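(* For every integer $n\ge 1$, the radial Hardy constant $c_n^{\mathrm{rad}}$ and the full Hardy constant $c_n$ of the Heisenberg group $\mathbb{H}^n$ with respect to the Carnot-Carathéodory distance $\delta$ from the origin satisfy $$c_n^{\mathrm{rad}}=0\qquad\text{and}\qquad c_n<n^2 .$$
   Context: The Heisenberg group $\mathbb{H}^n$ is $\mathbb{R}^{2n+1}$ with points $(x,y,z)\in\mathbb{R}^n\times\mathbb{R}^n\times\mathbb{R}$, endowed with the sub-Riemannian structure whose (horizontal) distribution $\mathcal{D}$ has orthonormal frame $$X_i=\partial_{x_i}-\frac{y_i}{2}\partial_z,\qquad Y_i=\partial_{y_i}+\frac{x_i}{2}\partial_z,\qquad i=1,\dots,n.$$ The metric on $\mathcal{D}$ making these fields orthonormal is denoted $\langle\cdot,\cdot\rangle$, with norm $|\cdot|$. A curve $\gamma:[0,1]\to\mathbb{H}^n$ is horizontal if it is absolutely continuous and $\dot\gamma(t)\in\mathcal{D}_{\gamma(t)}$ for a.e. $t$. The Carnot-Carathéodory distance from the origin is $\delta(p)=\inf\int_0^1|\dot\gamma(t)|\,dt$, the infimum being over horizontal curves $\gamma:[0,1]\to\mathbb{H}^n$ with $\gamma(0)=0$, $\gamma(1)=p$. It is smooth outside the center $\mathcal{Z}=\{x=y=0\}$, which has measure zero. The horizontal gradient is $\nabla_{\mathbb{H}}u=\sum_{i=1}^n\big((X_iu)X_i+(Y_iu)Y_i\big)$. Integration $dp$ is with respect to Lebesgue measure on $\mathbb{R}^{2n+1}$. The constants are $$c_n=\inf_{0\ne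 u\in C_c^\infty(\mathbb{H}^n\setminus\{0\})}\frac{\int_{\mathbb{H}^n}|\nabla_{\mathbb{H}}u|^2\,dp}{\int_{\mathbb{H}^n}|u|^2\delta^{-2}\,dp},$$ $$c_n^{\mathrm{rad}}=\sup\Big\{c\ge 0:\ \int_{\mathbb{H}^n}|\langle\nabla_{\mathbb{H}}u,\nabla_{\mathbb{H}}\delta\rangle|^2\,dp\ \ge\ c\int_{\mathbb{H}^n}\frac{|u|^2}{\delta^2}\,dp\ \text{ for all } u\in C_c^\infty(\mathbb{H}^n\setminus\{0\})\Big\}.$$ *)

(* Defs.v *)
From HB Require Import structures.
From mathcomp Require Import all_boot all_order all_algebra.
From mathcomp Require Import all_classical all_reals all_analysis.

Set Implicit Arguments.
Unset Strict Implicit.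
Unset Printing Implicit Defensive.

Import Order.TTheory GRing.Theory Num.Theory.
Import numFieldNormedType.Exports.

Local Open Scope classical_set_scope.
Local Open Scope ring_scope.

(* The library has Lebesgue measure on R only; on R^k it is built here as the
   k-fold product measure, on the product sigma-algebra of k-tuples. *)
Section lebesgue_tuple.
Context {R : realType}.

Section cons_measure.
Context {k : nat}.

Definition tcons (p : measurableTypeR R * k.-tuple (measurableTypeR R)) :
  k.+1.-tuple (measurableTypeR R) := [tuple of p.1 :: p.2].

Lemma measurable_tcons : measurable_fun setT tcons.
Proof. by apply: measurable_cons. Qed.

Context (mu : {sigma_finite_measure set (k.-tuple (measurableTypeR R)) -> \bar R}).

Definition cons_measure := pushforward (lebesgue_measure \x mu)%E tcons.

HB.instance Definition _ := Measure.copy cons_measure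
  (measure_function_pushforward__canonical__measure_function_Measure
    (lebesgue_measure \x mu)%E measurable_tcons).

Lemma cons_measure_sigma_finite : sigma_finite setT cons_measure.
Proof.
have /sigma_finiteP[F [TF ndF Foo]] := sigma_finiteT (@lebesgue_measure R).
have /sigma_finiteP[G [TG ndG Goo]] := sigma_finiteT mu.
pose uncons (t : k.+1.-tuple (measurableTypeR R)) :=
  (thead t, [tuple of behead t]).
have muncons : measurable_fun setT uncons.
  apply: measurable_fun_pair; first exact: measurable_tnth.
  exact: measurable_behead.
have tconsK : cancel tcons uncons.
  by case=> x t; rewrite /uncons /tcons theadE; congr pair; apply/val_inj.
exists (fun i => uncons @^-1` (F i `*` G i)).
  apply/esym/seteqP; split=> // t _.
  have [i _ Fi] : (\bigcup_i F i) (uncons t).1 by rewrite -TF.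
  have [j _ Gj] : (\bigcup_i G i) (uncons t).2 by rewrite -TG.
  exists (maxn i j) => //; split.
    by move: Fi; exact/subsetPset/ndF/leq_maxl.
  by move: Gj; exact/subsetPset/ndG/leq_maxr.
move=> i; have [mFi Fioo] := Foo i; have [mGi Gioo] := Goo i; split.
  by rewrite -[X in measurable X]setTI; apply: muncons => //; exact: measurableX.
rewrite /cons_measure /pushforward -comp_preimage (_ : uncons \o tcons = id).
  by rewrite preimage_id product_measure1E// lte_mul_pinfty// ge0_fin_numE.
exact/funext.
Qed.

HB.instance Definition _ := Measure_isSigmaFinite.Build _ _ _ cons_measure
  cons_measure_sigma_finite.

End cons_measure.

Fixpoint lebesgue_tuple (k : nat) :
    {sigma_finite_measure set (k.-tuple (measurableTypeR R)) -> \bar R} :=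
  match k with
  | 0 => \d_ [tuple]
  | k.+1 => cons_measure (lebesgue_tuple k)
  end.

Definition lebesgue_int (k : nat) (f : 'rV[R]_k -> \bar R) : \bar R :=
  (\int[lebesgue_tuple k]_t f (\row_i (tnth t i : R)))%E.

End lebesgue_tuple.

Section calculus.
Context {R : realType}.

Definition smooth (k : nat) (u : 'rV[R]_k -> R) :=
  forall (vs : seq 'rV[R]_k) (p : 'rV[R]_k),
    differentiable (foldr (fun v f => 'D_v f) u vs) p.

Definition abs_continuous01 (k : nat) (g : R -> 'rV[R]_k) :=
  forall e : R, 0 < e -> exists2 d : R, 0 < d &
    forall (m : nat) (a b : 'I_m -> R),
      (forall i, 0 <= a i <= b i /\ b i <= 1) ->
      trivIset setT (fun i => `]a i, b i[%classic) ->
      \sum_(i < m) (b i - a i) < d ->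
      \sum_(i < m) `|g (b i) - g (a i)| < e.

End calculus.

Section heisenberg.
Context {R : realType} {n : nat}.

(* A point (x, y, z) of R^n x R^n x R is stored as one row vector. *)
Notation heis := 'rV[R]_(n + n + 1).

Definition ix (i : 'I_n) : 'I_(n + n + 1) := lshift 1 (lshift n i).
Definition iy (i : 'I_n) : 'I_(n + n + 1) := lshift 1 (rshift n i).
Definition iz : 'I_(n + n + 1) := rshift (n + n) ord0.

Definition Xf (i : 'I_n) (p : heis) : heis :=
  delta_mx 0 (ix i) - (p 0 (iy i) / 2) *: delta_mx 0 iz.
Definition Yf (i : 'I_n) (p : heis) : heis :=
  delta_mx 0 (iy i) + (p 0 (ix i) / 2) *: delta_mx 0 iz.

Definition horizontal_at (p : heis) : set heis :=
  [set v | exists a b : 'I_n -> R,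
     v = \sum_(i < n) (a i *: Xf i p + b i *: Yf i p)].

(* Since X_i and Y_i have x- and y-components forming the canonical basis of
   R^2n, the coefficients of a horizontal vector in the frame are its x- and
   y-components: on each horizontal space this bilinear form is the metric for
   which the frame is orthonormal (lemmas hdot_XX to hdot_YY). It is only
   meaningful on horizontal vectors. *)
Definition hdot (v w : heis) : R :=
  \sum_(i < n) (v 0 (ix i) * w 0 (ix i) + v 0 (iy i) * w 0 (iy i)).

Definition hnorm (v : heis) : R := Num.sqrt (hdot v v).

Definition horizontal_curve (g : R -> heis) :=
  abs_continuous01 g /\
  {ae lebesgue_measure, forall t : R, t \in `[0, 1] ->
     derivable g t 1 /\ horizontal_at (g t) (derive1 g t)}.

Definition curve_length (g : R -> heis) : \bar R :=
  (\int[lebesgue_measure]_(t in `[0%R, 1%R]) (hnorm (derive1 g t))%:E)%E.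

Definition ccdist (p : heis) : R :=
  fine (ereal_inf [set curve_length g | g in
    [set g : R -> heis | [/\ horizontal_curve g, g 0 = 0 & g 1 = p]]]).

Definition hgrad (u : heis -> R) (p : heis) : heis :=
  \sum_(i < n) ('D_(Xf i p) u p *: Xf i p + 'D_(Yf i p) u p *: Yf i p).

(* Smooth functions with compact support in the complement of the origin,
   extended by zero. *)
Definition test_function (u : heis -> R) :=
  [/\ smooth u, compact (closure [set p | u p != 0])
    & ~ closure [set p | u p != 0] 0].

Definition energy (u : heis -> R) : \bar R :=
  lebesgue_int (fun p => (hnorm (hgrad u p) ^+ 2)%:E).

Definition radial_energy (u : heis -> R) : \bar R :=
  lebesgue_int (fun p => (`|hdot (hgrad u p) (hgrad ccdist p)| ^+ 2)%:E).

Definition hardy_weight (u : heis -> R) : \bar R :=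
  lebesgue_int (fun p => (`|u p| ^+ 2 / ccdist p ^+ 2)%:E).

Definition hardy_const : \bar R :=
  ereal_inf [set (energy u / hardy_weight u)%E | u in
    [set u : heis -> R | test_function u /\ u <> cst 0]].

Definition radial_hardy_const : \bar R :=
  ereal_sup [set c%:E | c in [set c : R | 0 <= c /\
    forall u, test_function u ->
      (c%:E * hardy_weight u <= radial_energy u)%E]].

Lemma ix_inj : injective ix.
Proof. by move=> i j /lshift_inj/lshift_inj. Qed.
Lemma iy_inj : injective iy.
Proof. by move=> i j /lshift_inj/rshift_inj. Qed.
Lemma ixy i j : (ix i == iy j) = false.
Proof. by rewrite (inj_eq (@lshift_inj _ _)) eq_lrshift. Qed.

Lemma Xf_ix i p j : Xf i p 0 (ix j) = (j == i)%:R.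
Proof.
by rewrite !mxE eqxx eq_lrshift /= mulr0 subr0 (inj_eq ix_inj).
Qed.
Lemma Xf_iy i p j : Xf i p 0 (iy j) = 0.
Proof. by rewrite !mxE eqxx eq_lrshift /= mulr0 subr0 eq_sym ixy. Qed.
Lemma Yf_ix i p j : Yf i p 0 (ix j) = 0.
Proof. by rewrite !mxE eqxx eq_lrshift /= mulr0 addr0 ixy. Qed.
Lemma Yf_iy i p j : Yf i p 0 (iy j) = (j == i)%:R.
Proof. by rewrite !mxE eqxx eq_lrshift /= mulr0 addr0 (inj_eq iy_inj). Qed.

Lemma hdot_XX i j p : hdot (Xf i p) (Xf j p) = (i == j)%:R.
Proof.
rewrite /hdot (bigD1 i)//= big1 => [|k /negPf ki].
  by rewrite !Xf_ix !Xf_iy mulr0 eqxx mul1r !addr0.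
by rewrite !Xf_ix !Xf_iy mulr0 ki mul0r addr0.
Qed.
Lemma hdot_XY i j p : hdot (Xf i p) (Yf j p) = 0.
Proof.
by rewrite /hdot big1// => k _; rewrite Yf_ix Xf_iy mulr0 mul0r addr0.
Qed.
Lemma hdot_YY i j p : hdot (Yf i p) (Yf j p) = (i == j)%:R.
Proof.
rewrite /hdot (bigD1 i)//= big1 => [|k /negPf ki].
  by rewrite !Yf_ix !Yf_iy mulr0 eqxx mul1r add0r addr0.
by rewrite !Yf_ix !Yf_iy mulr0 ki mul0r addr0.
Qed.

End heisenberg.

Arguments ccdist {R n} p.
Arguments hardy_const R n : clear implicits.
Arguments radial_hardy_const R n : clear implicits.

(* Main.v *)
Require Import Defs.
From mathcomp Require Import all_boot all_order all_algebra.
From mathcomp Require Import all_classical all_reals all_analysis.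
From mathcomp Require Import measurable_realfun ring lra.
Import Order.TTheory GRing.Theory Num.Theory.
Import numFieldNormedType.Exports.
Local Open Scope classical_set_scope.
Local Open Scope ring_scope.
Set Implicit Arguments.
Unset Strict Implicit.
Unset Printing Implicit Defensive.

(* Put rho = |x|^2 + |y|^2 and, for rho > 0, write z / rho as
   (psi - sin psi cos psi) / (4 sin^2 psi) with |psi| < pi. The distance is then
   sqrt rho * psi / sin psi: an arc of circle of half-aperture psi lifts to a
   curve of that length, and a calibration (a subsolution of the
   Hamilton-Jacobi equation along which arc length is the time) shows that no
   horizontal curve is shorter.

   Radial constant. Geodesics start at the origin and end on the center, and
   a = sin^2 psi / rho is constant along them. For u = chi(a) k(rho) the product
   of the gradients of u and of the distance involves k' only. A cutoff k which
   is logarithmic on exp(-2T) <= rho <= exp(-T) makes u vanish near both ends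
   of the geodesics at a cost O(1/T), even for n = 1.

   Full constant. For the gauge K = rho^2 + 16 z^2 one has
   |grad K|^2 = 16 rho K, so that u = K^(-n/4) satisfies
   |grad u|^2 = n^2 u^2 rho / K, whereas rho / K <= delta^(-2), strictly off the
   plane z = 0. Both sides are homogeneous: the gain of the strict inequality is
   proportional to the logarithm of the ratio of the two scales at which u is
   cut off, while the cost of the cutoffs stays bounded. *)

(** * Lower bound for the length of horizontal curves *)

(** The number n^2 is ((Q - 2) / 2)^2 for the homogeneous dimension Q = 2n + 2, and K^(-n/4) is the
    power -(Q - 2)/2 of the gauge. This exponent is critical: u^2 rho / K has degree -Q, so all
    dyadic scales count equally. The integral of u^2 rho / K is never evaluated: it bounds the
    energy (times n^2) from above and the weight from below, and only the surplus per scale matters.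
    Polar coordinates are replaced by coordinate boxes: cutoff costs and radial energies are
    dominated by finite sums of box indicators, surpluses and radial weights dominate such sums.

    For the lower bound on lengths, curves are only absolutely continuous, so the calibration must
    be shown monotone from an almost everywhere derivative. The creeping argument asks for an upper
    bound on increments only; this suits the calibration, where arc length is nondecreasing and its
    coefficient S is nonincreasing.

    The half-aperture is defined implicitly and degenerates at z = 0. The radial trial functions are
    supported in rho > 0, z > 0, where it solves an ordinary differential equation, so its
    smoothness is needed nowhere else. *)

Section creeping.
Context {R : realType}.
Implicit Types (F : R -> R) (a b t x y : R).

(** The endpoints lie on both sides of t, so the two one-sided slope bounds at t add up; no
    regularity of F elsewhere enters. *)
Lemma is_derive_slope F t l : is_derive t 1 F l -> forall e, 0 < e ->
  exists2 r, 0 < r & forall x y, x <= t <= y -> t - r < x -> y < t + r ->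
    F y - F x <= (l + e) * (y - x).
Proof.
move=> Ftl e e0.
have : h^-1 *: (F (h *: 1 + t) - F t) @[h --> (0:R)^'] --> l.
  by rewrite -(@derive_val _ _ _ _ _ _ _ Ftl); exact: (@ex_derive _ _ _ _ _ _ _ Ftl).
move=> /cvgrPdist_lt /(_ _ e0) [r /= r0 rP]; exists r => // x y /andP[xt ty] tx yt.
have up z : t <= z -> z < t + r -> F z - F t <= (l + e) * (z - t).
  rewrite le_eqVlt => /predU1P[->|tz zr]; first by rewrite !subrr mulr0.
  have /= := rP (z - t); rewrite /ball/= sub0r normrN gtr0_norm ?subr_gt0//.
  rewrite [_ *: 1]mulr1 subrK /GRing.scale/=.
  move=> /(_ _ _)/[!ltr_distlC]; case/(_ _ _)/andP; first lra.
    by rewrite subr_eq0 gt_eqF.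
  by move=> _ /ltW; rewrite mulrC ler_pdivrMr ?subr_gt0.
have dn z : z <= t -> t - r < z -> F t - F z <= (l + e) * (t - z).
  rewrite le_eqVlt => /predU1P[->|tz zr]; first by rewrite !subrr mulr0.
  have /= := rP (z - t); rewrite /ball/= sub0r normrN ltr0_norm ?subr_lt0//.
  rewrite [_ *: 1]mulr1 subrK /GRing.scale/=.
  move=> /(_ _ _)/[!ltr_distlC]; case/(_ _ _)/andP; first lra.
    by rewrite subr_eq0 lt_eqF.
  move=> _ /ltW; rewrite mulrC -mulrNN -invrN ler_pdivrMr; last lra.
  lra.
have := up y ty yt; have := dn x xt tx; lra.
Qed.

(* If the increments of F are controlled by those of an absolutely continuous
   curve, then F cannot increase on a null set: cover it by an open set U of
   small measure, and creep from 0 to 1 by intervals that either lie in U or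
   are short enough for the slope bound. *)
Lemma creeping k (g : R -> 'rV[R]_k) F (K : R) (N : set R) :
  abs_continuous01 g -> 0 <= K ->
  (forall a b, 0 <= a -> a <= b -> b <= 1 -> F b - F a <= K * `|g b - g a|) ->
  measurable N -> lebesgue_measure N = 0%E ->
  (forall t, 0 <= t <= 1 -> ~ N t -> exists2 l, l <= 0 & is_derive t 1 F l) ->
  F 1 <= F 0.
Proof.
move=> gac K0 FK mN N0 FN; rewrite -subr_le0; apply/ler_addgt0Pr => e' e'0.
(* One half of the error pays for the slopes off N, the other for the jumps across N. The divisor
   [K + 1] covers K = 0. *)
set e := e' / 2; have e0 : 0 < e by rewrite divr_gt0.
have K1 : 0 < K + 1 by lra.
have [d d0 dP] := gac (e / (K + 1)) (divr_gt0 e0 K1).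
have Noo : (lebesgue_measure N < +oo)%E by rewrite N0 ltry.
have [U [oU NU muU]] := lebesgue_regularity_outer mN Noo d0.
have {}muU : (lebesgue_measure U < d%:E)%E.
  apply: le_lt_trans muU; have -> : (lebesgue_measure U =
      lebesgue_measure (U `\` N) + lebesgue_measure (U `&` N))%E.
    have mU : measurable (U : set (measurableTypeR R)) by exact: open_measurable.
    exact: (@measureDI _ _ _ (@lebesgue_measure R) U N mU mN).
  rewrite (_ : lebesgue_measure (U `&` N) = 0%E) ?adde0//.
  apply/eqP; rewrite -measure_le0 -N0; apply: le_measure; rewrite ?inE//.
  exact: measurableI (open_measurable oU) mN.
(* A certificate for t lists the jumped intervals, newest first: they are ordered by [dj], lie in U,
   and their cost is measured by the increments of g. *)
pose dj (p q : R * R) := q.2 <= p.1.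
pose wf t (s : seq (R * R)) := [/\ pairwise dj s,
  (forall p, p \in s -> [/\ 0 <= p.1, p.1 <= p.2, p.2 <= t & `]p.1, p.2[ `<=` U]) &
  F t - F 0 <= e * t + K * \sum_(p <- s) `|g p.2 - g p.1|].
pose A := [set t | 0 <= t <= 1 /\ exists s, wf t s].
have step t : 0 <= t <= 1 -> exists2 r, 0 < r & forall x y, x <= t <= y ->
    t - r < x -> y < t + r -> A x -> y <= 1 -> A y.
  (* On N the move is recorded as a jump inside U; off N the nonpositive derivative pays for it and
     the list is unchanged. *)
  move=> t01; have [Nt|Nt] := pselect (N t).
    have /nbhs_ballP[r /= r0 rU] := open_nbhs_nbhs (conj oU (NU _ Nt)).
    exists r => // x y /andP[xt ty] tx yt [/andP[x0 x1] [s [s1 s2 s3]]] y1.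
    split; first by rewrite y1 andbT; lra.
    exists ((x, y) :: s); split.
    - rewrite /= s1 andbT; apply/allP => p /s2[_ _ + _]; exact.
    - move=> p; rewrite inE => /predU1P[->/=|/s2[? ? ? ?]].
        split => //; first lra.
        move=> z /=; rewrite in_itv/= => /andP[xz zy]; apply: rU.
        by rewrite /ball/= ltr_distlC; apply/andP; split; lra.
      by split => //; lra.
    - rewrite big_cons mulrDr/=; have := FK x y x0 (le_trans xt ty) y1.
      have : e * x <= e * y by rewrite ler_pM2l//; lra.
      lra.
  have [l l0 /is_derive_slope /(_ e e0) [r r0 rP]] := FN t t01 Nt.
  exists r => // x y xty tx yt [/andP[x0 x1] [s [s1 s2 s3]]] y1.
  have /andP[xt ty] := xty.
  split; first by rewrite y1 andbT; lra.
  exists s; split => //.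
    by move=> p /s2[? ? ? ?]; split => //; lra.
  have := rP x y xty tx yt.
  have : (l + e) * (y - x) <= e * (y - x) by apply: ler_wpM2r; lra.
  lra.
have A0 : A 0.
  split; first by rewrite lexx ler01.
  by exists [::]; split => //; rewrite big_nil subrr !mulr0 addr0.
have hA : has_sup A.
  by split; [exists 0 | exists 1 => x [/andP[]]].
have sA : 0 <= sup A <= 1.
  apply/andP; split; first exact: (ub_le_sup hA.2).
  by apply: ge_sup; [exists 0 | move=> x [/andP[]]].
have [r r0 rP] := step _ sA.
have [x Ax xs] := sup_adherent r0 hA.
have xsA : x <= sup A by apply: (ub_le_sup hA.2).
(* The move at sup A starts from a point of A within its radius, so it reaches sup A, and goes
   beyond it if sup A < 1. *)
have A1 : A 1.
  have [sA1|sA1] := leP 1 (sup A).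
    have -> : 1 = sup A by apply/eqP; rewrite eq_le sA1; case/andP: sA.
    by apply: (rP x) => //; rewrite ?xsA ?lexx//; [lra|case/andP: sA].
  pose y := Num.min 1 (sup A + r / 2).
  have ys : sup A < y by rewrite lt_min sA1/=; lra.
  have Ay : A y.
    apply: (rP x) => //; first by rewrite xsA ltW.
      by rewrite gt_min; apply/orP; right; lra.
    by rewrite ge_min lexx.
  by have := ub_le_sup hA.2 Ay; rewrite leNgt ys.
case: A1 => _ [s [s1 s2 s3]].
have sU (i : 'I_(size s)) := s2 _ (mem_nth (0, 0) (ltn_ord i)).
pose a (i : 'I_(size s)) := (nth (0, 0) s i).1.
pose b (i : 'I_(size s)) := (nth (0, 0) s i).2.
have tI : trivIset setT (fun i => `]a i, b i[%classic).
  apply/trivIsetP => i j _ _; wlog ij : i j / (i < j)%N => [wl ij|].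
    have [|] := ltnP i j; first by move/wl; apply.
    rewrite leq_eqVlt => /predU1P[/val_inj ji|/wl]; first by rewrite ji eqxx in ij.
    by rewrite setIC; apply; rewrite eq_sym.
  move=> _; have /(pairwiseP (0, 0))/(_ i j) := s1.
  rewrite !inE/= => /(_ (ltn_ord _) (ltn_ord _) ij); rewrite /dj => ba.
  rewrite -subset0 => z [/=]; rewrite !in_itv/= /a /b => /andP[za _] /andP[_ zb].
  by have := lt_le_trans zb ba; rewrite ltNge (ltW za).
have sumd : \sum_(i < size s) (b i - a i) < d.
  rewrite -lte_fin; apply: le_lt_trans muU.
  have -> : ((\sum_(i < size s) (b i - a i))%:E =
      \sum_(i < size s) lebesgue_measure `]a i, b i[%classic)%E.
    rewrite -sumEFin; apply: eq_bigr => i _; rewrite lebesgue_measure_itv/= lte_fin.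
    by have [_ + _ _] := sU i; rewrite le_eqVlt /a /b => /predU1P[->|->//];
      rewrite ltxx subrr.
  have mI i : measurable (`]a i, b i[%classic : set (measurableTypeR R)) by [].
  have mB : measurable (\big[setU/set0]_(i < size s) `]a i, b i[%classic
    : set (measurableTypeR R)) by apply: bigsetU_measurable => i _.
  rewrite -measure_semi_additive_ord//.
  apply: le_measure; rewrite ?inE//; first exact: open_measurable.
  elim/big_ind: _ => [//|X Y XU YU z [/XU|/YU]//|i _].
  by have [] := sU i.
have /ltW := dP _ a b (fun i => ltac:(by have [? ? ? _] := sU i; split=> //; apply/andP)) tI sumd.
rewrite ler_pdivlMr// => sume.
have sumE : \sum_(p <- s) `|g p.2 - g p.1| = \sum_(i < size s) `|g (b i) - g (a i)|.
  by rewrite (big_nth (0, 0)) big_mkord.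
rewrite sumE in s3; set S := \sum_(i < _) _ in sume s3.
have S0 : 0 <= S by apply: sumr_ge0.
have -> : 0 + e' = e * 1 + e by rewrite /e; lra.
by apply: le_trans s3 _; rewrite lerD2l; lra.
Qed.

End creeping.

(* No measurability is needed: the integral of a nonnegative function is a
   supremum over the simple functions below it. *)
Lemma ge0_le_integralT d (T : measurableType d) (R : realType)
    (mu : {measure set T -> \bar R}) (A B : set T) (f g : T -> \bar R) :
  (forall x, A x -> 0 <= f x)%E -> (forall x, B x -> 0 <= g x)%E ->
  (forall x, A x -> B x /\ (f x <= g x)%E) ->
  (\int[mu]_(x in A) f x <= \int[mu]_(x in B) g x)%E.
Proof.
move=> f0 g0 fg; rewrite !ge0_integralE//; apply: ereal_sup_le => _ /= [h hf <-].
exists h => //= x; apply: le_trans (hf x) _; rewrite !patchE.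
have [xA|xA] := boolP (x \in A); last by case: ifPn => // /set_mem/g0.
by have [/mem_set -> ] := fg x (set_mem xA).
Qed.

(** * Arc length and regularity of absolutely continuous curves *)

Section arc_length.
Context {R : realType}.
Notation mu := (@lebesgue_measure R).

(** The speed is known to be measurable on D only, so s integrates [f \_ D]. Its final value is at
    most the length, the right direction for a lower bound, and Lebesgue differentiation gives its
    derivative almost everywhere on D. *)
Lemma arc_length_function (f : R -> R) (D : set R) :
  measurable D -> D `<=` `[0, 1] -> @measurable_fun _ _ (measurableTypeR R) R D f -> (forall t, 0 <= f t) ->
  (\int[mu]_(t in `[0%R, 1%R]) (f t)%:E < +oo)%E ->
  exists s : R -> R, [/\ s 0 = 0, {homo s : x y / x <= y},
    ((s 1)%:E <= \int[mu]_(t in `[0%R, 1%R]) (f t)%:E)%E &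
    {ae mu, forall t, 0 < t -> D t -> is_derive t 1 s (f t)}].
Proof.
move=> mD D01 mf f0 foo.
pose h := f \_ D; have h0 t : 0 <= h t by rewrite /h patchE; case: ifP.
have mh : measurable_fun setT h by exact/(measurable_restrictT _ _).1.
have mEh (A : set (measurableTypeR R)) : measurable_fun A (EFin \o h).
  by apply/measurable_EFinP; exact: measurable_funTS.
have hle (A : set (measurableTypeR R)) :
    (\int[mu]_(t in A) (h t)%:E <= \int[mu]_(t in `[0%R, 1%R]) (f t)%:E)%E.
  rewrite integral_mkcond.
  have hD : (\int[mu]_(t in D) (f t)%:E <= \int[mu]_(t in `[0%R, 1%R]) (f t)%:E)%E.
    apply: ge0_le_integralT => [x _|x _|x Dx]; rewrite ?lee_fin//.
    by split; [exact: D01|].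
  apply: le_trans hD; rewrite [leRHS]integral_mkcond.
  apply: ge0_le_integralT => x _.
  - by apply: erestrict_ge0 => y; rewrite lee_fin.
  - by apply: erestrict_ge0 => y; rewrite lee_fin.
  split=> //; rewrite !patchE /h patchE; case: ifP => _; case: ifP => //;
    by rewrite lee_fin.
have ih (A : set (measurableTypeR R)) : measurable A -> mu.-integrable A (EFin \o h).
  move=> mA; apply/integrableP; split; first exact: mEh.
  apply: le_lt_trans foo; under eq_integral do rewrite /= ger0_norm//.
  exact: hle.
pose s x := (\int[mu]_(t in `[0%R, x]) h t)%R.
have sE x : (s x)%:E = (\int[mu]_(t in `[0%R, x]) (h t)%:E)%E.
  by rewrite /s /Rintegral fineK//; apply: integrable_fin_num => //; exact: ih.
exists s; split.
- by rewrite /s set_itv1 Rintegral_set1.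
- move=> x y xy; rewrite -lee_fin !sE.
  apply: ge0_le_integralT => [t _|t _|t /= p]; rewrite ?lee_fin//; split=> //.
  by move: p; apply: subset_itvl; rewrite bnd_simp.
- by rewrite sE; exact: hle.
have : locally_integrable [set: R] h.
  by apply: open_integrable_locally; [exact: openT|exact: ih].
move=> /(FTC1 (a := BLeft 0) (fun y => ih _ (measurable_itv _))).
apply: filterS; first exact: (ae_filter_ringOfSetsType mu).
move=> t /= + t0 Dt.
rewrite lte_fin => /(_ t0)[ds s'E].
split=> //; by rewrite -derive1E s'E /h patchE mem_set.
Qed.

(** Curves are arbitrary outside [0, 1]; precomposition with this retraction makes them continuous
    on the line. *)
Definition clamp (x : R) : R := Num.max 0 (Num.min 1 x).

Lemma clamp01 x : 0 <= clamp x <= 1.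
Proof.
by rewrite /clamp le_max lexx/= ge_max ler01/= ge_min lexx.
Qed.

Lemma clamp_id x : 0 <= x <= 1 -> clamp x = x.
Proof. by move=> /andP[x0 x1]; rewrite /clamp (min_idPr x1) (max_idPr x0). Qed.

Lemma clamp_lip x y : x <= y -> clamp x <= clamp y <= clamp x + (y - x).
Proof.
move=> xy; rewrite /clamp; apply/andP; split;
  case: (leP 1 x) => ?; case: (leP 1 y) => ?; case: (leP (0 : R) 1) => ?;
  case: (leP 0 x) => ?; case: (leP 0 y) => ? //; lra.
Qed.

Lemma abs_continuous01_dist k (g : R -> 'rV[R]_k) e : abs_continuous01 g -> 0 < e ->
  exists2 d : R, 0 < d & forall a b, 0 <= a -> a <= b -> b <= 1 -> b - a < d ->
    `|g b - g a| < e.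
Proof.
move=> gac e0; have [d d0 dP] := gac _ e0; exists d => // a b a0 ab b1 bad.
have := dP 1%N (fun=> a) (fun=> b); rewrite !big_ord1; apply => //.
- by move=> _; rewrite a0 ab.
- by apply/trivIsetP => i j _ _; rewrite (ord1 i) (ord1 j) eqxx.
Qed.

Lemma abs_continuous01_clamp k (g : R -> 'rV[R]_k) : abs_continuous01 g ->
  continuous (g \o clamp).
Proof.
move=> gac x; apply/cvgrPdist_lt => e e0.
have [d d0 dP] := abs_continuous01_dist gac e0.
near=> y.
have : `|x - y| < d by near: y; exact: cvgr_dist_lt.
have [xy|/ltW yx] := leP x y.
- rewrite ler0_norm ?subr_le0// opprB distrC => h.
  have /andP[? ?] := clamp_lip xy; have /andP[? ?] := clamp01 x.
  by have /andP[? ?] := clamp01 y; apply: dP => //; lra.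
- rewrite ger0_norm ?subr_ge0// => h.
  have /andP[? ?] := clamp_lip yx; have /andP[? ?] := clamp01 x.
  by have /andP[? ?] := clamp01 y; apply: dP => //; lra.
Unshelve. all: by end_near. Qed.

Lemma abs_continuous01_bounded k (g : R -> 'rV[R]_k) : abs_continuous01 g ->
  exists2 M : R, 0 <= M & forall t, 0 <= t <= 1 -> `|g t| <= M.
Proof.
move=> gac; have gc := abs_continuous01_clamp gac.
have : compact [set (g \o clamp) t | t in `[0, 1]%classic].
  by apply: continuous_compact; [exact: continuous_subspaceT|exact: segment_compact].
move=> /compact_bounded [M [_ MP]].
exists (`|M| + 1); first by rewrite addr_ge0.
move=> t t01; rewrite -[t]clamp_id//; apply: MP.
  by rewrite ltr_pwDr// ler_norm.
by exists t => //=; rewrite in_itv.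
Qed.

(* On the set where the curve is differentiable, its derivative is the limit of
   the measurable functions [m (g (t + 1/m) - g t)]. *)
Lemma measurable_derive1_coord k (g : R -> 'rV[R]_k) (D : set R) (j : 'I_k) :
  abs_continuous01 g -> D `<=` `]0, 1[ -> (forall t, D t -> derivable g t 1) ->
  @measurable_fun _ _ (measurableTypeR R) R D (fun t => derive1 g t 0 j).
Proof.
move=> gac D01 gD.
pose c (t : R) := g (clamp t) 0 j.
have cc : continuous c.
  move=> t; apply: (@continuous_comp _ _ _ (g \o clamp) (fun M : 'rV[R]_k => M 0 j)).
    exact: abs_continuous01_clamp.
  exact: coord_continuous.
apply: (@measurable_fun_cvg _ (measurableTypeR R) R _ (fun m (t : R) => m.+1%:R * (c (t + m.+1%:R^-1) - c t))).
  move=> m; apply: measurable_funTS; apply: continuous_measurable_fun => t.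
  apply: cvgM; first exact: cvg_cst.
  apply: cvgB; last exact: cc.
  apply: (@continuous_comp _ _ _ (fun t => t + _) c); last exact: cc.
  by apply: cvgD; [exact: cvg_id|exact: cvg_cst].
move=> t Dt; have := gD _ Dt => dg.
have /derivable_mxP/(_ 0 j)/cvg_dnbhs_at_right/cvg_at_rightP := dg.
move=> /(_ harmonic) cv.
have {}cv := cv (conj (@harmonic_gt0 R) (@cvg_harmonic R)).
rewrite derive1E derive_mx// mxE.
have /D01 := Dt; rewrite /= in_itv/= => /andP[t0 t1].
have h : 0 < 1 - t by rewrite subr_gt0.
apply: cvg_trans cv; apply: near_eq_cvg; near=> m.
have m0 : 0 < m.+1%:R^-1 :> R by [].
have mt : m.+1%:R^-1 < 1 - t.
  near: m.
  exact: (@cvgr_lt R nat _ _ harmonic 0 (@cvg_harmonic R) _ h).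
rewrite /= /harmonic invrK [_ *: 1]mulr1 /c (addrC t) !clamp_id//.
- by rewrite !ltW.
- apply/andP; split; first by rewrite addr_ge0// ltW.
  by rewrite -lerBrDr ltW.
Unshelve. all: by end_near. Qed.

End arc_length.

(** * Rules for directional derivatives *)

Section derivation_rules.
Context {R : realType} {V : normedModType R}.
Implicit Types (f g : V -> R) (x v : V).

Lemma is_derive_add f g x v df dg : is_derive x v f df -> is_derive x v g dg ->
  is_derive x v (fun t => f t + g t) (df + dg).
Proof. by move=> fd gd; exact: is_deriveD. Qed.

Lemma is_derive_mul f g x v df dg : is_derive x v f df -> is_derive x v g dg ->
  is_derive x v (fun t => f t * g t) (df * g x + f x * dg).
Proof.
move=> fd gd; apply: is_derive_eq (is_deriveM fd gd) _.
by rewrite addrC /GRing.scale/= (mulrC df).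
Qed.

Lemma is_derive_opp f x v df : is_derive x v f df ->
  is_derive x v (fun t => - f t) (- df).
Proof. by move=> fd; exact: is_deriveN. Qed.

Lemma is_derive_scale f c x v df : is_derive x v f df ->
  is_derive x v (fun t => c * f t) (c * df).
Proof.
move=> fd; apply: is_derive_eq (is_derive_mul (is_derive_cst c x v) fd) _.
by rewrite mul0r add0r.
Qed.

(** Restricting to the line [s *: v + x] reduces this to the chain rule in one variable. *)
Lemma is_derive_chain (h : R -> R) f x v dh df : is_derive (f x) 1 h dh ->
  is_derive x v f df -> is_derive x v (fun t => h (f t)) (dh * df).
Proof.
move=> hd fd.
pose k (s : R) := f (s *: v + x).
have kd : is_derive (0 : R) 1 k df.
  split; first exact: (derivable1P _ _ _).1 (@ex_derive _ _ _ _ _ _ _ fd).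
  have := @derive_val _ _ _ _ _ _ _ fd; rewrite /derive /k /= => <-.
  rewrite [in LHS](_ : (fun _ => _) = fun s => s^-1 *: (f (s *: v + x) - f x))//.
  by apply/funext => s /=; rewrite !addr0 scale0r add0r [_ *: (1 : R)]mulr1.
have k0 : k 0 = f x by rewrite /k scale0r add0r.
rewrite -k0 in hd.
have hk := is_derive1_comp hd kd.
split; first exact: (derivable1P _ _ _).2 (@ex_derive _ _ _ _ _ _ _ hk).
have := @derive_val _ _ _ _ _ _ _ hk; rewrite /derive /k /= => <-.
rewrite [in RHS](_ : (fun _ => _) =
  fun s => s^-1 *: (h (f (s *: v + x)) - h (f x)))//.
by apply/funext => s /=; rewrite !addr0 scale0r add0r [_ *: (1 : R)]mulr1.
Qed.

Lemma is_derive_coord m (M : V -> 'rV[R]_m) x v (j : 'I_m) :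
  derivable M x v -> is_derive x v (fun t => M t 0 j) ('D_v M x 0 j).
Proof.
move=> Md; split; first by move/derivable_mxP : Md; exact.
by rewrite (derive_mx Md) mxE.
Qed.

End derivation_rules.

Lemma is_derive_sqr {R : realType} (x : R) : is_derive x 1 (fun t => t ^+ 2) (2 * x).
Proof.
apply: is_derive_eq (is_derive_mul (is_derive_id x 1) (is_derive_id x 1)) _.
by rewrite mul1r mulr1 mulr_natl.
Qed.

Lemma is_derive_inv {R : realType} (x : R) : x != 0 ->
  is_derive x 1 (fun t => t^-1) (- x ^- 2).
Proof.
move=> x0; apply: is_derive_eq (is_deriveV x0 (is_derive_id x 1)) _.
by rewrite /GRing.scale/= mulr1.
Qed.

(** * Calibration of horizontal curves *)

Section length_lower_bound.
Context {R : realType} {n : nat}.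
Notation heis := 'rV[R]_(n + n + 1).
Implicit Types (p q v : heis) (g : R -> heis).

Notation rho p := (hdot p p).
Notation zc p := (p 0 (iz (n := n))).

Definition frame p (a b : 'I_n -> R) : heis :=
  \sum_(i < n) (a i *: Xf i p + b i *: Yf i p).

Lemma frame_entry p a b (i : 'I_n) k : (a *: Xf i p + b *: Yf i p) 0 k =
  a * Xf i p 0 k + b * Yf i p 0 k.
Proof. by rewrite mxE; congr (_ + _); rewrite mxE. Qed.

Lemma frame_ix p a b j : frame p a b 0 (ix j) = a j.
Proof.
rewrite summxE (bigD1 j)//= big1 => [|k /negPf kj]; rewrite frame_entry Xf_ix Yf_ix.
  by rewrite eqxx mulr1 mulr0 !addr0.
by rewrite eq_sym kj !mulr0 addr0.
Qed.

Lemma frame_iy p a b j : frame p a b 0 (iy j) = b j.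
Proof.
rewrite summxE (bigD1 j)//= big1 => [|k /negPf kj]; rewrite frame_entry Xf_iy Yf_iy.
  by rewrite eqxx mulr1 mulr0 addr0 add0r.
by rewrite eq_sym kj !mulr0 addr0.
Qed.

Lemma frame_iz p a b :
  zc (frame p a b) = \sum_(i < n) (p 0 (ix i) * b i - p 0 (iy i) * a i) / 2.
Proof.
rewrite summxE; apply: eq_bigr => i _; rewrite frame_entry !mxE !eqxx !eq_rlshift/=.
by rewrite mulr0n; field.
Qed.

Lemma heis_coordP p q : (forall i, p 0 (ix i) = q 0 (ix i)) ->
  (forall i, p 0 (iy i) = q 0 (iy i)) -> zc p = zc q -> p = q.
Proof.
move=> hx hy hz; apply/rowP => j; rewrite -[j]splitK.
case: (fintype.split _) => [k|k] /=; last by rewrite (ord1 k); exact: hz.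
by rewrite -[k]splitK; case: (fintype.split _) => i /=; [exact: hx|exact: hy].
Qed.

(** The distribution is the kernel of the contact form dz - sum_i (x_i dy_i - y_i dx_i) / 2. *)
Lemma horizontal_atP p v : horizontal_at p v <->
  zc v = \sum_(i < n) (p 0 (ix i) * v 0 (iy i) - p 0 (iy i) * v 0 (ix i)) / 2.
Proof.
split=> [[a [b ->]]|hz].
  rewrite -/(frame p a b) frame_iz; apply: eq_bigr => i _.
  by rewrite frame_ix frame_iy.
exists (fun i => v 0 (ix i)), (fun i => v 0 (iy i)); rewrite -/(frame _ _ _).
by apply: heis_coordP => [i|i|]; rewrite ?frame_ix ?frame_iy ?frame_iz.
Qed.

Lemma hdot_ge0 v : 0 <= hdot v v.
Proof. by apply: sumr_ge0 => i _; rewrite addr_ge0// -expr2 sqr_ge0. Qed.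

Lemma hnorm_ge0 v : 0 <= hnorm v. Proof. exact: sqrtr_ge0. Qed.

Lemma hnorm_sqr v : hnorm v ^+ 2 = hdot v v.
Proof. by rewrite sqr_sqrtr// hdot_ge0. Qed.

(** The norm is the maximum of the coordinates, so each of the 2n squares is 2M-Lipschitz on the
    ball of radius M. *)
Lemma rho_diff_le (M : R) p q : `|p| <= M -> `|q| <= M ->
  `|rho p - rho q| <= (n%:R * 4 * M) * `|p - q|.
Proof.
have cle j (u : heis) : `|u 0 j| <= `|u|.
  by rewrite [leRHS]/Num.Def.normr/= mx_normrE; apply: (le_bigmax _ _ (0, j)).
move=> pM qM; rewrite /hdot -sumrB (le_trans (ler_norm_sum _ _ _))//.
have -> : n%:R * 4 * M * `|p - q| = \sum_(i < n) (4 * M * `|p - q|).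
  by rewrite sumr_const card_ord -[RHS]mulr_natl; ring.
apply: ler_sum => i _.
have one j : `|p 0 j * p 0 j - q 0 j * q 0 j| <= 2 * M * `|p - q|.
  have -> : p 0 j * p 0 j - q 0 j * q 0 j = (p 0 j + q 0 j) * (p - q) 0 j.
    by rewrite !mxE; ring.
  rewrite normrM ler_pM// (le_trans (ler_normD _ _))//.
  by have := cle j p; have := cle j q; lra.
have -> : p 0 (ix i) * p 0 (ix i) + p 0 (iy i) * p 0 (iy i) -
   (q 0 (ix i) * q 0 (ix i) + q 0 (iy i) * q 0 (iy i)) =
   (p 0 (ix i) * p 0 (ix i) - q 0 (ix i) * q 0 (ix i)) +
   (p 0 (iy i) * p 0 (iy i) - q 0 (iy i) * q 0 (iy i)) by ring.
rewrite (le_trans (ler_normD _ _))//.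
by have := one (ix i); have := one (iy i); lra.
Qed.

Lemma is_derive_rho (V : normedModType R) (h : V -> heis) (x v : V) :
  derivable h x v ->
  is_derive x v (fun s => rho (h s)) (2 * hdot (h x) ('D_v h x)).
Proof.
move=> hd; have cd j := is_derive_coord j hd.
have := is_derive_sum (fun i : 'I_n => is_derive_add
  (is_derive_mul (cd (ix i)) (cd (ix i))) (is_derive_mul (cd (iy i)) (cd (iy i)))).
rewrite (_ : \sum_(i < n) _ = fun s => rho (h s)); last first.
  by apply/funext => s; rewrite fct_sumE.
move=> e; apply: is_derive_eq e _.
by rewrite /hdot mulr_sumr; apply: eq_bigr => i _; ring.
Qed.

(* Weighted AM-GM with weight [hnorm v / 2] in place of Cauchy-Schwarz. *)
Lemma calibration_le p v (S r : R) : horizontal_at p v ->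
  2 * S * hdot p v + 2 * r * zc v <= ((S ^+ 2 + r ^+ 2 / 4) * rho p + 1) * hnorm v.
Proof.
move=> hv; rewrite ((horizontal_atP _ _).1 hv).
have [v0|vN0] := eqVneq (hnorm v) 0.
  have /eqP : \sum_(i < n) (v 0 (ix i) ^+ 2 + v 0 (iy i) ^+ 2) = 0.
    by move: (hnorm_sqr v); rewrite v0 expr0n/= /hdot => <-.
  rewrite psumr_eq0 => [/allP v0i|i _]; last by rewrite addr_ge0 ?sqr_ge0.
  have vi i : v 0 (ix i) = 0 /\ v 0 (iy i) = 0.
    have := v0i i (mem_index_enum _).
    by rewrite implyTb paddr_eq0 ?sqr_ge0// !sqrf_eq0 => /andP[/eqP ? /eqP].
  rewrite v0 mulr0 /hdot !big1 ?mulr0 ?addr0// => i _;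
    by have [-> ->] := vi i; ring.
have v0 : 0 < hnorm v by rewrite lt_def vN0 hnorm_ge0.
have -> : ((S ^+ 2 + r ^+ 2 / 4) * rho p + 1) * hnorm v =
    (S ^+ 2 + r ^+ 2 / 4) * hnorm v * rho p + hdot v v / hnorm v.
  by rewrite -(hnorm_sqr v); field.
rewrite /hdot !mulr_sumr mulr_suml -!big_split/=; apply: ler_sum => i _.
set x := p 0 (ix i); set y := p 0 (iy i); set a := v 0 (ix i); set b := v 0 (iy i).
set h := hnorm v in v0 vN0 *; rewrite -subr_ge0.
(* Equality holds when the unit vector v / h has coordinates S x - r y / 2 and S y + r x / 2, as
   along the calibrated geodesic. *)
have -> : (S ^+ 2 + r ^+ 2 / 4) * h * (x * x + y * y) + (a * a + b * b) / h -
    (2 * S * (x * a + y * b) + 2 * r * ((x * b - y * a) / 2)) =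
  (((S * x - r * y / 2) * h - a) ^+ 2 + ((S * y + r * x / 2) * h - b) ^+ 2) / h.
  by field.
by rewrite divr_ge0 ?addr_ge0 ?sqr_ge0 ?(ltW v0).
Qed.


Lemma lebesgue_null_setU (A B : set (measurableTypeR R)) :
  measurable A -> measurable B -> lebesgue_measure A = 0%E ->
  lebesgue_measure B = 0%E -> lebesgue_measure (A `|` B) = 0%E.
Proof.
move=> mA mB A0 B0; apply/eqP; rewrite -measure_le0.
have : (lebesgue_measure (A `|` B) <= lebesgue_measure A + lebesgue_measure B)%E.
  exact: (@measureU2 _ _ _ (@lebesgue_measure R) A B mA mB).
by rewrite A0 B0 adde0.
Qed.

(** The almost everywhere clause provides a measurable null set containing the bad points. D is its
    complement in the open interval, where small forward difference quotients stay inside [0, 1]. *)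
Lemma horizontal_curve_regular g : horizontal_curve g ->
  exists D : set (measurableTypeR R), [/\ measurable D, D `<=` `]0, 1[,
    lebesgue_measure (`[0%R, 1%R] `\` D) = 0%E,
    (forall t, D t -> derivable g t 1 /\ horizontal_at (g t) (derive1 g t)) &
    @measurable_fun _ _ (measurableTypeR R) R D (fun t => hnorm (derive1 g t))].
Proof.
move=> [gac [N [mN N0 gN]]].
exists (`]0%R, 1%R[ `\` N).
have gD t : (`]0%R, 1%R[ `\` N) t ->
    derivable g t 1 /\ horizontal_at (g t) (derive1 g t).
  move=> [t01 Nt]; apply/not_notP => ngt; apply: Nt; apply: gN => /= h; apply: ngt.
  by apply: h; apply: subset_itv_oo_cc.
split; [exact: measurableD|by move=> t []| |exact: gD|].
- have mN01 : measurable (N `|` ([set 0] `|` [set 1]) : set (measurableTypeR R)).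
    by apply: measurableU => //; apply: measurableU; exact: measurable_set1.
  apply: (subset_measure0 _ mN01); first by do 2 apply: measurableD => //.
    move=> t /= [t01 nt]; apply/not_notP => nt'; apply: nt; split; last first.
      by move=> Nt; apply: nt'; left.
    move: t01; rewrite !in_itv/= => /andP[t0 t1]; rewrite !lt_neqAle t0 t1 !andbT.
    by apply/andP; split; apply/eqP => te; apply: nt'; right; [left|right].
  have m1 (x : R) := measurable_set1 x.
  apply: lebesgue_null_setU => //; first exact: measurableU.
  by apply: lebesgue_null_setU => //; rewrite lebesgue_measure_set1.
- apply: (@measurableT_comp _ _ _ _ _ _ (@Num.sqrt R)).
    by apply: continuous_measurable_fun; exact: sqrt_continuous.
  apply: measurable_sum => i; apply: measurable_funD; apply: measurable_funM;
    by apply: measurable_derive1_coord => // t /gD[].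
Qed.

(* [S (s + eta) rho + 2 r z - s], with [s] the arc length, is nonincreasing along
   any horizontal curve because [S] solves the Riccati equation
   [S' = - (S^2 + r^2 / 4)]. A curve shorter than [delta] would make it end
   above its initial value 0. *)
Lemma curve_length_ge (S : R -> R) (r delta : R) p g :
  0 < delta ->
  (forall x, 0 < x <= delta -> is_derive x 1 S (- (S x ^+ 2 + r ^+ 2 / 4))) ->
  S delta * rho p + 2 * r * zc p = delta ->
  horizontal_curve g -> g 0 = 0 -> g 1 = p -> (delta%:E <= curve_length g)%E.
Proof.
move=> delta0 Sd Sp hg g0 g1.
have [D [mD D01 D0 gD mf]] := horizontal_curve_regular hg.
have [gac _] := hg.
have [->|] := eqVneq (curve_length g) +oo%E; first exact: leey.
rewrite -ltey => Loo.
have [|s [s0 smon sL sd]] := arc_length_function mD _ mf (fun t => hnorm_ge0 _) Loo.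
  by move=> t /D01; apply: subset_itv_oo_cc.
apply: le_trans sL; rewrite lee_fin leNgt; apply/negP => sdelta.
(* S may blow up at 0. The shift keeps its argument in [eta, delta] and makes it end exactly at
   delta. *)
pose eta := delta - s 1; have eta0 : 0 < eta by rewrite subr_gt0.
pose F t := S (s t + eta) * rho (g t) + 2 * r * zc (g t) - s t.
have [M M0 gM] := abs_continuous01_bounded gac.
have s01 t : 0 <= t <= 1 -> eta <= s t + eta <= delta.
  move=> /andP[t0 t1]; have := smon _ _ t0; have := smon _ _ t1.
  by rewrite /eta s0; lra.
have Sc x : 0 < x <= delta -> {for x, continuous S}.
  move=> /Sd h; apply: differentiable_continuous; apply/derivable1_diffP.
  exact: (@ex_derive _ _ _ _ _ _ _ h).
(* The Riccati equation makes S nonincreasing, which yields both its bound on [eta, delta] and the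
   sign of its increments. *)
have Smon x y : eta <= x -> x <= y -> y <= delta -> S y <= S x.
  move=> ex xy yd; have xyd z : x <= z <= y -> 0 < z <= delta by lra.
  apply: (@ler0_derive1_le_cc R S x y) => //; rewrite ?in_itv/= ?lexx ?xy//.
  - move=> z; rewrite in_itv/= => /andP[xz zy].
    have /Sd h : 0 < z <= delta by apply: xyd; rewrite !ltW.
    exact: (@ex_derive _ _ _ _ _ _ _ h).
  - move=> z; rewrite in_itv/= => /andP[xz zy].
    have /Sd h : 0 < z <= delta by apply: xyd; rewrite !ltW.
    rewrite derive1E (@derive_val _ _ _ _ _ _ _ h) oppr_le0.
    by rewrite addr_ge0 ?divr_ge0 ?sqr_ge0.
  - apply: continuous_in_subspaceT => z; rewrite inE/= in_itv/= => h.
    by apply: Sc; exact: xyd.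
have F0 : F 0 = 0.
  by rewrite /F g0 s0 /hdot big1 => [|i _]; rewrite !mxE; ring.
have F1 : F 1 = delta - s 1.
  by rewrite /F g1 (_ : s 1 + eta = delta) ?Sp// /eta; ring.
suff : F 1 <= F 0 by rewrite F0 F1 subr_le0 leNgt sdelta.
pose B := `|S eta| + `|S delta|.
have SB x : eta <= x <= delta -> `|S x| <= B.
  move=> /andP[ex xd]; have := Smon _ _ (lexx _) ex xd; have := Smon _ _ ex xd (lexx _).
  rewrite /B ler_norml => h1 h2; have := ler_norm (S eta).
  have := lerNnormlW (lexx `|S delta|); have := normr_ge0 (S eta).
  by have := normr_ge0 (S delta); lra.
have [N' [mN' N'0 sN']] := sd.
pose N := (`[0%R, 1%R] `\` D) `|` N' : set (measurableTypeR R).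
apply: (@creeping _ _ g F (B * (n%:R * 4 * M) + `|2 * r|) N gac).
- by rewrite addr_ge0// mulr_ge0 ?addr_ge0// !mulr_ge0.
- move=> a b a0 ab b1.
  have a01 : 0 <= a <= 1 by rewrite a0 (le_trans ab).
  have b01 : 0 <= b <= 1 by rewrite b1 (le_trans a0 ab).
  have /andP[sa1 sa2] := s01 _ a01; have /andP[sb1 sb2] := s01 _ b01.
  have sab := smon _ _ ab.
  (* The increments of S (s + eta) and of - s are nonpositive, so those of F are bounded above
     through g alone, as [creeping] asks. *)
  have h1 : S (s b + eta) * rho (g b) <= S (s a + eta) * rho (g b).
    by apply: ler_wpM2r; [exact: hdot_ge0|apply: Smon => //; lra].
  have h2 : S (s a + eta) * (rho (g b) - rho (g a)) <=
      B * (n%:R * 4 * M * `|g b - g a|).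
    apply: le_trans (ler_norm _) _; rewrite normrM ler_pM//.
      by apply: SB; rewrite sa1.
    by apply: rho_diff_le; exact: gM.
  have h3 : 2 * r * (zc (g b) - zc (g a)) <= `|2 * r| * `|g b - g a|.
    apply: le_trans (ler_norm _) _; rewrite normrM ler_pM//.
    rewrite [leRHS]/Num.Def.normr/= mx_normrE.
    have := le_bigmax 0 (fun i => `|(g b - g a) i.1 i.2|) (0, iz (n := n)).
    by rewrite /= !mxE.
  have -> : F b - F a = (S (s b + eta) * rho (g b) - S (s a + eta) * rho (g b)) +
    S (s a + eta) * (rho (g b) - rho (g a)) + 2 * r * (zc (g b) - zc (g a)) -
    (s b - s a) by rewrite /F; ring.
  have -> : (B * (n%:R * 4 * M) + `|2 * r|) * `|g b - g a| =
    B * (n%:R * 4 * M * `|g b - g a|) + `|2 * r| * `|g b - g a| by ring.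
  lra.
- by apply: measurableU => //; apply: measurableD.
- by apply: lebesgue_null_setU => //; exact: measurableD.
move=> t t01 Nt.
have Dt : D t by apply/not_notP => nD; apply: Nt; left; split.
have [gdt hgt] := gD t Dt.
have t0 : 0 < t by have := D01 _ Dt; rewrite /= in_itv/= => /andP[].
have sdt : is_derive t 1 s (hnorm (derive1 g t)).
  by apply/not_notP => nd; apply: Nt; right; apply: sN' => /= /(_ t0 Dt).
have /andP[st1 st2] := s01 _ t01.
have Sdt : is_derive (s t + eta) 1 S (- (S (s t + eta) ^+ 2 + r ^+ 2 / 4)).
  by apply: Sd; rewrite st2 andbT; lra.
have seta : is_derive t 1 (fun t => s t + eta) (hnorm (derive1 g t)).
  by apply: is_derive_eq (is_derive_add sdt (is_derive_cst eta _ _)) _; rewrite addr0.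
have := is_derive_add (is_derive_add
  (is_derive_mul (is_derive_chain (f := fun t => s t + eta) Sdt seta) (is_derive_rho gdt))
  (is_derive_scale (2 * r) (is_derive_coord (iz (n := n)) gdt))) (is_derive_opp sdt).
set l := (X in is_derive _ _ _ X); exists l => //.
(* Once S' is replaced by its Riccati value, this inequality says exactly that the derivative l is
   nonpositive. *)
have := calibration_le (S (s t + eta)) r hgt.
rewrite /l -derive1E; set e := hdot (g t) _; set w := hnorm _.
set z := derive1 g t 0 _; set q := rho _; set A := S _; lra.
Qed.

End length_lower_bound.

(** * The Carnot-Caratheodory distance *)

Section smooth_curves.
Context {R : realType}.

Lemma bounded_derivative_lipschitz (f f' : R -> R) (K : R) :
  (forall t : R, is_derive t 1 f (f' t)) ->
  (forall t : R, 0 <= t <= 1 -> `|f' t| <= K) ->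
  forall a b, 0 <= a -> a <= b -> b <= 1 -> `|f b - f a| <= K * (b - a).
Proof.
move=> fd fK a b a0; rewrite le_eqVlt => /predU1P[->|ab b1].
  by rewrite !subrr normr0 mulr0.
have fc : {within `[a, b], continuous f}.
  apply: continuous_subspaceT => x; apply: differentiable_continuous.
  by apply/derivable1_diffP; exact: (@ex_derive _ _ _ _ _ _ _ (fd x)).
have [c] := MVT ab (fun x _ => fd x) fc.
rewrite in_itv/= => /andP[ac cb] ->.
rewrite normrM (gtr0_norm (_ : 0 < b - a)) ?subr_gt0// ler_wpM2r ?subr_ge0 ?(ltW ab)//.
by apply: fK; apply/andP; split; lra.
Qed.

Lemma lipschitz_abs_continuous01 k (g : R -> 'rV[R]_k) (K : R) : 0 <= K ->
  (forall a b, 0 <= a -> a <= b -> b <= 1 -> `|g b - g a| <= K * (b - a)) ->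
  abs_continuous01 g.
Proof.
move=> K0 gK e e0; exists (e / (K + 1)); first by rewrite divr_gt0//; lra.
move=> m a b hab _ sd.
apply: (@le_lt_trans _ _ (K * \sum_(i < m) (b i - a i))).
  rewrite mulr_sumr; apply: ler_sum => i _.
  by have [/andP[? ?] ?] := hab i; exact: gK.
have s0 : 0 <= \sum_(i < m) (b i - a i).
  by apply: sumr_ge0 => i _; have [/andP[? ?] ?] := hab i; rewrite subr_ge0.
move: sd; rewrite ltr_pdivlMr; last lra.
by move: s0 K0; nra.
Qed.

Lemma is_derive_comb3 k (u v w : 'rV[R]_k) (a b c a' b' c' : R -> R) (t : R) :
  is_derive t 1 a (a' t) -> is_derive t 1 b (b' t) -> is_derive t 1 c (c' t) ->
  is_derive t 1 (fun s => a s *: u + b s *: v + c s *: w)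
    (a' t *: u + b' t *: v + c' t *: w).
Proof.
move=> da db dc.
have cd j : is_derive t 1 (fun s => (a s *: u + b s *: v + c s *: w) 0 j)
    ((a' t *: u + b' t *: v + c' t *: w) 0 j).
  rewrite (_ : (fun s => _) = fun s => u 0 j * a s + v 0 j * b s + w 0 j * c s).
    apply: is_derive_eq (is_derive_add (is_derive_add (is_derive_scale _ da)
      (is_derive_scale _ db)) (is_derive_scale _ dc)) _.
    by rewrite !mxE; ring.
  by apply/funext => s; rewrite !mxE; ring.
have D : derivable (fun s => a s *: u + b s *: v + c s *: w) t 1.
  apply/derivable_mxP => i j; rewrite (ord1 i).
  exact: (@ex_derive _ _ _ _ _ _ _ (cd j)).
split=> //; rewrite derive_mx//; apply/rowP => j.
by rewrite mxE (@derive_val _ _ _ _ _ _ _ (cd j)).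
Qed.

End smooth_curves.

(** * Explicit minimizers: lifts of segments and circle arcs *)

Section ccdist_formula.
Context {R : realType} {n : nat}.
Notation heis := 'rV[R]_(n + n + 1).
Implicit Types (p q v : heis) (g : R -> heis).
Notation rho p := (hdot p p).
Notation zc p := (p 0 (iz (n := n))).

(* Multiplication of the horizontal part of p by the complex number [a + i b]. *)
Definition rotation p (a b z : R) : heis :=
  a *: frame 0 (fun i => p 0 (ix i)) (fun i => p 0 (iy i)) +
  b *: frame 0 (fun i => - p 0 (iy i)) (fun i => p 0 (ix i)) +
  z *: delta_mx 0 (iz (n := n)).

Lemma rotation_ix p a b z i :
  rotation p a b z 0 (ix i) = a * p 0 (ix i) - b * p 0 (iy i).
Proof.
rewrite 2!mxE [X in X + _ + _]mxE [X in _ + X + _]mxE !frame_ix.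
by rewrite !mxE !eqxx eq_lrshift/= mulr0; ring.
Qed.

Lemma rotation_iy p a b z i :
  rotation p a b z 0 (iy i) = a * p 0 (iy i) + b * p 0 (ix i).
Proof.
rewrite 2!mxE [X in X + _ + _]mxE [X in _ + X + _]mxE !frame_iy.
by rewrite !mxE !eqxx eq_lrshift/= mulr0; ring.
Qed.

Lemma rotation_iz p a b z : zc (rotation p a b z) = z.
Proof.
rewrite 2!mxE [X in X + _ + _]mxE [X in _ + X + _]mxE !frame_iz.
rewrite big1 => [|i _]; last by rewrite !mxE; ring.
rewrite big1 => [|i _]; last by rewrite !mxE; ring.
by rewrite !mxE !eqxx/=; ring.
Qed.

Lemma rho_rotation p a b z : rho (rotation p a b z) = (a ^+ 2 + b ^+ 2) * rho p.
Proof.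
rewrite /hdot mulr_sumr; apply: eq_bigr => i _.
by rewrite !rotation_ix !rotation_iy; ring.
Qed.

Lemma rotation_horizontal p a b z a' b' z' : z' = rho p * (a * b' - b * a') / 2 ->
  horizontal_at (rotation p a b z) (rotation p a' b' z').
Proof.
move=> z'E; apply/horizontal_atP; rewrite rotation_iz z'E /hdot !mulr_suml.
by apply: eq_bigr => i _; rewrite !rotation_ix !rotation_iy; field.
Qed.

(** Every minimizer used has horizontal part (a + i b) p with a + i b a plane curve from 0 to 1 of
    constant speed l, so one plane arc serves all dimensions. The condition on z' is the area law
    that makes the lift horizontal. *)
Lemma rotation_curve p (a b z a' b' z' : R -> R) (l : R) :
  (forall t : R, is_derive t 1 a (a' t)) -> (forall t : R, is_derive t 1 b (b' t)) ->
  (forall t : R, is_derive t 1 z (z' t)) ->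
  (forall t, z' t = rho p * (a t * b' t - b t * a' t) / 2) ->
  (forall t, a' t ^+ 2 + b' t ^+ 2 = l ^+ 2) -> 0 <= l ->
  a 0 = 0 -> b 0 = 0 -> z 0 = 0 -> a 1 = 1 -> b 1 = 0 -> z 1 = zc p ->
  let g t := rotation p (a t) (b t) (z t) in
  [/\ horizontal_curve g, g 0 = 0, g 1 = p &
      curve_length g = (l * Num.sqrt (rho p))%:E].
Proof.
move=> ad bd zd zE ab l0 a0 b0 z0 a1 b1 z1 g.
have gd (t : R) : is_derive t 1 g (rotation p (a' t) (b' t) (z' t)).
  exact: is_derive_comb3.
have al t : `|a' t| <= l.
  by rewrite -(ger0_norm l0) -ler_sqr ?nnegrE// -!normrX !ger0_norm ?sqr_ge0// -(ab t)
    lerDl sqr_ge0.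
have bl t : `|b' t| <= l.
  by rewrite -(ger0_norm l0) -ler_sqr ?nnegrE// -!normrX !ger0_norm ?sqr_ge0// -(ab t)
    lerDr sqr_ge0.
have aL := bounded_derivative_lipschitz ad (fun t _ => al t).
have bL := bounded_derivative_lipschitz bd (fun t _ => bl t).
have lt t : 0 <= t <= 1 -> l * (t - 0) <= l.
  by move=> /andP[t0 t1]; rewrite subr0 ler_piMr.
have la t : 0 <= t <= 1 -> `|a t| <= l.
  move=> /[dup] t01 /andP[t0 t1]; have := aL _ _ (lexx 0) t0 t1.
  by rewrite a0 subr0 => /le_trans; apply; exact: lt.
have lb t : 0 <= t <= 1 -> `|b t| <= l.
  move=> /[dup] t01 /andP[t0 t1]; have := bL _ _ (lexx 0) t0 t1.
  by rewrite b0 subr0 => /le_trans; apply; exact: lt.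
have zL : forall s t, 0 <= s -> s <= t -> t <= 1 ->
    `|z t - z s| <= (rho p * l ^+ 2) * (t - s).
  apply: bounded_derivative_lipschitz zd _ => t t01; rewrite zE.
  rewrite !normrM (ger0_norm (hdot_ge0 p)) normfV (ger0_norm (ler0n _ 2)) -mulrA.
  apply: ler_wpM2l; first exact: hdot_ge0.
  rewrite ler_pdivrMr// (le_trans (ler_normB _ _))// !normrM.
  have := ler_pM (normr_ge0 _) (normr_ge0 _) (la t t01) (bl t).
  have := ler_pM (normr_ge0 _) (normr_ge0 _) (lb t t01) (al t).
  by rewrite expr2; lra.
have gp q : zc q = zc p -> (forall i, q 0 (ix i) = p 0 (ix i)) ->
    (forall i, q 0 (iy i) = p 0 (iy i)) -> q = p.
  by move=> *; exact: heis_coordP.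
split.
- split.
    set u := frame 0 (fun i => p 0 (ix i)) (fun i => p 0 (iy i)).
    set v := frame 0 (fun i => - p 0 (iy i)) (fun i => p 0 (ix i)).
    set w : heis := delta_mx 0 (iz (n := n)).
    apply: (@lipschitz_abs_continuous01 _ _ _
      (l * `|u| + l * `|v| + rho p * l ^+ 2 * `|w|)).
      by rewrite !addr_ge0 ?mulr_ge0 ?sqr_ge0 ?hdot_ge0.
    move=> s t s0 st t1.
    have -> : g t - g s = (a t - a s) *: u + (b t - b s) *: v + (z t - z s) *: w.
      by rewrite /g /rotation -/u -/v -/w !scalerBl; apply/rowP => j; rewrite !mxE; ring.
    rewrite (le_trans (ler_normD _ _))// 1?(le_trans (lerD (ler_normD _ _) (lexx _)))//.
    rewrite !normrZ.
    have := ler_wpM2r (normr_ge0 u) (aL _ _ s0 st t1).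
    have := ler_wpM2r (normr_ge0 v) (bL _ _ s0 st t1).
    have := ler_wpM2r (normr_ge0 w) (zL _ _ s0 st t1).
    lra.
  apply: aeW => t _; split; first exact: (@ex_derive _ _ _ _ _ _ _ (gd t)).
  rewrite derive1E (@derive_val _ _ _ _ _ _ _ (gd t)).
  exact: rotation_horizontal.
- by rewrite /g /rotation a0 b0 z0 !scale0r !addr0.
- by rewrite /g a1 b1 z1; apply: gp => [|i|i];
    rewrite ?rotation_ix ?rotation_iy ?rotation_iz//; ring.
rewrite /curve_length.
rewrite (_ : (fun t => _) = cst (l * Num.sqrt (rho p))%:E); last first.
  apply/funext => t /=; rewrite derive1E (@derive_val _ _ _ _ _ _ _ (gd t)).
  by rewrite /hnorm rho_rotation ab sqrtrM ?sqr_ge0// sqrtr_sqr ger0_norm.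
rewrite integral_cst//= lebesgue_measure_itv/= lte_fin ltr01.
by rewrite -EFinB subr0 mule1.
Qed.

Lemma ccdist_eq p (delta : R) g : horizontal_curve g -> g 0 = 0 -> g 1 = p ->
  curve_length g = delta%:E ->
  (forall f, horizontal_curve f -> f 0 = 0 -> f 1 = p -> (delta%:E <= curve_length f)%E) ->
  ccdist p = delta.
Proof.
move=> hg g0 g1 gl lb; rewrite /ccdist (_ : ereal_inf _ = delta%:E)//.
apply/eqP; rewrite eq_le; apply/andP; split.
  by apply: ereal_inf_lbound; exists g.
by apply: le_ereal_inf_tmp => _ [f [hf f0 f1] <-]; exact: lb.
Qed.

(** This is the limit psi = 0 of [ccdist_arc], where psi / sin psi degenerates. The minimizer is a
    segment, and S = 1/x solves the Riccati equation with r = 0. *)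
Lemma ccdist_horizontal p : 0 < rho p -> zc p = 0 -> ccdist p = Num.sqrt (rho p).
Proof.
move=> p0 pz; have q0 : 0 < Num.sqrt (rho p) by rewrite sqrtr_gt0.
have idd (t : R) := is_derive_id t 1.
have zd (t : R) : is_derive t 1 (cst (0 : R)) 0 := is_derive_cst (0 : R) t 1.
have [||hg g0 g1 gl] := @rotation_curve p id (cst 0) (cst 0) (cst 1) (cst 0) (cst 0) 1
  idd zd zd _ _ ler01 erefl erefl erefl erefl erefl (esym pz).
- by move=> t /=; rewrite mulr0 mul0r subr0 mulr0 mul0r.
- by move=> t /=; rewrite expr0n/= addr0.
apply: (ccdist_eq hg g0 g1); first by rewrite gl mul1r.
move=> f; apply: (@curve_length_ge _ _ (fun x => x^-1) 0) => //.
  move=> x /andP[x0 _].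
  apply: is_derive_eq (is_derive_inv (lt0r_neq0 x0)) _.
  by rewrite expr0n/= mul0r addr0 exprVn.
by rewrite mulr0 mul0r addr0 -[X in _ * X]sqr_sqrtr ?(ltW p0)// expr2 mulKf ?gt_eqF.
Qed.

Lemma sin_neq0 (psi : R) : psi != 0 -> `|psi| < pi -> sin psi != 0.
Proof.
move=> psi0; rewrite ltr_norml => /andP[h1 h2].
have [p0|p0|p0] := ltgtP psi 0.
- by rewrite -oppr_eq0 -sinN gt_eqF// sin_gt0_pi//; apply/andP; split; lra.
- by rewrite gt_eqF// sin_gt0_pi// p0.
- by rewrite p0 eqxx in psi0.
Qed.

Lemma div_sin_gt0 (psi : R) : psi != 0 -> `|psi| < pi -> 0 < psi / sin psi.
Proof.
move=> psi0; rewrite ltr_norml => /andP[h1 h2].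
have [p0|p0|p0] := ltgtP psi 0.
- rewrite -[psi / _]mulrNN -invrN -sinN divr_gt0 ?oppr_gt0// sin_gt0_pi//.
  by apply/andP; split; lra.
- by rewrite divr_gt0// sin_gt0_pi// p0.
- by rewrite p0 eqxx in psi0.
Qed.

Lemma is_derive_sin_scale (k t : R) :
  is_derive t 1 (fun x => sin (k * x)) (k * cos (k * t)).
Proof.
apply: is_derive_eq (is_derive_chain (f := fun x => k * x) (is_derive_sin _)
  (is_derive_scale k (is_derive_id t 1))) _.
by rewrite mulr1 mulrC.
Qed.

Lemma is_derive_cos_scale (k t : R) :
  is_derive t 1 (fun x => cos (k * x)) (- (k * sin (k * t))).
Proof.
apply: is_derive_eq (is_derive_chain (f := fun x => k * x) (is_derive_cos _)
  (is_derive_scale k (is_derive_id t 1))) _.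
by rewrite mulr1 mulrC mulrN.
Qed.

Lemma ccdist_arc p (psi : R) : 0 < rho p -> psi != 0 -> `|psi| < pi ->
  zc p = rho p * (psi - sin psi * cos psi) / (4 * sin psi ^+ 2) ->
  ccdist p = Num.sqrt (rho p) * psi / sin psi.
Proof.
move=> p0 psi0 psipi zp.
have s0 := sin_neq0 psi0 psipi; have l0 := div_sin_gt0 psi0 psipi.
have q0 : 0 < Num.sqrt (rho p) by rewrite sqrtr_gt0.
have q2 := sqr_sqrtr (ltW p0).
set s := sin psi in s0 l0 zp *; set c := cos psi in zp *.
have cs : c ^+ 2 = 1 - s ^+ 2 by rewrite -(cos2Dsin2 psi) addrK.
pose S t := sin (psi * t); pose C t := cos (psi * t).
have CS t : C t ^+ 2 = 1 - S t ^+ 2 by rewrite -(cos2Dsin2 (psi * t)) addrK.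
have dS (t : R) : is_derive t 1 S (psi * C t) := is_derive_sin_scale psi t.
have dC (t : R) : is_derive t 1 C (- (psi * S t)) := is_derive_cos_scale psi t.
(* a + i b = exp (i psi (t - 1)) sin (psi t) / sin psi, an arc of circle from 0 to 1. *)
pose a t := s^-1 * ((c * C t + s * S t) * S t).
pose a' t := s^-1 * (psi * ((s * C t - c * S t) * S t + (c * C t + s * S t) * C t)).
pose b t := s^-1 * ((c * S t - s * C t) * S t).
pose b' t := s^-1 * (psi * ((c * C t + s * S t) * S t + (c * S t - s * C t) * C t)).
pose z t := rho p / (4 * s ^+ 2) * (psi * t - S t * C t).
pose z' t := rho p / (4 * s ^+ 2) * (psi * (1 - C t ^+ 2 + S t ^+ 2)).
have ad (t : R) : is_derive t 1 a (a' t).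
  apply: is_derive_eq (is_derive_scale s^-1 (is_derive_mul (is_derive_add
    (is_derive_scale c (dC t)) (is_derive_scale s (dS t))) (dS t))) _.
  by rewrite /a'; ring.
have bd (t : R) : is_derive t 1 b (b' t).
  apply: is_derive_eq (is_derive_scale s^-1 (is_derive_mul (is_derive_add
    (is_derive_scale c (dS t)) (is_derive_opp (is_derive_scale s (dC t)))) (dS t))) _.
  by rewrite /b'; ring.
have zd (t : R) : is_derive t 1 z (z' t).
  apply: is_derive_eq (is_derive_scale _ (is_derive_add
    (is_derive_scale psi (is_derive_id t 1)) (is_derive_opp
    (is_derive_mul (dS t) (dC t))))) _.
  by rewrite /z'; ring.
have S0 : S 0 = 0 by rewrite /S mulr0 sin0.
have S1 : S 1 = s by rewrite /S mulr1.
have C1 : C 1 = c by rewrite /C mulr1.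
have [|||||||||hg g0 g1 gl] := @rotation_curve p a b z a' b' z' (psi / s) ad bd zd.
- move=> t; rewrite /z' /a /a' /b /b'; set X := S t; set Y := C t.
  have Y2 : Y ^+ 2 = 1 - X ^+ 2 := CS t.
  have -> : rho p * (s^-1 * ((c * Y + s * X) * X) *
      (s^-1 * (psi * ((c * Y + s * X) * X + (c * X - s * Y) * Y))) -
     s^-1 * ((c * X - s * Y) * X) *
      (s^-1 * (psi * ((s * Y - c * X) * X + (c * Y + s * X) * Y)))) / 2 =
    rho p * psi * X ^+ 2 * ((c ^+ 2 + s ^+ 2) * (Y ^+ 2 + X ^+ 2)) / (2 * s ^+ 2).
    by field.
  by rewrite Y2 cs; field.
- move=> t; rewrite /a' /b'; set X := S t; set Y := C t.
  have Y2 : Y ^+ 2 = 1 - X ^+ 2 := CS t.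
  have -> : (s^-1 * (psi * ((s * Y - c * X) * X + (c * Y + s * X) * Y))) ^+ 2 +
    (s^-1 * (psi * ((c * Y + s * X) * X + (c * X - s * Y) * Y))) ^+ 2 =
    (psi / s) ^+ 2 * ((c ^+ 2 + s ^+ 2) * (Y ^+ 2 + X ^+ 2) ^+ 2) by field.
  by rewrite Y2 cs; ring.
- exact: ltW.
- by rewrite /a S0; ring.
- by rewrite /b S0; ring.
- by rewrite /z S0; ring.
- by rewrite /a S1 C1 (_ : (c * c + s * s) = 1) ?mul1r ?mulVf// -!expr2 cs subrK.
- by rewrite /b S1 C1 mulrC (mulrC c) subrr !mul0r.
- by rewrite /z S1 C1 zp mulr1; field.
have gl' : curve_length (fun t => rotation p (a t) (b t) (z t)) =
    (Num.sqrt (rho p) * psi / s)%:E by rewrite gl; congr (_%:E); ring.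
have d0 : 0 < Num.sqrt (rho p) * psi / s by rewrite -mulrA mulr_gt0.
apply: (ccdist_eq hg g0 g1 gl') => f.
(* k is the signed inverse of the diameter of the circle. S = k cot (k x) solves the Riccati
   equation with r = 2k, and k delta = psi with |psi| < pi keeps it regular on ]0, delta]. *)
pose k := s / Num.sqrt (rho p).
have kx x : 0 < x <= Num.sqrt (rho p) * psi / s -> sin (k * x) != 0.
  move=> /andP[x0 xd]; have k0 : k * x != 0.
    by rewrite /k !mulf_eq0 invr_eq0 !negb_or s0 !gt_eqF.
  apply: sin_neq0 => //; apply: le_lt_trans psipi.
  have -> : psi = k * (Num.sqrt (rho p) * psi / s).
    by rewrite /k; field; rewrite s0 gt_eqF.
  by rewrite !normrM ler_wpM2l// -!normrM !gtr0_norm.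
apply: (@curve_length_ge _ _ (fun x => k * (cos (k * x) / sin (k * x))) (2 * k) _ p f d0).
- move=> x /kx sx.
  have cx : cos (k * x) ^+ 2 = 1 - sin (k * x) ^+ 2.
    by rewrite -(cos2Dsin2 (k * x)) addrK.
  have sd := is_deriveV sx (is_derive_sin_scale k x).
  apply: is_derive_eq (is_derive_scale k (is_derive_mul (is_derive_cos_scale k x) sd)) _.
  rewrite /GRing.scale/=; set X := sin _ in sx cx *; set Y := cos _ in cx *.
  have -> : k * (- (k * X) / X + Y * (- X ^- 2 * (k * Y))) =
    - (k ^+ 2 * (X ^+ 2 + Y ^+ 2) / X ^+ 2) by field.
  have -> : (k * (Y / X)) ^+ 2 + (2 * k) ^+ 2 / 4 =
    k ^+ 2 * (X ^+ 2 + Y ^+ 2) / X ^+ 2 by field.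
  by [].
have -> : k * (Num.sqrt (rho p) * psi / s) = psi.
  by rewrite /k; field; rewrite s0 gt_eqF.
rewrite zp -/s -/c /k; set q := Num.sqrt _ in q0 q2 *; rewrite -q2.
by field; rewrite s0 gt_eqF.
Qed.

End ccdist_formula.

(** * The half-aperture as a function of z / rho *)

Section inverse_aperture.
Context {R : realType}.
Implicit Types (a b w x psi : R).

Lemma is_derive_continuous (f : R -> R) x d : is_derive x 1 f d -> {for x, continuous f}.
Proof.
move=> fd; apply: differentiable_continuous; apply/derivable1_diffP.
exact: (@ex_derive _ _ _ _ _ _ _ fd).
Qed.

Lemma derive_pos_lt (f f' : R -> R) (a b : R) : a < b ->
  (forall x, a <= x <= b -> is_derive x 1 f (f' x)) ->
  (forall x, a < x < b -> 0 < f' x) -> f a < f b.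
Proof.
move=> ab fd f'0.
have [||c] := @MVT _ f f' a b ab.
- by move=> x; rewrite in_itv/= => /andP[? ?]; apply: fd; rewrite !ltW.
- apply: continuous_in_subspaceT => x; rewrite inE/= in_itv/= => /fd.
  exact: is_derive_continuous.
rewrite in_itv/= => /f'0 h fE.
by rewrite -subr_gt0 fE mulr_gt0// subr_gt0.
Qed.

Lemma derive_neg_lt (f f' : R -> R) (a b : R) : a < b ->
  (forall x, a <= x <= b -> is_derive x 1 f (f' x)) ->
  (forall x, a < x < b -> f' x < 0) -> f b < f a.
Proof.
move=> ab fd f'0; rewrite -ltrN2.
apply: (@derive_pos_lt (fun x => - f x) (fun x => - f' x)) => // x h.
  by apply: is_derive_opp; exact: fd.
by rewrite oppr_gt0; exact: f'0.
Qed.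

(** The function sin - x cos is the numerator of the derivative of [aperture], and its square
    measures the defect between gauge and distance. *)
Lemma is_derive_gap psi :
  is_derive psi 1 (fun x : R => sin x - x * cos x) (psi * sin psi).
Proof.
apply: is_derive_eq (is_derive_add (is_derive_sin psi) (is_derive_opp
  (is_derive_mul (is_derive_id psi 1) (is_derive_cos psi)))) _.
by ring.
Qed.

Lemma gap_lt a b : 0 <= a -> a < b -> b <= pi ->
  sin a - a * cos a < sin b - b * cos b.
Proof.
move=> a0 ab bpi.
apply: (@derive_pos_lt (fun x : R => sin x - x * cos x) (fun x : R => x * sin x)) => // x.
  by move=> _; exact: is_derive_gap.
move=> /andP[ax xb]; rewrite mulr_gt0 ?sin_gt0_pi//; first lra.
by apply/andP; split; lra.
Qed.

Lemma gap_gt0 psi : 0 < psi < pi -> 0 < sin psi - psi * cos psi.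
Proof.
move=> /andP[p0 ppi]; have := gap_lt (lexx 0) p0 (ltW ppi).
by rewrite sin0 mul0r subr0.
Qed.

(* The ratio z / rho at the endpoint of a geodesic of half-aperture psi. *)
Definition aperture psi := (psi - sin psi * cos psi) / (4 * sin psi ^+ 2).

Lemma is_derive_aperture psi : 0 < psi < pi ->
  is_derive psi 1 aperture ((sin psi - psi * cos psi) / (2 * sin psi ^+ 3)).
Proof.
move=> p0pi; have s0 : sin psi != 0 by rewrite gt_eqF// sin_gt0_pi.
have s20 : 4 * sin psi ^+ 2 != 0 by rewrite mulf_neq0// expf_neq0.
have dn := is_derive_add (is_derive_id psi 1) (is_derive_opp
  (is_derive_mul (is_derive_sin psi) (is_derive_cos psi))).
have ds : is_derive psi 1 (fun x => 4 * sin x ^+ 2) (8 * sin psi * cos psi).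
  apply: is_derive_eq (is_derive_scale 4 (is_derive_chain (is_derive_sqr _)
    (is_derive_sin psi))) _.
  by ring.
have dv := @is_deriveV _ (fun x => 4 * sin x ^+ 2) psi _ 1 s20 ds.
apply: is_derive_eq (is_derive_mul dn dv) _.
rewrite /GRing.scale/=; set s := sin psi in s0 *; set c := cos psi.
have cs : c ^+ 2 = 1 - s ^+ 2 by rewrite -(cos2Dsin2 psi) addrK.
have -> : (1 - (c * c + s * - s)) / (4 * s ^+ 2) +
    (psi - s * c) * (- (4 * s ^+ 2) ^- 2 * (8 * s * c)) =
  (4 * s ^+ 2 * (1 - c ^+ 2 + s ^+ 2) - 8 * s * c * psi + 8 * s ^+ 2 * c ^+ 2)
    / (16 * s ^+ 4) by field.
by rewrite cs; field.
Qed.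

Lemma aperture_lt a b : 0 < a -> a < b -> b < pi -> aperture a < aperture b.
Proof.
move=> a0 ab bpi.
have inpi x : a <= x <= b -> 0 < x < pi by move=> /andP[? ?]; apply/andP; split; lra.
apply: (derive_pos_lt ab (fun x h => is_derive_aperture (inpi x h))) => x /andP[ax xb].
have xpi : 0 < x < pi by apply: inpi; rewrite !ltW.
by rewrite divr_gt0 ?gap_gt0// mulr_gt0// exprn_gt0// sin_gt0_pi.
Qed.

Lemma aperture_inj a b : 0 < a < pi -> 0 < b < pi -> aperture a = aperture b -> a = b.
Proof.
move=> /andP[a0 api] /andP[b0 bpi] e; have [ab|ab|//] := ltgtP a b.
- by have := aperture_lt a0 ab bpi; rewrite e ltxx.
- by have := aperture_lt b0 ab api; rewrite e ltxx.
Qed.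

(** G is the equation aperture x = w cleared of its denominator, hence regular at pi. It vanishes at
    0 and decreases as long as tan x < 4w, so the intermediate value theorem is applied from atan
    (4w): this avoids the trivial root 0 and gives the lower bound on psi behind the quantitative
    gain. *)
Lemma aperture_surj w : 0 < w ->
  exists2 psi, 0 < psi < pi & aperture psi = w /\ atan (4 * w) <= psi.
Proof.
move=> w0.
pose G x := x - sin x * cos x - 4 * w * sin x ^+ 2.
have dG (x : R) : is_derive x 1 G (2 * sin x * (sin x - 4 * w * cos x)).
  apply: is_derive_eq (is_derive_add (is_derive_add (is_derive_id x 1) (is_derive_opp
    (is_derive_mul (is_derive_sin x) (is_derive_cos x)))) (is_derive_opp
    (is_derive_scale (4 * w) (is_derive_chain (is_derive_sqr _) (is_derive_sin x))))) _.
  have -> : 1 - (cos x * cos x + sin x * - sin x) - 4 * w * (2 * sin x * cos x) =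
    1 - cos x ^+ 2 + sin x ^+ 2 - 8 * w * sin x * cos x by ring.
  by rewrite cos2sin2; ring.
set a := atan (4 * w).
have a0 : 0 < a.
  by rewrite /a -(@atan0 R); apply: lt_atan; rewrite mulr_gt0.
have api : a < pi / 2 := atan_ltpi2 (4 * w).
have pi0 := pi_gt0 R.
have Ga : G a < 0.
  have -> : 0 = G 0 by rewrite /G sin0; ring.
  apply: (derive_neg_lt a0 (fun x _ => dG x)) => x /andP[x0 xa].
  have apii : a \in `](- (pi / 2)), (pi / 2)[ by rewrite in_itv/= atan_gtNpi2 api.
  have xpii : x \in `](- (pi / 2)), (pi / 2)[ by rewrite in_itv/=; apply/andP; split; lra.
  have := xpii; rewrite in_itv/= => /cos_gt0_pihalf cx0.
  have sx0 : 0 < sin x by apply: sin_gt0_pi; apply/andP; split; lra.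
  rewrite pmulr_rlt0 ?mulr_gt0// subr_lt0.
  by move: xa; rewrite -ltr_tan// atanK /tan ltr_pdivrMr.
have Gpi : G pi = pi by rewrite /G sinpi; ring.
have Gc : {within `[a, pi], continuous G}.
  by apply: continuous_subspaceT => x; exact: is_derive_continuous (dG x).
have [||psi] := @IVT _ G a pi 0 _ Gc; first lra.
  by rewrite Gpi ge_min le_max (ltW Ga) (ltW pi0) orbT.
rewrite in_itv/= => /andP[ap ppi] Gp; exists psi.
  apply/andP; split; first lra.
  by rewrite lt_neqAle ppi andbT; apply/eqP => e; move: Gp; rewrite e Gpi; lra.
split=> //.
have s0 : sin psi != 0.
  rewrite gt_eqF// sin_gt0_pi// (lt_le_trans a0 ap) lt_neqAle ppi andbT.
  by apply/eqP => e; move: Gp; rewrite e Gpi; lra.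
apply: (mulIf (mulf_neq0 (_ : 4 != 0) (expf_neq0 2 s0))) => //.
rewrite /aperture divfK ?mulf_neq0 ?expf_neq0//; move: Gp; rewrite /G; lra.
Qed.

(** The default 0 is the value for w <= 0, since [aperture] is positive on ]0, pi[. It makes the
    curvature below vanish when rho > 0 and z <= 0. *)
Definition half_aperture w := xget 0 [set psi | 0 < psi < pi /\ aperture psi = w].

Lemma half_apertureP w : 0 < w ->
  0 < half_aperture w < pi /\ aperture (half_aperture w) = w.
Proof.
move=> /aperture_surj[psi ppi [aw _]].
by apply: (@xgetPex _ 0 [set psi | 0 < psi < pi /\ aperture psi = w]); exists psi.
Qed.

Lemma aperture_gt0 psi : 0 < psi < pi -> 0 < aperture psi.
Proof.
move=> /andP[p0 ppi]; have s0 : 0 < sin psi by apply: sin_gt0_pi; rewrite p0.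
rewrite divr_gt0 ?mulr_gt0 ?exprn_gt0// subr_gt0.
have : 0 - sin 0 * cos 0 < psi - sin psi * cos psi.
  apply: (@derive_pos_lt (fun x => x - sin x * cos x) (fun x => 2 * sin x ^+ 2)) => //.
    move=> x _; apply: is_derive_eq (is_derive_add (is_derive_id x 1) (is_derive_opp
      (is_derive_mul (is_derive_sin x) (is_derive_cos x)))) _.
    have -> : 1 - (cos x * cos x + sin x * - sin x) =
      1 - cos x ^+ 2 + sin x ^+ 2 by ring.
    by rewrite cos2sin2; ring.
  move=> x /andP[x0 xp]; rewrite mulr_gt0// exprn_gt0// sin_gt0_pi//.
  by rewrite x0 (lt_trans xp).
by rewrite sin0 mul0r subrr subr_gt0.
Qed.

Lemma apertureK psi : 0 < psi < pi -> half_aperture (aperture psi) = psi.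
Proof.
move=> p0pi.
by have [h1 h2] := half_apertureP (aperture_gt0 p0pi); exact: aperture_inj h2.
Qed.

Lemma half_aperture_ge w : 0 < w -> atan (4 * w) <= half_aperture w.
Proof.
by move=> /[dup] w0 /aperture_surj[psi ppi [<- ap]]; rewrite apertureK.
Qed.

Lemma is_derive_half_aperture w : 0 < w ->
  let psi := half_aperture w in
  is_derive w 1 half_aperture (2 * sin psi ^+ 3 / (sin psi - psi * cos psi)).
Proof.
move=> w0 psi; have [ppi aw] := half_apertureP w0.
have {1}-> : w = aperture psi by [].
rewrite -invf_div; apply: is_derive_inverse.
- have /near_in_itvoo h : psi \in `]0, pi[ by rewrite in_itv.
  by apply: filterS h => x; rewrite in_itv/=; exact: apertureK.
- have /near_in_itvoo h : psi \in `]0, pi[ by rewrite in_itv.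
  apply: filterS h => x; rewrite in_itv/= => /is_derive_aperture.
  exact: is_derive_continuous.
- exact: is_derive_aperture.
- by rewrite gt_eqF// divr_gt0 ?gap_gt0// mulr_gt0// exprn_gt0// sin_gt0_pi.
Qed.

End inverse_aperture.

(** * Comparison of the distance with the Koranyi gauge *)

Section gauge.
Context {R : realType} {n : nat}.
Notation heis := 'rV[R]_(n + n + 1).
Implicit Types (p q v : heis).
Notation rho p := (hdot p p).
Notation zc p := (p 0 (iz (n := n))).

(* The fourth power of the Koranyi gauge. *)
Definition gauge4 p : R := rho p ^+ 2 + 16 * zc p ^+ 2.

Lemma gauge4_gt0 p : 0 < rho p -> 0 < gauge4 p.
Proof. by move=> p0; rewrite ltr_pwDl ?exprn_gt0// mulr_ge0 ?sqr_ge0. Qed.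

Lemma half_aperture_zc p : 0 < rho p -> 0 < zc p ->
  let psi := half_aperture (zc p / rho p) in
  [/\ 0 < psi < pi, 0 < sin psi &
    zc p = rho p * (psi - sin psi * cos psi) / (4 * sin psi ^+ 2)].
Proof.
move=> p0 z0 psi; have [h1 h2] := half_apertureP (divr_gt0 z0 p0); split=> //.
  exact: sin_gt0_pi.
by rewrite -mulrA -/(aperture _) h2 mulrC divfK// gt_eqF.
Qed.

Lemma ccdist_half_aperture p : 0 < rho p -> 0 < zc p ->
  let psi := half_aperture (zc p / rho p) in
  ccdist p = Num.sqrt (rho p) * psi / sin psi.
Proof.
move=> p0 z0 psi; have [h1 h2 h3] := half_aperture_zc p0 z0.
have /andP[psi0 psipi] := h1.
by apply: ccdist_arc => //; rewrite ?gt_eqF// gtr0_norm.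
Qed.

(** The defect K / rho - delta^2 is a square up to a positive factor: this gives the bound of the
    distance by the gauge and, off z = 0, its strictness. *)
Lemma gauge4_ccdist p psi : 0 < rho p -> sin psi != 0 ->
  zc p = rho p * (psi - sin psi * cos psi) / (4 * sin psi ^+ 2) ->
  gauge4 p / rho p - (Num.sqrt (rho p) * psi / sin psi) ^+ 2 =
  rho p * (sin psi - psi * cos psi) ^+ 2 / sin psi ^+ 4.
Proof.
move=> p0; have p0' : rho p != 0 by rewrite gt_eqF.
rewrite !exprMn sqr_sqrtr ?ltW// /gauge4.
have := cos2sin2 psi; set s := sin psi; set c := cos psi => cs s0 ->.
have -> : (rho p ^+ 2 + 16 * (rho p * (psi - s * c) / (4 * s ^+ 2)) ^+ 2) / rho p -
    rho p * psi ^+ 2 * s^-1 ^+ 2 =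
  rho p * (s ^+ 4 + psi ^+ 2 * (1 - s ^+ 2) - 2 * psi * s * c + s ^+ 2 * c ^+ 2)
  / s ^+ 4 by field; rewrite s0.
have -> : rho p * (s - psi * c) ^+ 2 / s ^+ 4 =
  rho p * (s ^+ 2 + psi ^+ 2 * c ^+ 2 - 2 * psi * s * c) / s ^+ 4 by ring.
by rewrite cs; ring.
Qed.

Lemma ccdist_gt0_gauge p : 0 < rho p ->
  0 < ccdist p /\ ccdist p ^+ 2 <= gauge4 p / rho p.
Proof.
move=> p0; have q0 : 0 < Num.sqrt (rho p) by rewrite sqrtr_gt0.
have arc (psi : R) : psi != 0 -> `|psi| < pi ->
    zc p = rho p * (psi - sin psi * cos psi) / (4 * sin psi ^+ 2) ->
    0 < ccdist p /\ ccdist p ^+ 2 <= gauge4 p / rho p.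
  move=> psi0 psipi zE; have s0 := sin_neq0 psi0 psipi.
  rewrite (ccdist_arc p0 psi0 psipi zE); split.
    by rewrite -mulrA mulr_gt0// div_sin_gt0.
  have s40 : 0 <= sin psi ^+ 4 by rewrite exprn_even_ge0.
  by rewrite -subr_ge0 gauge4_ccdist// divr_ge0// mulr_ge0 ?sqr_ge0 ?(ltW p0).
have [z0|z0|z0] := ltgtP (zc p) 0.
(* The ratio z / rho is odd in psi, so z < 0 is reached with a negative half-aperture. *)
- have z0' : 0 < - zc p / rho p by rewrite divr_gt0// oppr_gt0.
  have [/andP[h1 h2] h3] := half_apertureP z0'.
  apply: (arc (- half_aperture (- zc p / rho p))).
  + by rewrite oppr_eq0 gt_eqF.
  + by rewrite normrN gtr0_norm.
  rewrite sinN cosN; set psi := half_aperture _ in h1 h2 h3 *.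
  have -> : rho p * (- psi - - sin psi * cos psi) / (4 * (- sin psi) ^+ 2) =
    - (rho p * aperture psi) by rewrite /aperture sqrrN; ring.
  by rewrite h3 mulrC divfK ?opprK// gt_eqF.
- have [/andP[h1 h2] _ h3] := half_aperture_zc p0 z0.
  by apply: (arc (half_aperture (zc p / rho p))) => //; rewrite ?gt_eqF// gtr0_norm.
- rewrite ccdist_horizontal// q0 sqr_sqrtr ?(ltW p0)//; split=> //.
  by rewrite /gauge4 z0 expr0n/= mulr0 addr0 expr2 mulfK// gt_eqF.
Qed.

(** On the center the left side is 0, so the comparison holds at every point and integrates without
    an exceptional set. *)
Lemma inv_ccdist_ge p : rho p / gauge4 p <= (ccdist p ^+ 2)^-1.
Proof.
have [p0|p0] := ltP 0 (rho p); last first.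
  by rewrite (_ : rho p = 0) ?mul0r ?invr_ge0 ?sqr_ge0//; apply/eqP; rewrite eq_le p0 hdot_ge0.
have [d0 dK] := ccdist_gt0_gauge p0.
by rewrite -[leLHS]invrK lef_pV2 ?posrE ?exprn_gt0// ?invf_div ?divr_gt0 ?gauge4_gt0.
Qed.

(* Off the plane [z = 0] the distance is strictly below its bound by the gauge,
   uniformly on the cone [w rho <= z]. *)
Lemma inv_ccdist_gain p w : 0 < rho p -> 0 < w -> w * rho p <= zc p ->
  rho p / gauge4 p + rho p ^+ 3 *
    (sin (atan (4 * w)) - atan (4 * w) * cos (atan (4 * w))) ^+ 2 / gauge4 p ^+ 2
  <= (ccdist p ^+ 2)^-1.
Proof.
move=> p0 w0 wz; have z0 : 0 < zc p by rewrite (lt_le_trans _ wz)// mulr_gt0.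
have [/andP[h1 h2] s0 zE] := half_aperture_zc p0 z0.
have [d0 dK] := ccdist_gt0_gauge p0.
have K0 := gauge4_gt0 p0.
have := gauge4_ccdist p0 (lt0r_neq0 s0) zE.
rewrite -(ccdist_half_aperture p0 z0).
set psi := half_aperture _ in h1 h2 s0 zE *.
set a := atan (4 * w).
have a0 : 0 < a by rewrite /a -(@atan0 R); apply: lt_atan; rewrite mulr_gt0.
have api : a < pi by have := @pi_gt0 R; have : a < pi / 2 := atan_ltpi2 _; lra.
have apsi : a <= psi.
  apply: (le_trans _ (half_aperture_ge (divr_gt0 z0 p0))).
  by apply: le_atan; rewrite ler_pM2l// ler_pdivlMr.
set ga := sin a - a * cos a; set gp := sin psi - psi * cos psi.
have ga0 : 0 < ga by apply: gap_gt0; rewrite a0.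
have gagp : ga <= gp.
  move: apsi; rewrite le_eqVlt => /predU1P[e|apsi]; first by rewrite /ga /gp e.
  by apply/ltW; apply: gap_lt => //; rewrite ltW.
set d := ccdist p in d0 dK *; set K := gauge4 p in K0 dK *; set r := rho p in p0 dK *.
move=> E.
have s1 : sin psi ^+ 4 <= 1 by rewrite exprn_ile1 ?(ltW s0) ?sin_le1.
have D : r * ga ^+ 2 <= K / r - d ^+ 2.
  rewrite E ler_pdivlMr ?exprn_gt0//.
  have : ga ^+ 2 <= gp ^+ 2 by rewrite ler_sqr ?nnegrE ?(ltW ga0)// (le_trans (ltW ga0)).
  have : 0 <= ga ^+ 2 by rewrite sqr_ge0.
  move: s1; set X := _ ^+ 4 => X1 g2 gg.
  have : r * ga ^+ 2 * X <= r * ga ^+ 2 by rewrite ler_piMr// mulr_ge0// ltW.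
  have : r * ga ^+ 2 <= r * gp ^+ 2 by rewrite ler_wpM2l// ltW.
  lra.
have rK : r / K <= (d ^+ 2)^-1.
  by rewrite -[leLHS]invrK lef_pV2 ?posrE ?exprn_gt0// invf_div// divr_gt0.
have -> : (d ^+ 2)^-1 = r / K + (K / r - d ^+ 2) * (r / K) * (d ^+ 2)^-1.
  by field; rewrite !gt_eqF.
rewrite lerD2l.
have -> : r ^+ 3 * ga ^+ 2 / K ^+ 2 = r * ga ^+ 2 * (r / K) * (r / K).
  by field; rewrite !gt_eqF.
have rK0 : 0 <= r / K by rewrite divr_ge0// ltW.
have rg0 : 0 <= r * ga ^+ 2 by rewrite mulr_ge0 ?sqr_ge0// ltW.
by apply: ler_pM => //; [exact: mulr_ge0|exact: ler_wpM2r].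
Qed.

End gauge.

(** * Smooth functions *)

Section smooth_functions.
Context {R : realType}.

(** The difference of the two functions vanishes near x, hence has differential 0 there. *)
Lemma near_eq_differentiable (V : normedModType R) (f g : V -> R) (x : V) :
  (\near x, f x = g x) -> differentiable f x -> differentiable g x.
Proof.
move=> fg df; pose k := (g : V -> R^o) - (f : V -> R^o).
have kx : \near x, k x = 0.
  by apply: filterS fg => y e; rewrite /k !fctE e subrr.
have k0 : k \o shift x = cst (k x) + (0 : V -> R^o) +o_ 0 id.
  apply/eqaddoP => e e0.
  have : \forall y \near (0 : V), k (y + x) = 0.
    rewrite (near_shift x); apply: filterS kx => y /=.
    by rewrite sub0r subrK.
  apply: filterS => y ky; rewrite !fctE /= ky (nbhs_singleton kx).
  have -> : (0 : V -> R^o) y = 0 by [].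
  by rewrite addr0 subr0 normr0 mulr_ge0// ltW.
have dk : 'd k x = 0 :> (V -> R^o) by apply: diff_unique => //; exact: cst_continuous.
have kd : differentiable k x.
  by apply/diff_locallyP; rewrite dk; split=> //; exact: cst_continuous.
rewrite (_ : g = (f : V -> R^o) + k); first exact: differentiableD.
by apply/funext => y; rewrite /k !fctE addrC subrK.
Qed.

(* A class of functions that is closed under differentiation, up to equality on
   the open set O, consists of smooth functions. *)
Definition smooth_class (V : normedModType R) (O : set V) (C : set (V -> R)) :=
  forall g, C g -> (forall p, O p -> differentiable g p) /\
    (forall v, exists2 g', C g' & forall p, O p -> 'D_v g p = g' p).

Definition smooth_on (V : normedModType R) (O : set V) (f : V -> R) :=
  exists2 C, smooth_class O C & C f.

Lemma is_derive_differentiable (V : normedModType R) (f : V -> R) (p v : V) : differentiable f p ->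
  is_derive p v f ('D_v f p).
Proof. by move=> fd; split=> //; exact: diff_derivable. Qed.

Section closure.
Context {V : normedModType R}.
Implicit Types (O : set V) (f g : V -> R).

Inductive generated (B : set (V -> R)) : (V -> R) -> Prop :=
| gen_base f of B f : generated B f
| gen_cst c : generated B (fun=> c)
| gen_add f g of generated B f & generated B g : generated B (fun x => f x + g x)
| gen_mul f g of generated B f & generated B g : generated B (fun x => f x * g x).

(** By the Leibniz rule it suffices to check the derivatives of the generators: smoothness to all
    orders becomes one verification per generator. *)
Lemma smooth_generated O (B : set (V -> R)) :
  (forall b, B b -> (forall p, O p -> differentiable b p) /\
    (forall v, exists2 g, generated B g & forall p, O p -> 'D_v b p = g p)) ->
  smooth_class O (generated B).
Proof.
move=> hB g; elim=> {g} [f /hB//|c|f g _ [fd fv] _ [gd gv]|f g Bf [fd fv] Bg [gd gv]].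
- split=> [p _|v]; first exact: differentiable_cst.
  exists (fun=> 0); first exact: gen_cst.
  by move=> p _; exact: (@derive_val _ _ _ _ _ _ _ (is_derive_cst c p v)).
- split=> [p Op|v]; first by apply: differentiableD; [exact: fd|exact: gd].
  have [f' Bf f'E] := fv v; have [g' Bg g'E] := gv v.
  exists (fun x => f' x + g' x); first exact: gen_add.
  move=> p Op; rewrite -f'E// -g'E//.
  have dp := is_derive_add (is_derive_differentiable v (fd p Op))
    (is_derive_differentiable v (gd p Op)).
  exact: (@derive_val _ _ _ _ _ _ _ dp).
- split=> [p Op|v]; first by apply: differentiableM; [exact: fd|exact: gd].
  have [f' Bf' f'E] := fv v; have [g' Bg' g'E] := gv v.
  exists (fun x => f' x * g x + f x * g' x); first by apply: gen_add; exact: gen_mul.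
  move=> p Op; rewrite -f'E// -g'E//.
  have dp := is_derive_mul (is_derive_differentiable v (fd p Op))
    (is_derive_differentiable v (gd p Op)).
  exact: (@derive_val _ _ _ _ _ _ _ dp).
Qed.

Lemma smooth_on_class O C f : smooth_class O C -> C f -> smooth_on O f.
Proof. by exists C. Qed.

Lemma smooth_on_subset O O' f : O' `<=` O -> smooth_on O f -> smooth_on O' f.
Proof.
move=> OO [C hC Cf]; exists C => // g Cg; have [gd gv] := hC g Cg.
split=> [p /OO|v]; first exact: gd.
by have [g' Cg' g'E] := gv v; exists g' => // p /OO; exact: g'E.
Qed.

Lemma smooth_on_differentiable O f p : smooth_on O f -> O p -> differentiable f p.
Proof. by move=> [C hC /hC[fd _]]; exact: fd. Qed.

Lemma smooth_on_cst O c : smooth_on O (fun=> c).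
Proof. by exists (generated set0); [exact: smooth_generated|exact: gen_cst]. Qed.

(** The two functions come with unrelated classes; the algebra generated by their union certifies
    both. *)
Lemma smooth_on2 O f g h : smooth_on O f -> smooth_on O g ->
  (forall B : set (V -> R), B f -> B g -> generated B h) -> smooth_on O h.
Proof.
move=> [C hC Cf] [D hD Dg] fgh.
exists (generated (C `|` D)); last by apply: fgh; [left|right].
apply: smooth_generated => b [/hC|/hD] [bd bv]; split=> // v.
- by have [b' Cb b'E] := bv v; exists b' => //; apply: gen_base; left.
- by have [b' Cb b'E] := bv v; exists b' => //; apply: gen_base; right.
Qed.

Lemma smooth_on_add O f g : smooth_on O f -> smooth_on O g ->
  smooth_on O (fun x => f x + g x).
Proof. by move=> /smooth_on2/[apply]; apply=> B; move=> *; apply: gen_add; exact: gen_base. Qed.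

Lemma smooth_on_mul O f g : smooth_on O f -> smooth_on O g ->
  smooth_on O (fun x => f x * g x).
Proof. by move=> /smooth_on2/[apply]; apply=> B; move=> *; apply: gen_mul; exact: gen_base. Qed.

Lemma smooth_on_scale O c f : smooth_on O f -> smooth_on O (fun x => c * f x).
Proof. exact/smooth_on_mul/smooth_on_cst. Qed.

Lemma smooth_on_sub O f g : smooth_on O f -> smooth_on O g ->
  smooth_on O (fun x => f x - g x).
Proof.
move=> fs /(smooth_on_scale (-1)) gs.
by under eq_fun do rewrite -mulN1r; exact: smooth_on_add.
Qed.

Lemma smooth_on_sum O m (F : 'I_m -> V -> R) : (forall i, smooth_on O (F i)) ->
  smooth_on O (fun x => \sum_(i < m) F i x).
Proof.
elim: m F => [|m IH] F Fs.
  by under eq_fun do rewrite big_ord0; exact: smooth_on_cst.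
under eq_fun do rewrite big_ord_recr/=.
by apply: smooth_on_add => //; exact: IH.
Qed.

Lemma derive_comp_differentiable (h : R -> R) f (p v : V) :
  differentiable h (f p) -> differentiable f p ->
  'D_v (fun x => h (f x)) p = 'D_1 h (f p) * 'D_v f p.
Proof.
move=> hd fd.
have := is_derive_chain (is_derive_differentiable (1 : R) hd) (is_derive_differentiable v fd).
by move=> /(@derive_val _ _ _ _ _ _ _).
Qed.

(** The generators are the class of f and the pullbacks by f of the class of h; the chain rule keeps
    derivatives in the generated algebra. *)
Lemma smooth_on_comp (U : set R) O (h : R -> R) f : smooth_on U h -> smooth_on O f ->
  (forall p, O p -> U (f p)) -> smooth_on O (fun x => h (f x)).
Proof.
move=> [C hC Ch] [D hD Df] OU.
pose B := D `|` [set g | exists2 k, C k & g = (fun x => k (f x))].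
exists (generated B); last by apply: gen_base; right; exists h.
apply: smooth_generated => b [Db|[k Ck ->]].
  have [bd bv] := hD _ Db; split=> // v.
  by have [b' Db' b'E] := bv v; exists b' => //; apply: gen_base; left.
have [kd kv] := hC _ Ck; have [fd fv] := hD _ Df; split=> [p Op|v].
  by apply: (@differentiable_comp _ _ _ _ f k); [exact: fd|exact/kd/OU].
have [k' Ck' k'E] := kv 1; have [f' Df' f'E] := fv v.
exists (fun x => k' (f x) * f' x).
  by apply: gen_mul; apply: gen_base; [right; exists k'|left].
move=> p Op; rewrite derive_comp_differentiable//; [|exact/kd/OU|exact: fd].
by rewrite f'E// k'E//; exact: OU.
Qed.

(** O and the complement of K form an open cover. Vanishing off K and agreeing on O with a member of
    C are both local, hence inherited by derivatives. *)
Lemma smooth_on_extend O (K : set V) f : open O -> closed K -> K `<=` O ->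
  (forall p, ~ K p -> f p = 0) -> smooth_on O f -> smooth_on setT f.
Proof.
move=> oO cK KO f0 [C hC Cf].
have oK : open (~` K) by exact: closed_openC.
exists [set g | (forall p, ~ K p -> g p = 0) /\
  exists2 k, C k & forall p, O p -> g p = k p]; last by split=> //; exists f.
move=> g [g0 [k Ck gk]]; have [kd kv] := hC _ Ck.
have nO p : O p -> \forall q \near p, k q = g q.
  move=> Op; have : nbhs p O by exact: open_nbhs_nbhs.
  by apply: filterS => q /gk.
have nK p : ~ K p -> \forall q \near p, cst 0 q = g q.
  move=> Kp; have : nbhs p (~` K) by exact: open_nbhs_nbhs.
  by apply: filterS => q /g0.
split=> [p _|v].
  have [Kp|Kp] := pselect (K p).
    by apply: near_eq_differentiable (nO _ (KO _ Kp)) _; exact/kd/KO.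
  by apply: near_eq_differentiable (nK _ Kp) _; exact: differentiable_cst.
exists ('D_v g) => //; split.
  move=> p /nK h; rewrite -(near_eq_derive v h).
  exact: (@derive_val _ _ _ _ _ _ _ (is_derive_cst 0 p v)).
have [k' Ck' k'E] := kv v; exists k' => // p Op.
by rewrite -(near_eq_derive v (nO _ Op)) k'E.
Qed.

End closure.

Lemma smooth_on_coord k (O : set 'rV[R]_k) j : smooth_on O (fun p => p 0 j).
Proof.
exists (generated [set fun p : 'rV[R]_k => p 0 j]); last exact: gen_base.
apply: smooth_generated => _ ->; split=> [p _|v]; first exact: differentiable_coord.
exists (fun=> v 0 j); first exact: gen_cst.
move=> p _.
have := is_derive_coord (M := id) j (@derivable_id _ _ p v).
by rewrite derive_id => /(@derive_val _ _ _ _ _ _ _).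
Qed.

Lemma smooth_on_smooth k (f : 'rV[R]_k -> R) : smooth_on setT f -> smooth f.
Proof.
move=> [C hC Cf] vs p.
suff Cvs : C (foldr (fun v f => 'D_v f) f vs) by have [fd _] := hC _ Cvs; exact: fd.
elim: vs {p} => //= v vs IH; have [_ /(_ v)[g' Cg' g'E]] := hC _ IH.
rewrite (_ : 'D_v _ = g')//; apply/funext => p; exact: g'E.
Qed.

Lemma smooth_generated1 (U : set R) (B : set (R -> R)) :
  (forall b, B b -> exists2 g, generated B g & forall x, U x -> is_derive x 1 b (g x)) ->
  smooth_class U (generated B).
Proof.
move=> hB; apply: smooth_generated => b /hB[g Bg bg].
have bd x : U x -> differentiable b x.
  by move=> /bg h; apply/derivable1_diffP; exact: (@ex_derive _ _ _ _ _ _ _ h).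
split=> // v; exists (fun x => v * g x); first by apply: gen_mul => //; exact: gen_cst.
move=> x Ux; rewrite deriveE; last exact: bd.
have -> : 'd b x v = v *: ('d b x (1 : R^o)) by rewrite -linearZ/= [_ *: _]mulr1.
rewrite -deriveE; last exact: bd.
by rewrite (@derive_val _ _ _ _ _ _ _ (bg _ Ux)).
Qed.

Lemma smooth_on_derive1 (U : set R) (f : R -> R) : smooth_on U f ->
  exists2 f', smooth_on U f' & forall x, U x -> is_derive x 1 f (f' x).
Proof.
move=> [C hC Cf]; have [fd fv] := hC _ Cf.
have [f' Cf' f'E] := fv 1; exists f'; first by exists C.
by move=> x Ux; rewrite -f'E//; exact: is_derive_differentiable (fd _ Ux).
Qed.

End smooth_functions.

(** * Elementary smooth functions and cutoffs *)

Section smooth_examples.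
Context {R : realType}.
Implicit Types (x : R).

Lemma smooth_on_id (O : set R) : smooth_on O id.
Proof.
exists (generated [set id]); last exact: gen_base.
apply: smooth_generated1 => _ ->; exists (fun=> 1); first exact: gen_cst.
by move=> x _; exact: is_derive_id.
Qed.

Lemma smooth_on_inv : smooth_on [set x : R | x != 0] (fun x => x^-1).
Proof.
exists (generated [set fun x : R => x^-1]); last exact: gen_base.
apply: smooth_generated1 => _ ->; exists (fun x => -1 * (x^-1 * x^-1)).
  by apply: gen_mul; [exact: gen_cst|apply: gen_mul; exact: gen_base].
move=> x /= x0; apply: is_derive_eq (is_derive_inv x0) _.
by rewrite mulN1r -expr2 exprVn.
Qed.

Lemma smooth_on_ln : smooth_on [set x : R | 0 < x] (@ln R).
Proof.
exists (generated [set f : R -> R | f = @ln R \/ f = (fun x => x^-1)]); last first.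
  by apply: gen_base; left.
apply: smooth_generated1 => _ [->|->].
  exists (fun x => x^-1); first by apply: gen_base; right.
  by move=> x /= x0; exact: is_derive1_ln.
exists (fun x => -1 * (x^-1 * x^-1)).
  by apply: gen_mul; [exact: gen_cst|apply: gen_mul; apply: gen_base; right].
move=> x /= x0; apply: is_derive_eq (is_derive_inv (lt0r_neq0 x0)) _.
by rewrite mulN1r -expr2 exprVn.
Qed.

Lemma smooth_on_expR : smooth_on setT (@expR R).
Proof.
exists (generated [set @expR R]); last exact: gen_base.
apply: smooth_generated1 => _ ->; exists (@expR R); first exact: gen_base.
by move=> x _; exact: is_derive_expR.
Qed.

Lemma smooth_on_sin_cos : smooth_on setT (@sin R) /\ smooth_on setT (@cos R).
Proof.
have h : smooth_class setT (generated [set f : R -> R | f = @sin R \/ f = @cos R]).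
  apply: smooth_generated1 => _ [->|->].
    exists (@cos R); first by apply: gen_base; right.
    by move=> x _; exact: is_derive_sin.
  exists (fun x => -1 * sin x).
    by apply: gen_mul; [exact: gen_cst|apply: gen_base; left].
  by move=> x _; rewrite mulN1r; exact: is_derive_cos.
split; apply: (smooth_on_class h).
  by apply: gen_base; left.
by apply: gen_base; right.
Qed.

Lemma smooth_on_div (V : normedModType R) (O : set V) (f g : V -> R) :
  smooth_on O f -> smooth_on O g -> (forall p, O p -> g p != 0) ->
  smooth_on O (fun p => f p / g p).
Proof.
move=> fs gs g0; apply: smooth_on_mul => //.
exact: (smooth_on_comp smooth_on_inv gs g0).
Qed.

(* [Psi = half_aperture] solves an autonomous equation [Psi' = G(Psi)], hence so
   does every function of Psi. *)
Lemma smooth_on_half_aperture : smooth_on [set w : R | 0 < w] half_aperture.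
Proof.
pose I := [set psi : R | 0 < psi < pi].
pose G psi : R := 2 * (sin psi * (sin psi * sin psi)) / (sin psi - psi * cos psi).
have [ss cs] := smooth_on_sin_cos.
have sI : smooth_on I (@sin R) by exact: (smooth_on_subset (@subsetT _ _) ss).
have cI : smooth_on I (@cos R) by exact: (smooth_on_subset (@subsetT _ _) cs).
have idI := smooth_on_id I.
have GI : smooth_on I G.
  apply: smooth_on_div => [||psi /= /gap_gt0 h]; last by rewrite gt_eqF.
    by apply: smooth_on_scale; do 2 apply: smooth_on_mul => //.
  by apply: smooth_on_sub => //; exact: smooth_on_mul.
pose B := [set f : R -> R | exists2 phi, smooth_on I phi & f = (fun w => phi (half_aperture w))].
exists (generated B); last by apply: gen_base; exists id.
apply: smooth_generated1 => _ [phi phiI ->].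
have [phi' phi'I phid] := smooth_on_derive1 phiI.
exists (fun w => phi' (half_aperture w) * G (half_aperture w)).
  by apply: gen_base; exists (fun psi => phi' psi * G psi) => //; exact: smooth_on_mul.
move=> w /= w0; have [Iw _] := half_apertureP w0.
apply: is_derive_eq (is_derive_chain (phid _ Iw) (is_derive_half_aperture w0)) _.
by rewrite /G; congr (_ * (_ / _)); ring.
Qed.

(* [x^-k exp (-1/x)] extended by 0 to [x <= 0]. *)
Definition flat (k : nat) x : R := if 0 < x then x^-1 ^+ k * expR (- x^-1) else 0.

(** Raise 1 + y <= exp y, at y = x / (m + 1), to the power m + 1. *)
Lemma expR_geXn (m : nat) x : 0 <= x -> x ^+ m.+1 <= m.+1%:R ^+ m.+1 * expR x.
Proof.
move=> x0.
have -> : expR x = expR (x / m.+1%:R) ^+ m.+1.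
  by rewrite -expRM_natl mulrC divfK// pnatr_eq0.
rewrite -exprMn lerXn2r ?nnegrE ?mulr_ge0 ?expR_ge0//.
rewrite mulrC -ler_pdivrMr ?ltr0n//.
by apply: le_trans (expR_ge1Dx _); rewrite lerDr.
Qed.

Lemma flat_le (k : nat) x : 0 < x ->
  0 <= flat k x <= k.+2%:R ^+ k.+2 * x ^+ 2.
Proof.
move=> x0; rewrite /flat x0; have y0 : 0 < x^-1 by rewrite invr_gt0.
rewrite mulr_ge0 ?exprn_ge0 ?expR_ge0 ?(ltW y0)//= expRN ler_pdivrMr ?expR_gt0//.
have -> : x^-1 ^+ k = x ^+ 2 * x^-1 ^+ k.+2.
  by rewrite -[k.+2]add2n exprD mulrA -exprMn divff ?expr1n ?mul1r// gt_eqF.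
have -> (K E : R) : K * x ^+ 2 * E = x ^+ 2 * (K * E) by ring.
apply: ler_wpM2l; first exact: sqr_ge0.
exact: expR_geXn (ltW y0).
Qed.

Lemma is_derive_flat k x :
  is_derive x 1 (flat k) (flat k.+2 x - k%:R * flat k.+1 x).
Proof.
have [x0|x0|->] := ltgtP x 0.
- apply: (near_eq_is_derive (f := cst 0)).
    near=> y; rewrite /flat ifF//; apply/negbTE; rewrite -leNgt ltW//.
    by near: y; exact: lt_nbhsl.
  apply: is_derive_eq (is_derive_cst 0 x 1) _.
  by rewrite /flat !ifF ?mulr0 ?subr0//; apply/negbTE; rewrite -leNgt ltW.
- apply: (near_eq_is_derive (f := fun y : R => y^-1 ^+ k * expR (- y^-1))).
    near=> y; rewrite /flat ifT//.
    by near: y; exact: lt_nbhsr.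
  have dv : is_derive x 1 (fun y : R => y^-1) (- x^-1 ^+ 2).
    by apply: is_derive_eq (is_derive_inv (lt0r_neq0 x0)) _; rewrite exprVn.
  have dX : is_derive x^-1 1 (fun y : R => y ^+ k) (k%:R * x^-1 ^+ k.-1).
    rewrite (_ : (fun y : R => y ^+ k) = id ^+ k); last by rewrite exprfctE.
    apply: is_derive_eq (is_deriveX k (is_derive_id x^-1 1)) _.
    by rewrite /GRing.scale/= mulr1.
  apply: is_derive_eq (is_derive_mul (is_derive_chain dX dv)
    (is_derive_chain (is_derive_expR _) (is_derive_opp dv))) _.
  rewrite /flat x0; case: k dX => [|k] _ /=; first by rewrite !expr0; ring.
  by rewrite !exprS; ring.
have -> : flat k.+2 0 - k%:R * flat k.+1 0 = 0 by rewrite /flat ltxx mulr0 subr0.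
(* At 0 the quadratic bound [flat_le] makes the difference quotient O(h). *)
have cv : h^-1 *: ((flat k \o shift 0) (h *: (1 : R^o)) - flat k 0) @[h --> (0 : R)^'] --> (0 : R^o).
  apply/cvgrPdist_le => e e0; set M := k.+2%:R ^+ k.+2 : R.
  have M0 : 0 < M by rewrite exprn_gt0// ltr0n.
  near=> h.
  have h0 : h != 0 by near: h; exact: nbhs_dnbhs_neq.
  have he : `|h| < e / M by near: h; apply: dnbhs0_lt; rewrite divr_gt0.
  rewrite /= sub0r normrN addr0 [_ *: 1]mulr1 /GRing.scale/= {2}/flat ltxx subr0.
  have [hle|hp] := leP h 0.
    by rewrite /flat ifF ?mulr0 ?normr0 ?(ltW e0)//; apply/negbTE; rewrite -leNgt.
  have /andP[f0 fM] := flat_le k hp.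
  rewrite normrM (ger0_norm f0) normfV (gtr0_norm hp) ler_pdivrMl//.
  rewrite (le_trans fM)// expr2 mulrCA ler_wpM2l ?(ltW hp)//.
  by move: he; rewrite (gtr0_norm hp) ltr_pdivlMr// mulrC => /ltW.
split; first by apply/cvg_ex; exists 0.
by apply/cvg_lim => //.
Unshelve. all: by end_near. Qed.

Lemma smooth_on_flat k : smooth_on setT (flat k).
Proof.
exists (generated [set f | exists k, f = flat k]); last by apply: gen_base; exists k.
apply: smooth_generated1 => _ [m ->].
exists (fun x => flat m.+2 x + (- m%:R) * flat m.+1 x).
  apply: gen_add; first by apply: gen_base; exists m.+2.
  by apply: gen_mul; [exact: gen_cst|apply: gen_base; exists m.+1].
by move=> x _; rewrite mulNr; exact: is_derive_flat.
Qed.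

Notation flat0 := (flat 0).

Lemma flat0_ge0 x : 0 <= flat0 x.
Proof. by rewrite /flat; case: ifP => // _; rewrite mul1r expR_ge0. Qed.

Lemma flat0_le1 x : flat0 x <= 1.
Proof.
rewrite /flat; case: ifP => // x0; rewrite mul1r expR_le1.
by rewrite oppr_le0 invr_ge0 ltW.
Qed.

Lemma flat0_gt0 x : 0 < x -> 0 < flat0 x.
Proof. by move=> x0; rewrite /flat x0 mul1r expR_gt0. Qed.

Lemma flat0_le0 x : x <= 0 -> flat0 x = 0.
Proof. by move=> x0; rewrite /flat ltNge x0. Qed.

Definition step x : R := flat0 x / (flat0 x + flat0 (1 - x)).

Let step_den x : 0 < flat0 x + flat0 (1 - x).
Proof.
have [x0|x0] := ltP 0 x; first by rewrite ltr_pwDl ?flat0_gt0 ?flat0_ge0.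
by rewrite ltr_wpDl ?flat0_ge0 ?flat0_gt0//; lra.
Qed.

Lemma step_le0 x : x <= 0 -> step x = 0.
Proof. by move=> x0; rewrite /step flat0_le0// mul0r. Qed.

Lemma step_ge1 x : 1 <= x -> step x = 1.
Proof.
move=> x1; rewrite /step (@flat0_le0 (1 - x)) ?subr_le0// addr0 divff//.
by rewrite gt_eqF// flat0_gt0//; lra.
Qed.

Lemma step01 x : 0 <= step x <= 1.
Proof.
rewrite divr_ge0 ?flat0_ge0 ?(ltW (step_den x))//= ler_pdivrMr// mul1r.
by rewrite lerDl flat0_ge0.
Qed.

Lemma smooth_on_step : smooth_on setT step.
Proof.
have b1 : smooth_on setT (fun x => flat0 (1 - x)).
  apply: (smooth_on_comp (U := setT)) => //; first exact: smooth_on_flat.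
  by apply: smooth_on_sub; [exact: smooth_on_cst|exact: smooth_on_id].
apply: smooth_on_div => [||x _]; first exact: smooth_on_flat.
  by apply: smooth_on_add => //; exact: smooth_on_flat.
by rewrite gt_eqF.
Qed.

Lemma step_derivative : exists (step' : R -> R) (M : R),
  [/\ forall x, is_derive x 1 step (step' x), forall x, `|step' x| <= M, 0 <= M,
     forall x, x < 0 -> step' x = 0 & forall x, 1 < x -> step' x = 0].
Proof.
have [s ss sd] := smooth_on_derive1 smooth_on_step.
have {}sd x : is_derive x 1 step (s x) by exact: sd.
have s0 x : x < 0 -> s x = 0.
  move=> x0; have h : is_derive x 1 step 0.
    have e : \near x, cst 0 x = step x.
      by near=> y; rewrite step_le0// ltW//; near: y; exact: lt_nbhsl.
    by apply: near_eq_is_derive e _; apply: is_derive_eq (is_derive_cst (0 : R) x 1) _.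
  by rewrite -(@derive_val _ _ _ _ _ _ _ (sd x)) (@derive_val _ _ _ _ _ _ _ h).
have s1 x : 1 < x -> s x = 0.
  move=> x1; have h : is_derive x 1 step 0.
    have e : \near x, cst 1 x = step x.
      by near=> y; rewrite step_ge1// ltW//; near: y; exact: lt_nbhsr.
    by apply: near_eq_is_derive e _; apply: is_derive_eq (is_derive_cst (1 : R) x 1) _.
  by rewrite -(@derive_val _ _ _ _ _ _ _ (sd x)) (@derive_val _ _ _ _ _ _ _ h).
have sc : continuous s.
  by move=> x; apply: differentiable_continuous; exact: smooth_on_differentiable ss _.
have : compact [set s x | x in `[0, 1]%classic].
  by apply: continuous_compact; [exact: continuous_subspaceT|exact: segment_compact].
move=> /compact_bounded [M [_ MP]].
exists s, (`|M| + 1); split => //.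
move=> x; have [x0|x0] := ltP x 0; first by rewrite s0// normr0 addr_ge0.
have [x1|x1] := ltP 1 x; first by rewrite s1// normr0 addr_ge0.
apply: MP; first by rewrite ltr_pwDr// ler_norm.
by exists x => //=; rewrite in_itv/= x0.
Unshelve. all: by end_near. Qed.

End smooth_examples.
Notation flat0 := (flat 0).

(** * Lebesgue measure of boxes *)

Section boxes.
Context {R : realType}.

Definition tuple_box k (a b : 'I_k -> R) : set (k.-tuple (measurableTypeR R)) :=
  [set t | forall i, a i <= tnth t i <= b i].

Lemma measurable_tuple_box k (a b : 'I_k -> R) : measurable (tuple_box a b).
Proof.
rewrite (_ : tuple_box a b = \bigcap_(i in [set: 'I_k])
    (fun t : k.-tuple (measurableTypeR R) => tnth t i) @^-1` `[a i, b i]).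
  apply: fin_bigcap_measurable => // i _; rewrite -[X in measurable X]setTI.
  exact: (measurable_tnth i).
apply/seteqP; split=> t /= h i; first by move=> _; rewrite /= in_itv/=; exact: h.
by have := h i I; rewrite /= in_itv.
Qed.

Lemma lebesgue_tuple_box k (a b : 'I_k -> R) : (forall i, a i <= b i) ->
  lebesgue_tuple k (tuple_box a b) = (\prod_i (b i - a i))%:E.
Proof.
elim: k a b => [|k IH] a b ab.
  by rewrite big_ord0 /= diracE mem_set// => -[].
have -> : lebesgue_tuple k.+1 (tuple_box a b) =
    ((@lebesgue_measure R) \x (lebesgue_tuple k))%E (tcons @^-1` tuple_box a b) by [].
rewrite (_ : tcons @^-1` _ = `[a ord0, b ord0]%classic `*`
    tuple_box (a \o lift ord0) (b \o lift ord0)); last first.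
  apply/seteqP; split=> -[x t] /=.
    move=> h; split; first by rewrite /= in_itv/=; have := h ord0; rewrite tnth0.
    by move=> i /=; have := h (lift ord0 i); rewrite tnthS.
  move=> [/=]; rewrite in_itv/= => hx ht i; case: (unliftP ord0 i) => [j|] ->.
    by rewrite tnthS; exact: ht.
  by rewrite tnth0.
set B := tuple_box _ _.
have -> : (((@lebesgue_measure R) \x (lebesgue_tuple k)) (`[a ord0, b ord0]%classic `*` B) =
    lebesgue_measure `[a ord0, b ord0]%classic * lebesgue_tuple k B)%E.
  by apply: product_measure1E => //; exact: measurable_tuple_box.
rewrite /B big_ord_recl EFinM IH => [|i]; last exact: ab.
by rewrite lebesgue_measure_itv/= lte_fin; have := ab ord0; rewrite le_eqVlt =>
  /predU1P[->|->]; rewrite ?ltxx ?subrr ?mul0e// -EFinB.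
Qed.

Definition box k (a b : 'I_k -> R) : set 'rV[R]_k := [set p | forall i, a i <= p 0 i <= b i].

Lemma lebesgue_int_le k (f g : 'rV[R]_k -> \bar R) : (forall p, 0 <= f p)%E ->
  (forall p, f p <= g p)%E -> (lebesgue_int f <= lebesgue_int g)%E.
Proof.
move=> f0 fg; apply: ge0_le_integralT => [t _|t _|t _]; first exact: f0.
  exact: le_trans (f0 _) (fg _).
by split.
Qed.

Lemma lebesgue_int_ge0 k (f : 'rV[R]_k -> \bar R) : (forall p, 0 <= f p)%E ->
  (0 <= lebesgue_int f)%E.
Proof. by move=> f0; apply: integral_ge0 => t _; exact: f0. Qed.

(** The integrals evaluated below are of these step functions: they reduce to finite sums of
    volumes. *)
Definition box_sum k m (c : 'I_m -> R) (a b : 'I_m -> 'I_k -> R) (p : 'rV[R]_k) : R :=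
  \sum_(j < m) c j * \1_(box (a j) (b j)) p.

Lemma box_indicE k (a b : 'I_k -> R) (t : k.-tuple (measurableTypeR R)) :
  \1_(box a b) (\row_i (tnth t i : R)) = \1_(tuple_box a b) t :> R.
Proof.
rewrite !indicE; congr (nat_of_bool _)%:R; apply/idP/idP => /set_mem h;
  apply/mem_set => i; have := h i; by rewrite mxE.
Qed.

Lemma measurable_box_sum k m (c : 'I_m -> R) (a b : 'I_m -> 'I_k -> R) :
  measurable_fun setT (fun t : k.-tuple (measurableTypeR R) =>
    (box_sum c a b (\row_i (tnth t i : R)))%:E).
Proof.
apply/measurable_EFinP; apply: measurable_sum => j.
under eq_fun do rewrite box_indicE.
by apply: measurable_funM => //; apply: measurable_indic; exact: measurable_tuple_box.
Qed.

Lemma box_sum_ge0 k m (c : 'I_m -> R) (a b : 'I_m -> 'I_k -> R) p :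
  (forall j, 0 <= c j) -> 0 <= box_sum c a b p.
Proof. by move=> c0; apply: sumr_ge0 => j _; rewrite mulr_ge0. Qed.

Lemma lebesgue_int_box_sum k m (c : 'I_m -> R) (a b : 'I_m -> 'I_k -> R) :
  (forall j, 0 <= c j) -> (forall j i, a j i <= b j i) ->
  lebesgue_int (fun p => (box_sum c a b p)%:E) =
  (\sum_(j < m) c j * \prod_i (b j i - a j i))%:E.
Proof.
move=> c0 ab; rewrite /lebesgue_int /box_sum.
under eq_integral do rewrite -sumEFin.
rewrite ge0_integral_sum//; last 2 first.
- move=> j; apply/measurable_EFinP; under eq_fun do rewrite box_indicE.
  by apply: measurable_funM => //; apply: measurable_indic; exact: measurable_tuple_box.
- by move=> j t _; rewrite lee_fin mulr_ge0.
rewrite -sumEFin; apply: eq_bigr => j _.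
under eq_integral do rewrite box_indicE EFinM.
rewrite ge0_integralZl_EFin//; last first.
  by apply/measurable_EFinP; apply: measurable_indic; exact: measurable_tuple_box.
rewrite integral_indic//; last exact: measurable_tuple_box.
by rewrite setIT EFinM -lebesgue_tuple_box.
Qed.

Lemma lebesgue_intD k (f g : 'rV[R]_k -> \bar R) :
  (forall p, 0 <= f p)%E -> (forall p, 0 <= g p)%E ->
  measurable_fun setT (fun t : k.-tuple (measurableTypeR R) => f (\row_i (tnth t i : R))) ->
  measurable_fun setT (fun t : k.-tuple (measurableTypeR R) => g (\row_i (tnth t i : R))) ->
  lebesgue_int (fun p => f p + g p)%E = (lebesgue_int f + lebesgue_int g)%E.
Proof. by move=> f0 g0 mf mg; rewrite /lebesgue_int ge0_integralD. Qed.

End boxes.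

(** * Horizontal gradients *)

Section horizontal_gradient.
Context {R : realType} {n : nat}.
Notation heis := 'rV[R]_(n + n + 1).
Implicit Types (p q v : heis) (u w : heis -> R).
Notation rho p := (hdot p p).
Notation zc p := (p 0 (iz (n := n))).

(** For functions of rho and z: |grad rho|^2 = 4 rho, |grad z|^2 = rho / 4, and the two gradients
    are orthogonal. *)
Lemma hdot_hgrad u w p (A B A' B' : R) :
  (forall v, 'D_v u p = A * (2 * hdot p v) + B * zc v) ->
  (forall v, 'D_v w p = A' * (2 * hdot p v) + B' * zc v) ->
  hdot (hgrad u p) (hgrad w p) = (4 * A * A' + B * B' / 4) * rho p.
Proof.
move=> uE wE.
have hX i : hdot p (Xf i p) = p 0 (ix i).
  rewrite /hdot (bigD1 i)//= big1 => [|j /negPf ji]; rewrite Xf_ix Xf_iy.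
    by rewrite eqxx mulr1 mulr0 !addr0.
  by rewrite ji !mulr0 addr0.
have hY i : hdot p (Yf i p) = p 0 (iy i).
  rewrite /hdot (bigD1 i)//= big1 => [|j /negPf ji]; rewrite Yf_ix Yf_iy.
    by rewrite eqxx mulr1 mulr0 addr0 add0r.
  by rewrite ji !mulr0 addr0.
have zX i : zc (Xf i p) = - (p 0 (iy i) / 2).
  by rewrite !mxE !eqxx eq_rlshift/= mulr0n mulr1 add0r.
have zY i : zc (Yf i p) = p 0 (ix i) / 2.
  by rewrite !mxE !eqxx eq_rlshift/= mulr0n mulr1 add0r.
have gx f j : hgrad f p 0 (ix j) = 'D_(Xf j p) f p.
  exact: (frame_ix p (fun i => 'D_(Xf i p) f p) (fun i => 'D_(Yf i p) f p)).
have gy f j : hgrad f p 0 (iy j) = 'D_(Yf j p) f p.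
  exact: (frame_iy p (fun i => 'D_(Xf i p) f p) (fun i => 'D_(Yf i p) f p)).
rewrite {1}/hdot [X in _ = _ * X]/hdot mulr_sumr; apply: eq_bigr => i _.
by rewrite !gx !gy !uE !wE hX hY zX zY; field.
Qed.

Lemma derive_rho p v : is_derive p v (fun q => rho q) (2 * hdot p v).
Proof.
have := is_derive_rho (h := id) (@derivable_id _ _ p v).
by rewrite derive_id.
Qed.

Lemma derive_zc p v : is_derive p v (fun q => zc q) (zc v).
Proof.
have := is_derive_coord (M := id) (iz (n := n)) (@derivable_id _ _ p v).
by rewrite derive_id.
Qed.

Lemma smooth_on_rho (O : set heis) : smooth_on O (fun p => rho p).
Proof.
apply: smooth_on_sum => i; apply: smooth_on_add; apply: smooth_on_mul;
  exact: smooth_on_coord.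
Qed.

Lemma continuous_rho : continuous (fun p : heis => rho p).
Proof.
move=> p; apply: differentiable_continuous.
by apply: smooth_on_differentiable (smooth_on_rho setT) _.
Qed.

Lemma derive_gauge4 p v :
  is_derive p v gauge4 (2 * rho p * (2 * hdot p v) + 32 * zc p * zc v).
Proof.
apply: is_derive_eq (is_derive_add (is_derive_chain (is_derive_sqr _) (derive_rho p v))
  (is_derive_scale 16 (is_derive_chain (is_derive_sqr _) (derive_zc p v)))) _.
by ring.
Qed.

Lemma smooth_on_gauge4 (O : set heis) : smooth_on O gauge4.
Proof.
have r := smooth_on_rho O; have z := smooth_on_coord O (iz (n := n)).
rewrite (_ : gauge4 = fun p => rho p * rho p + 16 * (zc p * zc p)).
  by apply: smooth_on_add; [|apply: smooth_on_scale]; exact: smooth_on_mul.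
by apply/funext => p; rewrite /gauge4 !expr2.
Qed.

Lemma hgrad_gauge4_comp (f : R -> R) p d : is_derive (gauge4 p) 1 f d ->
  hnorm (hgrad (fun q => f (gauge4 q)) p) ^+ 2 = 16 * d ^+ 2 * rho p * gauge4 p.
Proof.
move=> fd; rewrite hnorm_sqr.
have E v : 'D_v (fun q => f (gauge4 q)) p =
    d * (2 * rho p) * (2 * hdot p v) + d * (32 * zc p) * zc v.
  have := is_derive_chain fd (derive_gauge4 p v).
  by move=> /(@derive_val _ _ _ _ _ _ _) ->; ring.
by rewrite (hdot_hgrad E E) /gauge4; field.
Qed.

Lemma rho0 : rho (0 : heis) = 0.
Proof. by rewrite /hdot big1// => i _; rewrite !mxE mulr0 addr0. Qed.

Lemma coord_sqr_le_rho p i : p 0 (ix i) ^+ 2 <= rho p /\ p 0 (iy i) ^+ 2 <= rho p.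
Proof.
rewrite /hdot (bigD1 i)//=; set S := \sum_(j < n | _) _.
have S0 : 0 <= S by apply: sumr_ge0 => j _; rewrite addr_ge0// -expr2 sqr_ge0.
rewrite -!expr2; have := sqr_ge0 (p 0 (ix i)); have := sqr_ge0 (p 0 (iy i)).
by split; lra.
Qed.

Lemma heis_index j : [\/ exists i : 'I_n, j = ix i, exists i : 'I_n, j = iy i |
  j = iz (n := n)].
Proof.
rewrite -[j]splitK; case: (fintype.split _) => [k|k] /=; last by rewrite (ord1 k); constructor 3.
rewrite -[k]splitK; case: (fintype.split _) => i /=; [constructor 1|constructor 2]; by exists i.
Qed.

Lemma coord_norm_le p (a b : R) j : rho p <= a ^+ 2 -> 0 <= a -> `|zc p| <= b ->
  `|p 0 j| <= if j == iz (n := n) then b else a.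
Proof.
move=> pa a0 zb.
have sq (x : R) : x ^+ 2 <= rho p -> `|x| <= a.
  by move=> xp; rewrite -(ger0_norm a0) -ler_sqr ?nnegrE// !real_normK ?num_real// (le_trans xp).
case: (heis_index j) => [[i ->]|[i ->]|->]; last by rewrite eqxx.
- by rewrite eq_lrshift; apply: sq; have [] := coord_sqr_le_rho p i.
- by rewrite eq_lrshift; apply: sq; have [] := coord_sqr_le_rho p i.
Qed.

Lemma test_functionI u (S : set heis) (a b : R) : 0 <= a -> closed S ->
  (forall p, S p -> rho p <= a ^+ 2 /\ `|zc p| <= b) -> ~ S 0 ->
  (forall p, ~ S p -> u p = 0) -> smooth_on setT u -> test_function u.
Proof.
move=> a0 cS Sb S0 uS su.
have sub : closure [set p | u p != 0] `<=` S.
  rewrite [X in _ `<=` X](closure_id S).1//; apply: closure_subset => p /= /eqP up.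
  by apply/not_notP => /uS.
have compS : compact S.
  apply: bounded_closed_compact => //; exists (a + `|b|); split; first exact: num_real.
  move=> M /ltW abM p Sp; have [pa pb] := Sb _ Sp; apply: le_trans abM.
  rewrite [leLHS]/Num.Def.normr/= mx_normrE; apply: bigmax_le; first by rewrite addr_ge0.
  move=> [i j] _ /=; rewrite (ord1 i); have := coord_norm_le j pa a0 pb.
  by have := ler_norm b; have := normr_ge0 b; case: ifP => _; lra.
split; first exact: smooth_on_smooth.
  by apply: (subclosed_compact _ compS sub); exact: closed_closure.
by move/sub.
Qed.

End horizontal_gradient.

(** * The full Hardy constant *)

Section profile.
Context {R : realType}.
Implicit Types (k L t : R).

(** The power t^-k with smooth cutoffs on [1, 2] and [L, 2L]; the first one hides the values of ln
    at t <= 0. *)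
Definition profile k L t := step (t - 1) * step (2 - L^-1 * t) * expR (- k * ln t).

Lemma profile_eq0 k L t : t <= 1 -> profile k L t = 0.
Proof. by move=> t1; rewrite /profile step_le0 ?mul0r// subr_le0. Qed.

Lemma smooth_on_profile k L : smooth_on setT (profile k L).
Proof.
apply: (@smooth_on_extend _ _ [set t : R | 0 < t] [set t : R | 1 <= t]).
- exact: open_gt.
- exact: closed_ge.
- by move=> t /= h; exact: lt_le_trans h.
- by move=> t /= /negP; rewrite -ltNge => /ltW; exact: profile_eq0.
have idO := smooth_on_id [set t : R | 0 < t].
have stepO f : smooth_on [set t : R | 0 < t] f ->
    smooth_on [set t : R | 0 < t] (fun t => step (f t)).
  by move=> fO; apply: (smooth_on_comp smooth_on_step fO).
apply: smooth_on_mul; first apply: smooth_on_mul.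
- by apply: stepO; apply: smooth_on_sub => //; exact: smooth_on_cst.
- apply: stepO; apply: smooth_on_sub; first exact: smooth_on_cst.
  exact: smooth_on_scale.
- apply: (smooth_on_comp (smooth_on_expR) _ (fun _ _ => I)).
  by apply: smooth_on_scale; exact: smooth_on_ln.
Qed.

Lemma profile01 k L t : 0 <= k -> 0 <= profile k L t <= 1.
Proof.
move=> k0; have [t1|t1] := leP t 1; first by rewrite profile_eq0// lexx ler01.
have /andP[a0 a1] := step01 (t - 1); have /andP[b0 b1] := step01 (2 - L^-1 * t).
have e1 : expR (- k * ln t) <= 1.
  by rewrite expR_le1 mulNr oppr_le0 mulr_ge0// ln_ge0// ltW.
rewrite /profile; move: a0 a1 b0 b1 (expR_ge0 (- k * ln t)) e1.
move: (step _) (step _) (expR _) => a b e a0 a1 b0 b1 e0 e1.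
by rewrite !mulr_ge0//= -[leRHS](mulr1 1) ler_pM ?mulr_ge0// mulr_ile1.
Qed.

Lemma profile_mid k L t : 2 <= t -> t <= L -> profile k L t = expR (- k * ln t).
Proof.
move=> t2 tL; have L0 : 0 < L by apply: lt_le_trans tL; lra.
have h : L^-1 * t <= 1 by rewrite mulrC ler_pdivrMr// mul1r.
by rewrite /profile !step_ge1 ?mul1r//; lra.
Qed.

(** M does not depend on L: the slope of the outer cutoff is O(1/L), comparable with the logarithmic
    derivative of t^-k at that scale. *)
Lemma profile_derivative k : 0 <= k -> exists2 M : R, 0 <= M & forall L, 2 < L ->
  exists f' : R -> R, [/\ forall t, is_derive t 1 (profile k L) (f' t),
   forall t, 0 < t -> t < 1 \/ 2 * L < t -> f' t = 0,
   forall t, 1 <= t <= 2 -> `|f' t| <= M,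
   forall t, 2 < t < L -> f' t = - k / t * profile k L t &
   forall t, L <= t <= 2 * L -> `|f' t| <= M / L * expR (- k * ln L)].
Proof.
move=> k0; have [s [M [sd sM M0 s0 s1]]] := @step_derivative R.
exists (2 * M + k); first by lra.
move=> L L2; have L0 : 0 < L by lra.
have [f' _ f'd] := smooth_on_derive1 (smooth_on_profile k L).
have f'E t : 0 < t -> f' t =
    (s (t - 1) * step (2 - L^-1 * t) + step (t - 1) * (- (L^-1 * s (2 - L^-1 * t)))) *
      expR (- k * ln t) +
    step (t - 1) * step (2 - L^-1 * t) * (expR (- k * ln t) * (- k / t)).
  move=> t0; rewrite -(@derive_val _ _ _ _ _ _ _ (f'd t I)).
  have d1 : is_derive t 1 (fun t : R => t - 1) 1.
    apply: is_derive_eq (is_derive_add (is_derive_id t 1) (is_derive_cst (- 1 : R) t 1)) _.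
    by rewrite addr0.
  have d2 : is_derive t 1 (fun t : R => 2 - L^-1 * t) (- L^-1).
    apply: is_derive_eq (is_derive_add (is_derive_cst (2 : R) t 1) (is_derive_opp
      (is_derive_scale L^-1 (is_derive_id t 1)))) _.
    by rewrite mulr1 add0r.
  have d3 := is_derive_scale (- k) (is_derive1_ln t0).
  have d := is_derive_mul (is_derive_mul
    (is_derive_chain (f := fun t : R => t - 1) (sd _) d1)
    (is_derive_chain (f := fun t : R => 2 - L^-1 * t) (sd _) d2))
    (is_derive_chain (f := fun t : R => - k * ln t) (is_derive_expR _) d3).
  rewrite (@derive_val _ _ _ _ _ _ _ d); ring.
have eL t : 1 <= t -> 0 < expR (- k * ln t) <= 1.
  move=> t1; rewrite expR_gt0/= expR_le1 mulNr oppr_le0 mulr_ge0// ln_ge0//.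
exists f'; split.
- by move=> t; exact: f'd.
- move=> t t0 [t1|tL]; rewrite f'E//.
    by rewrite s0 ?subr_lt0// (@step_le0 _ (t - 1)) ?subr_le0 ?ltW//; ring.
  have h : 2 - L^-1 * t < 0.
    by rewrite subr_lt0 mulrC ltr_pdivlMr.
  by rewrite (@step_le0 _ (2 - _)) ?ltW// (@s0 (2 - _))//; ring.
- move=> t /andP[t1 t2]; have t0 : 0 < t by lra.
  rewrite f'E//; have /andP[e0 e1] := eL _ t1.
  have /andP[a0 a1] := step01 (t - 1); have /andP[b0 b1] := step01 (2 - L^-1 * t).
  have L1 : L^-1 <= 1 by rewrite invf_le1//; lra.
  have L1' : 0 <= L^-1 by rewrite invr_ge0 ltW.
  have ti : t^-1 <= 1 by rewrite invf_le1.
  have ti' : 0 <= t^-1 by rewrite invr_ge0 ltW.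
  have n1 : `|s (t - 1) * step (2 - L^-1 * t)| <= M * 1.
    by rewrite normrM; apply: ler_pM => //; rewrite ger0_norm.
  have n2 : `|step (t - 1) * - (L^-1 * s (2 - L^-1 * t))| <= 1 * (1 * M).
    rewrite normrM normrN [`|L^-1 * _|]normrM.
    apply: ler_pM; [exact: normr_ge0|by rewrite mulr_ge0|by rewrite (ger0_norm a0)|].
    by apply: ler_pM => //; rewrite (ger0_norm L1').
  have n3 : `|step (t - 1) * step (2 - L^-1 * t) * (expR (- k * ln t) * (- k / t))|
      <= 1 * 1 * (1 * (k * 1)).
    move: a0 a1 b0 b1; move: (step (t - 1)) (step (2 - _)) => A B a0 a1 b0 b1.
    rewrite [- k / t]mulNr 2!mulrN normrN ger0_norm ?mulr_ge0 ?(ltW e0)//.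
    by apply: ler_pM; rewrite ?mulr_ge0 ?(ltW e0)//; apply: ler_pM;
      rewrite ?mulr_ge0 ?(ltW e0)//; apply: ler_pM.
  apply: (le_trans (ler_normD _ _)).
  have n4 : `|(s (t - 1) * step (2 - L^-1 * t) +
      step (t - 1) * - (L^-1 * s (2 - L^-1 * t))) * expR (- k * ln t)| <= (M + M) * 1.
    rewrite normrM ler_pM//; last by rewrite ger0_norm// ltW.
    by apply: (le_trans (ler_normD _ _)); lra.
  lra.
- move=> t /andP[t2 tL]; have t0 : 0 < t by lra.
  rewrite f'E// s1; last lra.
  have h : 1 < 2 - L^-1 * t.
    have : L^-1 * t < 1 by rewrite mulrC ltr_pdivrMr// mul1r.
    lra.
  rewrite s1// !step_ge1 ?(ltW h)//; last lra.
  rewrite profile_mid ?(ltW t2) ?(ltW tL)//; ring.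
- move=> t /andP[Lt1 t2L]; have t0 : 0 < t by lra.
  rewrite f'E// s1; last lra.
  have /andP[a0 a1] := step01 (t - 1); have /andP[b0 b1] := step01 (2 - L^-1 * t).
  have eLt : 0 < expR (- k * ln t) <= expR (- k * ln L).
    by rewrite expR_gt0/= ler_expR !mulNr lerN2 ler_wpM2l// ler_ln.
  have /andP[e0 e1] := eLt.
  have L1' : 0 <= L^-1 by rewrite invr_ge0 ltW.
  have ti : t^-1 <= L^-1 by rewrite lef_pV2.
  have ti' : 0 <= t^-1 by rewrite invr_ge0 ltW.
  have n2 : `|step (t - 1) * - (L^-1 * s (2 - L^-1 * t))| <= 1 * (L^-1 * M).
    rewrite normrM normrN [`|L^-1 * _|]normrM.
    apply: ler_pM; [exact: normr_ge0|by rewrite mulr_ge0|by rewrite (ger0_norm a0)|].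
    by apply: ler_pM => //; rewrite (ger0_norm L1').
  have n3 : `|step (t - 1) * step (2 - L^-1 * t) * (expR (- k * ln t) * (- k / t))|
      <= 1 * 1 * (expR (- k * ln L) * (k * L^-1)).
    move: a0 a1 b0 b1; move: (step (t - 1)) (step (2 - _)) => A B a0 a1 b0 b1.
    rewrite [- k / t]mulNr 2!mulrN normrN ger0_norm ?mulr_ge0 ?(ltW e0)//.
    by apply: ler_pM; rewrite ?mulr_ge0 ?(ltW e0)//; apply: ler_pM;
      rewrite ?mulr_ge0 ?(ltW e0)//; apply: ler_pM.
  apply: (le_trans (ler_normD _ _)); rewrite mul0r add0r.
  have n4 : `|step (t - 1) * - (L^-1 * s (2 - L^-1 * t)) * expR (- k * ln t)| <=
      (1 * (L^-1 * M)) * expR (- k * ln L).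
    by rewrite normrM ler_pM//; rewrite ger0_norm// ltW.
  apply: (le_trans (lerD n4 n3)).
  have -> : 1 * (L^-1 * M) * expR (- k * ln L) + 1 * 1 * (expR (- k * ln L) * (k * L^-1)) =
    (M + k) / L * expR (- k * ln L) by ring.
  by rewrite !ler_wpM2r ?expR_ge0//; lra.
Qed.

End profile.

(** * Energy density of the truncated gauge power *)

Section full_constant.
Context {R : realType} {n : nat}.
Notation heis := 'rV[R]_(n + n + 1).
Implicit Types (p q v : heis) (u w : heis -> R).
Notation rho p := (hdot p p).
Notation zc p := (p 0 (iz (n := n))).

(** The vertical side is separate because dilations scale z quadratically. *)
Definition sides (c d : R) (j : 'I_(n + n + 1)) : R := if j == iz (n := n) then d else c.

Lemma prod_sides (a b c d : R) :
  \prod_j (sides b d j - sides a c j) = (b - a) ^+ (n + n) * (d - c).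
Proof.
rewrite (bigD1 (iz (n := n)))//= /sides eqxx mulrC; congr (_ * _).
rewrite (eq_bigr (fun=> b - a)) => [|j /negPf ->//].
by rewrite prodr_const cardC1 card_ord addn1.
Qed.

Lemma lebesgue_int_box (a b C : R) : 0 <= C -> 0 <= a -> 0 <= b ->
  lebesgue_int (fun p => (C * \1_(box (sides (- a) (- b)) (sides a b)) p)%:E) =
  (C * ((2 * a) ^+ (n + n) * (2 * b)))%:E.
Proof.
move=> C0 a0 b0.
have E (x : R) : 2 * x = x - - x by rewrite opprK mulr_natl.
have ab j : sides (- a) (- b) j <= sides a b j by rewrite /sides; case: ifP => _; lra.
have := @lebesgue_int_box_sum R _ 1 (fun=> C) (fun=> sides (- a) (- b))
  (fun=> sides a b) (fun=> C0) (fun=> ab).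
rewrite big_ord1 prod_sides !E => <-.
by congr lebesgue_int; apply/funext => p; rewrite /box_sum big_ord1.
Qed.

Lemma gauge4_ge0 p : 0 <= gauge4 p.
Proof. by rewrite addr_ge0 ?sqr_ge0// mulr_ge0 ?sqr_ge0. Qed.

Lemma gauge4_le_coord p s : 0 <= s -> gauge4 p <= s ^+ 4 ->
  rho p <= s ^+ 2 /\ `|zc p| <= s ^+ 2.
Proof.
move=> s0 ps; have := sqr_ge0 (rho p); have := sqr_ge0 (zc p) => z2 r2.
have s4 : s ^+ 4 = (s ^+ 2) ^+ 2 by rewrite -exprM.
move: ps; rewrite /gauge4 s4 => ps.
split.
  by rewrite -ler_sqr ?nnegrE ?sqr_ge0 ?hdot_ge0//; lra.
rewrite -ler_sqr ?nnegrE ?sqr_ge0 ?normr_ge0//.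
by rewrite real_normK ?num_real//; lra.
Qed.

Lemma gauge4_le_box p s : 0 <= s -> gauge4 p <= s ^+ 4 ->
  box (sides (- s) (- s ^+ 2)) (sides s (s ^+ 2)) p.
Proof.
move=> s0 /(gauge4_le_coord s0)[ps zs] j; have := coord_norm_le j ps s0 zs.
by rewrite /sides ler_norml; case: ifP.
Qed.

Lemma lt_gauge4_indic p s : 0 <= s -> gauge4 p <= s ^+ 4 ->
  \1_(box (sides (- s) (- s ^+ 2)) (sides s (s ^+ 2))) p = 1 :> R.
Proof. by move=> s0 ps; rewrite indicE mem_set//; exact: gauge4_le_box. Qed.

Notation k4 := (n%:R / 4 : R).
Definition trial (mu : R) p := profile k4 (mu ^+ 4) (gauge4 p).

Lemma trial_test (mu : R) : 1 < mu -> test_function (trial mu).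
Proof.
move=> mu1; have k0 : 0 <= k4 by rewrite divr_ge0.
apply: (@test_functionI _ _ _ (gauge4 @^-1` [set t | 1 <= t <= 2 * mu ^+ 4])
  (2 * mu) ((2 * mu) ^+ 2)).
- by lra.
- have gc : continuous (@gauge4 R n).
    move=> p; apply: differentiable_continuous.
    by apply: smooth_on_differentiable (smooth_on_gauge4 setT) _.
  apply: preimage_closed => [q _|]; first exact: gc.
  rewrite (_ : [set t | _] = `[1, 2 * mu ^+ 4]%classic); first exact: interval_closed.
  by apply/seteqP; split=> t /=; rewrite in_itv.
- move=> p /= /andP[_ pmu]; apply: gauge4_le_coord; first lra.
  apply: le_trans pmu _; rewrite exprMn ler_wpM2r ?exprn_ge0//; lra.
- by rewrite /= /gauge4 rho0 mxE !expr0n/= mulr0 addr0 ler10.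
- move=> p /= /negP; rewrite negb_and -!ltNge => /orP[|] h.
    by rewrite /trial profile_eq0// ltW.
  rewrite /trial /profile (@step_le0 _ (2 - _)) ?mulr0 ?mul0r// subr_le0.
  by rewrite mulrC ler_pdivlMr ?exprn_gt0 ?(ltW h)//; lra.
- apply: (smooth_on_comp (smooth_on_profile _ _) (smooth_on_gauge4 _)) => //.
Qed.

Lemma expR_gauge (mu : R) : 0 < mu -> expR (- k4 * ln (mu ^+ 4)) = (mu^-1) ^+ n.
Proof.
move=> mu0; rewrite lnXn// -[in RHS](lnK (_ : mu \is Num.pos))// -expRN -expRM_natl.
by congr expR; rewrite -mulr_natl; field.
Qed.

Lemma mul3_le (c x y z a b d : R) : 0 <= c -> 0 <= x <= a -> 0 <= y <= b -> 0 <= z <= d ->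
  c * x * y * z <= c * a * b * d.
Proof.
move=> c0 /andP[x0 xa] /andP[y0 yb] /andP[z0 zd].
by apply: ler_pM => //; [rewrite !mulr_ge0|apply: ler_pM => //; [rewrite mulr_ge0|exact: ler_wpM2l]].
Qed.

(** Between the cutoffs the first term is exact. Each cutoff shell lies in a box, and 64 = 16 * 2 *
    2 comes from the bounds on rho and K there. The outer coefficient has order mu^-(2n + 2), the
    inverse of the volume of its box. *)
Lemma trial_density : exists2 M : R, 0 <= M & forall mu p, 2 <= mu ->
  hnorm (hgrad (trial mu) p) ^+ 2 <= n%:R ^+ 2 * (trial mu p ^+ 2 * (rho p / gauge4 p)) +
    64 * M ^+ 2 * \1_(box (sides (- 2) (- 2 ^+ 2)) (sides 2 (2 ^+ 2))) p +
    64 * (M / mu ^+ 4 * (mu^-1) ^+ n) ^+ 2 * mu ^+ 6 *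
      \1_(box (sides (- (2 * mu)) (- (2 * mu) ^+ 2)) (sides (2 * mu) ((2 * mu) ^+ 2))) p.
Proof.
have k0 : 0 <= k4 by rewrite divr_ge0.
have [M M0 PM] := profile_derivative k0; exists M => // mu p mu2.
have mu0 : 0 < mu by lra.
have L2 : 2 < mu ^+ 4.
  have : 2 ^+ 4 <= mu ^+ 4 by rewrite lerXn2r// ?nnegrE//; lra.
  have -> : (2 : R) ^+ 4 = 16 by ring.
  lra.
have [f' [fd f0 f12 f2L fL2]] := PM _ L2.
rewrite (hgrad_gauge4_comp (fd _)).
set d := f' _; set K := gauge4 p; set r := rho p.
set I1 := \1_ _ p; set I2 := \1_ _ p.
have I10 : 0 <= I1 by rewrite /I1 indicE.
have I20 : 0 <= I2 by rewrite /I2 indicE.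
have r0 : 0 <= r by exact: hdot_ge0.
have K0 : 0 <= K by exact: gauge4_ge0.
have X0 : 0 <= n%:R ^+ 2 * (trial mu p ^+ 2 * (r / K)).
  by apply: mulr_ge0; [|apply: mulr_ge0]; rewrite ?sqr_ge0 ?divr_ge0.
set C2 := 64 * (M / mu ^+ 4 * (mu^-1) ^+ n) ^+ 2 * mu ^+ 6.
have C20 : 0 <= C2 by apply: mulr_ge0; [apply: mulr_ge0 => //; exact: sqr_ge0|apply: exprn_ge0; exact: ltW].
have C10 : 0 <= 64 * M ^+ 2 by rewrite mulr_ge0 ?sqr_ge0.
have T1 : 0 <= 64 * M ^+ 2 * I1 by rewrite mulr_ge0.
have T2 : 0 <= C2 * I2 by rewrite mulr_ge0.
have [K00|KN0] := eqVneq K 0; first by have -> : 16 * d ^+ 2 * r * K = 0; [rewrite K00 mulr0|rewrite !addr_ge0].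
have Kp : 0 < K by rewrite lt_def KN0.
have [K1|K1] := ltP K 1.
  by rewrite /d f0//; [rewrite expr0n/= mulr0 !mul0r !addr_ge0|left].
have [K2|K2] := leP K 2.
  have I11 : I1 = 1.
    by apply: lt_gauge4_indic => //; rewrite -/K; apply: (le_trans K2); rewrite !exprS expr0; lra.
  have [rs _] : r <= 2 ^+ 2 /\ `|zc p| <= 2 ^+ 2.
    by apply: gauge4_le_coord => //; rewrite -/K; apply: (le_trans K2); rewrite !exprS expr0; lra.
  have r2 : r <= 2.
    rewrite -ler_sqr ?nnegrE// (le_trans (_ : _ <= K))//; last by rewrite expr2; lra.
    by rewrite /K /gauge4 lerDl mulr_ge0 ?sqr_ge0.
  have dM : d ^+ 2 <= M ^+ 2.
    by rewrite -(@real_normK _ d) ?num_real// ler_sqr ?nnegrE// f12// K1 K2.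
  have : 16 * d ^+ 2 * r * K <= 16 * M ^+ 2 * 2 * 2.
      by apply: mul3_le => //; apply/andP; split => //; exact: sqr_ge0.
  rewrite I11; lra.
have [KL|KL] := ltP K (mu ^+ 4).
  have -> : 16 * d ^+ 2 * r * K = n%:R ^+ 2 * (trial mu p ^+ 2 * (r / K)).
    by rewrite /d f2L ?K2// /trial -/K; field.
  lra.
have [K2L|K2L] := leP K (2 * mu ^+ 4); last first.
  by rewrite /d f0//; [rewrite expr0n/= mulr0 !mul0r !addr_ge0|right].
have Ks : K <= (2 * mu) ^+ 4.
  apply: (le_trans K2L); rewrite exprMn ler_wpM2r ?exprn_ge0 ?(ltW mu0)//.
  by rewrite !exprS expr0; lra.
have I21 : I2 = 1 by apply: lt_gauge4_indic => //; lra.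
have m2 : 0 <= 2 * mu ^+ 2 by apply: mulr_ge0 => //; exact: sqr_ge0.
have r2 : r <= 2 * mu ^+ 2.
  have r2K : r ^+ 2 <= K by rewrite /K /gauge4 lerDl mulr_ge0 ?sqr_ge0.
  have m4 : 2 * mu ^+ 4 <= (2 * mu ^+ 2) ^+ 2.
    have h : 0 <= mu ^+ 4 by rewrite exprn_ge0// ltW.
    by rewrite exprMn -exprM; lra.
  by rewrite -ler_sqr ?nnegrE// (le_trans r2K)// (le_trans K2L).
have dM : d ^+ 2 <= (M / mu ^+ 4 * (mu^-1) ^+ n) ^+ 2.
  rewrite -(@real_normK _ d) ?num_real// ler_sqr ?nnegrE//; last first.
    by rewrite !mulr_ge0 ?invr_ge0 ?exprn_ge0 ?invr_ge0 ?(ltW mu0).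
  by rewrite -expR_gauge// fL2// KL K2L.
have : 16 * d ^+ 2 * r * K <=
    16 * (M / mu ^+ 4 * (mu^-1) ^+ n) ^+ 2 * (2 * mu ^+ 2) * (2 * mu ^+ 4).
  apply: mul3_le => //; apply/andP; split => //; exact: sqr_ge0.
have -> : 16 * (M / mu ^+ 4 * (mu^-1) ^+ n) ^+ 2 * (2 * mu ^+ 2) * (2 * mu ^+ 4) = C2.
  by rewrite /C2; ring.
rewrite I21; lra.
Qed.

End full_constant.

Section full_constant_bound.
Context {R : realType} {n : nat}.
Notation heis := 'rV[R]_(n + n + 1).
Implicit Types (p q v : heis) (u w : heis -> R).
Notation rho p := (hdot p p).
Notation zc p := (p 0 (iz (n := n))).
Notation k4 := (n%:R / 4 : R).
Notation point t := (\row_i (tnth t i : R)).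

Let k40 : 0 <= k4. Proof. by rewrite divr_ge0. Qed.

(** The term common to both sides: n^2 times its integral bounds the energy up to a constant, while
    the weight exceeds its integral by a multiple of the number of scales. *)
Definition main_density (mu : R) p := trial mu p ^+ 2 * (rho p / gauge4 p).

Lemma main_density_ge0 mu p : 0 <= main_density mu p.
Proof.
by apply: mulr_ge0; [exact: sqr_ge0|apply: divr_ge0; [exact: hdot_ge0|exact: gauge4_ge0]].
Qed.

Lemma measurable_coord j : measurable_fun setT
  (fun t : (n + n + 1).-tuple (measurableTypeR R) => (point t : heis) 0 j).
Proof. by under eq_fun do rewrite mxE; exact: measurable_tnth. Qed.

Lemma measurable_rho : measurable_fun setT
  (fun t : (n + n + 1).-tuple (measurableTypeR R) => rho (point t : heis)).
Proof.
apply: measurable_sum => i; apply: measurable_funD; apply: measurable_funM;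
  exact: measurable_coord.
Qed.

Lemma measurable_gauge4 : measurable_fun setT
  (fun t : (n + n + 1).-tuple (measurableTypeR R) => gauge4 (point t : heis)).
Proof.
apply: measurable_funD; first by apply: measurable_funX; exact: measurable_rho.
by apply: measurable_funM => //; apply: measurable_funX; exact: measurable_coord.
Qed.

(** The singularity of 1 / t is harmless because the profile vanishes for t <= 1. *)
Lemma continuous_profile_div L : continuous (fun t : R => profile k4 L t ^+ 2 / t).
Proof.
have pc (t : R) : {for t, continuous (profile k4 L)}.
  apply: differentiable_continuous.
  exact: (smooth_on_differentiable (smooth_on_profile k4 L)).
move=> t; have [t1|t1] := ltP t 1.
  have e : \near t, cst 0 t = profile k4 L t ^+ 2 / t.
    near=> s; rewrite profile_eq0 ?expr0n ?mul0r// ltW//.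
    by near: s; exact: lt_nbhsl.
  rewrite /continuous_at /= profile_eq0 ?(ltW t1)// expr0n/= mul0r.
  by apply: cvg_trans (near_eq_cvg e) _; exact: cvg_cst.
have t0 : t != 0 by rewrite gt_eqF//; lra.
apply: cvgM; last exact: cvgV.
by rewrite expr2; under eq_fun do rewrite expr2; apply: cvgM; exact: pc.
Unshelve. all: by end_near. Qed.

Lemma measurable_main_density mu : measurable_fun setT
  (fun t : (n + n + 1).-tuple (measurableTypeR R) =>
     (main_density mu (point t : heis))%:E).
Proof.
apply/measurable_EFinP.
under eq_fun do rewrite /main_density mulrCA mulrC.
apply: measurable_funM; last exact: measurable_rho.
apply: (@measurableT_comp _ _ _ _ _ _ (fun s => profile k4 (mu ^+ 4) s ^+ 2 / s)).
  by apply: continuous_measurable_fun; exact: continuous_profile_div.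
exact: measurable_gauge4.
Qed.

Lemma measurable_box_indic (C : R) (a b : 'I_(n + n + 1) -> R) : measurable_fun setT
  (fun t : (n + n + 1).-tuple (measurableTypeR R) => (C * \1_(box a b) (point t))%:E).
Proof.
apply/measurable_EFinP; under eq_fun do rewrite box_indicE.
by apply: measurable_funM => //; apply: measurable_indic; exact: measurable_tuple_box.
Qed.

Notation X mu := (lebesgue_int (fun p => (main_density mu p)%:E)).

Lemma energy_trial_le : exists2 E0 : R, 0 <= E0 & forall mu, 2 <= mu ->
  (energy (trial mu : heis -> R) <= (n%:R ^+ 2)%:E * X mu + E0%:E)%E.
Proof.
have [M M0 PM] := @trial_density R n.
exists `|64 * M ^+ 2 * ((2 * 2) ^+ (n + n) * (2 * 2 ^+ 2)) +
  512 * M ^+ 2 * 4 ^+ (n + n) * 1| => //.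
move=> mu mu2; have mu0 : 0 < mu by lra.
pose C2 := 64 * (M / mu ^+ 4 * (mu^-1) ^+ n) ^+ 2 * mu ^+ 6.
have C20 : 0 <= C2.
  by apply: mulr_ge0; [apply: mulr_ge0 => //; exact: sqr_ge0|apply: exprn_ge0; exact: ltW].
have C10 : 0 <= 64 * M ^+ 2 by rewrite mulr_ge0 ?sqr_ge0.
pose f1 p : \bar R := (n%:R ^+ 2 * main_density mu p)%:E.
pose f2 p : \bar R :=
  (64 * M ^+ 2 * \1_(box (sides (- 2) (- 2 ^+ 2)) (sides 2 (2 ^+ 2))) p)%:E.
pose f3 p : \bar R := (C2 *
  \1_(box (sides (- (2 * mu)) (- (2 * mu) ^+ 2)) (sides (2 * mu) ((2 * mu) ^+ 2))) p)%:E.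
have f10 p : (0 <= f1 p)%E.
  by rewrite lee_fin mulr_ge0 ?sqr_ge0 ?main_density_ge0.
have f20 p : (0 <= f2 p)%E by rewrite lee_fin mulr_ge0// indicE.
have f30 p : (0 <= f3 p)%E by rewrite lee_fin mulr_ge0// indicE.
have mf1 : measurable_fun setT
    (fun t : (n + n + 1).-tuple (measurableTypeR R) => f1 (point t)).
  rewrite /f1; under eq_fun do rewrite EFinM.
  by apply: measurable_funeM; exact: measurable_main_density.
have mf2 : measurable_fun setT
    (fun t : (n + n + 1).-tuple (measurableTypeR R) => f2 (point t)).
  exact: measurable_box_indic.
have mf3 : measurable_fun setT
    (fun t : (n + n + 1).-tuple (measurableTypeR R) => f3 (point t)).
  exact: measurable_box_indic.
apply: (@le_trans _ _ (lebesgue_int (fun p => (f1 p + f2 p) + f3 p)%E)).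
  apply: lebesgue_int_le => p; first by rewrite lee_fin sqr_ge0.
  by rewrite /f1 /f2 /f3 -!EFinD lee_fin; exact: PM.
rewrite lebesgue_intD//; last 2 first.
- by move=> p; rewrite adde_ge0.
- exact: emeasurable_funD.
rewrite lebesgue_intD//.
have -> : lebesgue_int f1 = ((n%:R ^+ 2)%:E * X mu)%E.
  rewrite /lebesgue_int /f1; under eq_integral do rewrite EFinM.
  rewrite ge0_integralZl_EFin ?sqr_ge0//.
  - by move=> t _; rewrite lee_fin main_density_ge0.
  - exact: measurable_main_density.
rewrite /f2 /f3 !lebesgue_int_box ?sqr_ge0//; last by lra.
rewrite -addeA -EFinD; apply: leeD2l.
rewrite lee_fin; apply: le_trans (ler_norm _); rewrite lerD2l.
(* The powers of mu cancel between the outer coefficient and the volume of its box, so the bound is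
   uniform in mu. *)
have YZ : (mu^-1) ^+ n * mu ^+ n = 1 by rewrite -exprMn mulVf ?expr1n// gt_eqF.
have -> : 2 * (2 * mu) = 4 * mu by ring.
rewrite /C2 [(4 * mu) ^+ _]exprMn [mu ^+ (n + n)]exprD.
have -> : 64 * (M / mu ^+ 4 * mu^-1 ^+ n) ^+ 2 * mu ^+ 6 *
    (4 ^+ (n + n) * (mu ^+ n * mu ^+ n) * (2 * (2 * mu) ^+ 2)) =
  512 * M ^+ 2 * 4 ^+ (n + n) * (mu^-1 ^+ n * mu ^+ n) ^+ 2.
  by move: (mu^-1 ^+ n) (mu ^+ n) (4 ^+ (n + n)) => Y Z W; field; rewrite gt_eqF.
by rewrite YZ expr1n.
Qed.

Lemma main_density_fin mu : 2 <= mu -> (X mu < +oo)%E.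
Proof.
move=> mu2; have mu0 : 0 < mu by lra.
have B0 : 0 <= (2 * mu) ^+ 2 by rewrite sqr_ge0.
have m0 : 0 <= 2 * mu by lra.
apply: (@le_lt_trans _ _ (lebesgue_int (fun p => ((2 * mu) ^+ 2 *
  \1_(box (sides (- (2 * mu)) (- (2 * mu) ^+ 2)) (sides (2 * mu) ((2 * mu) ^+ 2))) p)%:E))).
  apply: lebesgue_int_le => p; first by rewrite lee_fin main_density_ge0.
  rewrite lee_fin /main_density /trial.
  have [K1|K1] := leP (gauge4 p) 1.
    rewrite profile_eq0// expr0n/= mul0r; apply: mulr_ge0 => //; by rewrite indicE.
  have L0 : 0 < mu ^+ 4 by rewrite exprn_gt0.
  have [KL|KL] := leP (2 * mu ^+ 4) (gauge4 p).
    rewrite /profile (@step_le0 _ (2 - _)) ?mulr0 ?mul0r ?expr0n/= ?mul0r.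
      apply: mulr_ge0 => //; by rewrite indicE.
    by rewrite subr_le0 mulrC ler_pdivlMr.
  have Ks : gauge4 p <= (2 * mu) ^+ 4.
    apply: (le_trans (ltW KL)); rewrite exprMn ler_wpM2r ?(ltW L0)//.
    have -> : (2 : R) ^+ 4 = 16 by ring.
    lra.
  rewrite lt_gauge4_indic// mulr1.
  have [rs _] := gauge4_le_coord m0 Ks.
  have /andP[u0 u1] := profile01 (mu ^+ 4) (gauge4 p) k40.
  have -> : (2 * mu) ^+ 2 = 1 * (2 * mu) ^+ 2 by rewrite mul1r.
  apply: ler_pM.
  - exact: sqr_ge0.
  - by apply: divr_ge0; [exact: hdot_ge0|exact: gauge4_ge0].
  - by rewrite expr_le1.
  - apply: le_trans rs; rewrite ler_pdivrMr; last lra.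
    by rewrite ler_peMr ?hdot_ge0// ltW.
by rewrite lebesgue_int_box ?ltry.
Qed.

End full_constant_bound.

(** * Gain of the strict inequality, scale by scale *)

Section full_constant_gain.
Context {R : realType} {n : nat}.
Context (n_gt0 : (1 <= n)%N).
Notation heis := 'rV[R]_(n + n + 1).
Implicit Types (p q v : heis) (u w : heis -> R).
Notation rho p := (hdot p p).
Notation zc p := (p 0 (iz (n := n))).
Notation k4 := (n%:R / 4 : R).
Notation N := (n%:R : R).
Notation X mu := (lebesgue_int (fun p : heis => (main_density mu p)%:E)).

Let N1 : 1 <= N. Proof. by rewrite (ler_nat _ 1). Qed.
Let N0 : 0 < N. Proof. by rewrite ltr0n. Qed.

(** The image under the dilation of ratio l of a fixed box off the plane z = 0; its volume is l^(2n
    + 2). *)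
Definition cone_box (l : R) : set heis := box (sides l (l ^+ 2)) (sides (2 * l) (2 * l ^+ 2)).

Lemma cone_box_bounds p (l : R) : 0 < l -> cone_box l p ->
  [/\ 2 * N * l ^+ 2 <= rho p, rho p <= 8 * N * l ^+ 2, l ^+ 2 <= zc p & zc p <= 2 * l ^+ 2].
Proof.
move=> l0 Bp.
have hx i : l <= p 0 (ix i) <= 2 * l.
  by have := Bp (ix i); rewrite /sides eq_lrshift.
have hy i : l <= p 0 (iy i) <= 2 * l.
  by have := Bp (iy i); rewrite /sides eq_lrshift.
have sq (x : R) : l <= x <= 2 * l -> l ^+ 2 <= x * x <= 4 * l ^+ 2.
  by move=> /andP[lx xl]; rewrite expr2; apply/andP; split; nra.
have cst (c : R) : c * N = \sum_(i < n) c by rewrite sumr_const card_ord mulr_natr.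
have := Bp (iz (n := n)); rewrite /sides eqxx => /andP[-> ->]; split=> //.
- have -> : 2 * N * l ^+ 2 = 2 * l ^+ 2 * N by ring.
  rewrite cst; apply: ler_sum => i _.
  by have /andP[? ?] := sq _ (hx i); have /andP[? ?] := sq _ (hy i); lra.
- have -> : 8 * N * l ^+ 2 = 8 * l ^+ 2 * N by ring.
  rewrite cst; apply: ler_sum => i _.
  by have /andP[? ?] := sq _ (hx i); have /andP[? ?] := sq _ (hy i); lra.
Qed.

(** The constant 12 is rounded up: 8^2 + 16 * 2^2 = 128 <= 12^2. *)
Lemma cone_box_gauge4 p (l : R) : 0 < l -> cone_box l p ->
  16 * l ^+ 4 <= gauge4 p /\ gauge4 p <= (12 * N * l ^+ 2) ^+ 2.
Proof.
move=> l0 /(cone_box_bounds l0)[r1 r2 z1 z2].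
have l2 : 0 < l ^+ 2 by rewrite exprn_gt0.
have l4 : l ^+ 4 = (l ^+ 2) ^+ 2 by rewrite -exprM.
rewrite l4 /gauge4; move: (l ^+ 2) l2 r1 r2 z1 z2 => m m0 r1 r2 z1 z2.
have r0 := hdot_ge0 p.
have rs : rho p ^+ 2 <= (8 * N * m) ^+ 2 by rewrite lerXn2r ?nnegrE ?mulr_ge0// ltW.
have zs : zc p ^+ 2 <= (2 * m) ^+ 2 by rewrite lerXn2r ?nnegrE//; lra.
have zm : m ^+ 2 <= zc p ^+ 2 by rewrite lerXn2r ?nnegrE//; lra.
split; first by have := sqr_ge0 (rho p); lra.
have : (2 * m) ^+ 2 <= (2 * N * m) ^+ 2.
  have h : 2 * m <= 2 * N * m by rewrite ler_pM2r//; have := N1; lra.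
  by rewrite lerXn2r ?nnegrE ?mulr_ge0// ltW.
have := sqr_ge0 (N * m); move: rs.
have -> : (8 * N * m) ^+ 2 = 64 * (N * m) ^+ 2 by ring.
have -> : (2 * N * m) ^+ 2 = 4 * (N * m) ^+ 2 by ring.
have -> : (12 * N * m) ^+ 2 = 144 * (N * m) ^+ 2 by ring.
lra.
Qed.

Lemma trial_cone_ge p (l mu : R) : 1 <= l -> 12 * N * l ^+ 2 <= mu ^+ 2 ->
  cone_box l p -> ((12 * N * l ^+ 2)^-1) ^+ n <= trial mu p ^+ 2.
Proof.
move=> l1 lmu Bp; have l0 : 0 < l by lra.
have [K1 K2] := cone_box_gauge4 l0 Bp.
set S := 12 * N * l ^+ 2 in lmu K2 *.
have S0 : 0 < S by rewrite !mulr_gt0// exprn_gt0.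
have l41 : 1 <= l ^+ 4 by rewrite exprn_ege1.
have K0 : 0 < gauge4 p by lra.
have Kmu : gauge4 p <= mu ^+ 4.
  apply: (le_trans K2); rewrite (_ : mu ^+ 4 = (mu ^+ 2) ^+ 2); last by rewrite -exprM.
  by rewrite lerXn2r ?nnegrE ?sqr_ge0// ltW.
rewrite /trial profile_mid//; last lra.
have -> : S^-1 ^+ n = expR (- k4 * ln (S ^+ 2)) ^+ 2.
  rewrite -expRM_natl lnXn// -[in LHS](lnK (_ : S \is Num.pos))// -expRN -expRM_natl.
  by congr expR; rewrite -mulr_natl; field.
rewrite lerXn2r ?nnegrE ?expR_ge0// ler_expR !mulNr lerN2.
by apply: ler_wpM2l; [rewrite divr_ge0|rewrite ler_ln// posrE exprn_gt0].
Qed.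

(** On a cone box z >= l^2 and rho <= 8N l^2, whence z / rho >= 1 / (8N). In [gain], the first
    factor bounds the trial function, 8 N^3 comes from rho^3 >= (2N l^2)^3, and (12N)^4 from the
    square of the bound on K. *)
Let a0 : R := atan (4 * (8 * N)^-1).
Let gap2 : R := (sin a0 - a0 * cos a0) ^+ 2.
Let gain : R := ((12 * N)^-1) ^+ n * (8 * N ^+ 3 * gap2 / (12 * N) ^+ 4).

Let gap2_gt0 : 0 < gap2.
Proof.
have ha : 0 < a0 by rewrite /a0 -(@atan0 R); apply: lt_atan; rewrite mulr_gt0// invr_gt0 mulr_gt0.
have hp : a0 < pi / 2 := atan_ltpi2 _; have pp := @pi_gt0 R.
by rewrite exprn_gt0// gap_gt0//; apply/andP; split => //; lra.
Qed.

Let gain_gt0 : 0 < gain.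
Proof.
have N120 : 0 < 12 * N by rewrite mulr_gt0.
apply: mulr_gt0; first by rewrite exprn_gt0// invr_gt0.
apply: divr_gt0; last exact: exprn_gt0.
by apply: mulr_gt0 => //; apply: mulr_gt0 => //; exact: exprn_gt0.
Qed.

Lemma trial_cone_gain p (l mu : R) : 1 <= l -> 12 * N * l ^+ 2 <= mu ^+ 2 ->
  cone_box l p ->
  main_density mu p + gain / (l ^+ (n + n) * l ^+ 2) <= trial mu p ^+ 2 / ccdist p ^+ 2.
Proof.
move=> l1 lmu Bp; have l0 : 0 < l by lra.
have u2 := trial_cone_ge l1 lmu Bp.
have [K1 K2] := cone_box_gauge4 l0 Bp.
have [r1 r2 z1 z2] := cone_box_bounds l0 Bp.
have l20 : 0 < l ^+ 2 by rewrite exprn_gt0.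
have w0 : 0 < (8 * N)^-1 by rewrite invr_gt0 mulr_gt0.
have r0 : 0 < rho p by apply: lt_le_trans r1; rewrite !mulr_gt0.
have wr : (8 * N)^-1 * rho p <= zc p.
  by apply: le_trans z1; rewrite mulrC ler_pdivrMr ?mulr_gt0//; lra.
have := inv_ccdist_gain r0 w0 wr; rewrite -/a0 -/gap2 => gn.
have K0 : 0 < gauge4 p by rewrite gauge4_gt0.
rewrite /main_density; set U := trial mu p ^+ 2 in u2 *.
have U0 : 0 <= U by exact: sqr_ge0.
apply: le_trans (ler_wpM2l U0 gn); rewrite mulrDr lerD2l.
set S := 12 * N * l ^+ 2 in u2 K2.
have S0 : 0 < S by rewrite /S !mulr_gt0.
have -> : gain / (l ^+ (n + n) * l ^+ 2) =
    S^-1 ^+ n * ((2 * N * l ^+ 2) ^+ 3 * gap2 / (S ^+ 2) ^+ 2).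
  have -> : S^-1 ^+ n = (12 * N)^-1 ^+ n * ((l ^+ 2) ^+ n)^-1.
    by rewrite /S invfM exprMn; congr (_ * _); rewrite exprVn.
  rewrite (_ : l ^+ (n + n) = (l ^+ 2) ^+ n); last by rewrite -exprM mul2n addnn.
  have Z0 : (l ^+ 2) ^+ n != 0 by rewrite gt_eqF// exprn_gt0.
  rewrite /gain /S; move: ((12 * N)^-1 ^+ n) ((l ^+ 2) ^+ n) Z0 => Y Z Z0.
  by field; rewrite Z0 !gt_eqF.
have B0 : 0 <= 2 * N * l ^+ 2 by apply: mulr_ge0; [apply: mulr_ge0|exact: ltW].
have A0 : 0 <= (2 * N * l ^+ 2) ^+ 3 * gap2.
  by apply: mulr_ge0; [exact: exprn_ge0|exact: ltW].
apply: ler_pM => //.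
- by rewrite exprn_ge0// invr_ge0 ltW.
- by apply: divr_ge0 => //; exact: sqr_ge0.
apply: ler_pM.
- exact: A0.
- by rewrite invr_ge0 sqr_ge0.
- rewrite ler_wpM2r ?(ltW gap2_gt0)// lerXn2r ?nnegrE//; exact: ltW.
- rewrite lef_pV2 ?posrE ?exprn_gt0// lerXn2r ?nnegrE ?sqr_ge0//; exact: ltW.
Qed.

Let scale (j : nat) : R := 2 ^+ j.

(** The vertical sides [4^j, 2 * 4^j] are already disjoint. *)
Lemma cone_box_disjoint p (i j : nat) : cone_box (scale i) p -> cone_box (scale j) p ->
  i = j.
Proof.
have s0 k : 0 < scale k by rewrite exprn_gt0.
wlog ij : i j / (i <= j)%N => [wl bi bj|bi bj].
  by case/orP: (leq_total i j) => /wl; [apply|move/(_ bj bi)].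
apply/eqP; rewrite eqn_leq ij /= leqNgt; apply/negP => lij.
have [_ _ _ zi] := cone_box_bounds (s0 i) bi.
have [_ _ zj _] := cone_box_bounds (s0 j) bj.
have h : 2 * scale i <= scale j by rewrite /scale -exprS ler_eXn2l// ltr1n.
have h2 : (2 * scale i) ^+ 2 <= scale j ^+ 2.
  by rewrite lerXn2r ?nnegrE ?(ltW (s0 j))// mulr_ge0 ?(ltW (s0 i)).
have s2 : 0 < scale i ^+ 2 by rewrite exprn_gt0.
have : 4 * scale i ^+ 2 <= 2 * scale i ^+ 2.
  have -> : 4 * scale i ^+ 2 = (2 * scale i) ^+ 2 by ring.
  by apply: (le_trans h2); apply: (le_trans zj).
lra.
Qed.

(** T counts the dyadic scales and plays the part of the logarithm. On each box the surplus density
    is at least [gain] divided by the volume, so every scale contributes at least [gain]; the choice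
    of mu puts all the boxes where the trial function is an exact power. *)
Lemma hardy_weight_ge (T : nat) (mu : R) : mu = 12 * N * 2 ^+ T ->
  (X mu + (T%:R * gain)%:E <= hardy_weight (trial mu : heis -> R))%E.
Proof.
move=> muE.
have s0 k : 0 < scale k by rewrite exprn_gt0.
pose c (j : 'I_T) : R := gain / (scale j ^+ (n + n) * scale j ^+ 2).
pose A (j : 'I_T) := @sides R n (scale j) (scale j ^+ 2).
pose B (j : 'I_T) := @sides R n (2 * scale j) (2 * scale j ^+ 2).
have c0 j : 0 <= c j.
  by apply: divr_ge0; [exact: ltW|apply: mulr_ge0; apply: exprn_ge0; exact: ltW].
have AB j i : A j i <= B j i.
  rewrite /A /B /sides; case: ifP => _; first by have := sqr_ge0 (scale j); lra.
  by have := s0 j; lra.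
have -> : (T%:R * gain)%:E = lebesgue_int (fun p => (box_sum c A B p)%:E).
  rewrite lebesgue_int_box_sum//; congr EFin.
  rewrite (eq_bigr (fun=> gain)); first by rewrite sumr_const card_ord mulr_natl.
  move=> j _; rewrite prod_sides /c.
  have -> : 2 * scale j - scale j = scale j by ring.
  have -> : 2 * scale j ^+ 2 - scale j ^+ 2 = scale j ^+ 2 by ring.
  by rewrite divfK// mulf_neq0// gt_eqF// exprn_gt0.
rewrite -lebesgue_intD; first last.
- exact: measurable_box_sum.
- exact: measurable_main_density.
- by move=> p; rewrite lee_fin box_sum_ge0.
- by move=> p; rewrite lee_fin main_density_ge0.
apply: lebesgue_int_le => p.
  by rewrite -EFinD lee_fin addr_ge0 ?main_density_ge0 ?box_sum_ge0.
rewrite -EFinD lee_fin real_normK ?num_real//.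
have [[j Bj]|nB] := pselect (exists j : 'I_T, cone_box (scale j) p).
  rewrite /box_sum (bigD1 j)//= big1 ?addr0 => [|i ij].
    rewrite indicE mem_set// mulr1; apply: trial_cone_gain => //.
      by rewrite /scale exprn_ege1// ler1n.
    have ST : scale j ^+ 2 <= (2 ^+ T) ^+ 2.
      rewrite lerXn2r ?nnegrE ?exprn_ge0 ?(ltW (s0 j))//.
      by rewrite /scale ler_eXn2l ?ltr1n// ltnW.
    rewrite muE exprMn.
    have N12 : 12 * N <= (12 * N) ^+ 2.
      by rewrite expr2 ler_peMl ?mulr_ge0//; have := N1; lra.
    by apply: ler_pM N12 ST; [rewrite mulr_ge0|exact: sqr_ge0].
  rewrite indicE memNset ?mulr0// => Bi; move/eqP: ij; apply; apply: val_inj.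
  exact: cone_box_disjoint Bi Bj.
rewrite /box_sum big1 ?addr0 => [|j _].
  rewrite /main_density ler_wpM2l ?sqr_ge0//; exact: inv_ccdist_ge.
by rewrite indicE memNset ?mulr0// => Bj; apply: nB; exists j.
Qed.

Lemma hardy_const_lt : (hardy_const R n < (n%:R ^+ 2)%:E)%E.
Proof.
have [E0 E00 PE] := @energy_trial_le R n.
(* Enough scales for the accumulated gain to exceed the fixed cost E0 of the cutoffs. *)
have [T TP] : exists T : nat, E0 < N ^+ 2 * (T%:R * gain).
  have Ng : 0 < N ^+ 2 * gain by rewrite mulr_gt0// exprn_gt0.
  exists (Num.bound (E0 / (N ^+ 2 * gain))).
  by rewrite mulrCA -ltr_pdivrMr//; apply: archi_boundP; rewrite divr_ge0// ltW.
set mu := 12 * N * 2 ^+ T.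
have mu2 : 2 <= mu.
  have : 1 <= 2 ^+ T :> R by rewrite exprn_ege1// ler1n.
  by rewrite /mu; have := N1; nra.
have Xoo := @main_density_fin R n mu mu2.
have X0 : (0 <= X mu)%E.
  by apply: lebesgue_int_ge0 => p; rewrite lee_fin main_density_ge0.
have W := @hardy_weight_ge T mu erefl.
have En := PE mu mu2.
have [x xE] : exists x : R, X mu = x%:E.
  by exists (fine (X mu)); rewrite fineK// ge0_fin_numE.
rewrite xE -EFinM -EFinD in En; rewrite xE -EFinD in W; rewrite xE lee_fin in X0.
have Tg : 0 < T%:R * gain.
  have : 0 < N ^+ 2 * (T%:R * gain) by apply: le_lt_trans TP.
  by rewrite pmulr_rgt0// exprn_gt0.
apply: (@le_lt_trans _ _ (energy (trial mu : heis -> R) / hardy_weight (trial mu : heis -> R))%E).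
  apply: ereal_inf_lbound; exists (trial mu : heis -> R) => //; split.
    by apply: trial_test; lra.
  move=> u0; move: W; rewrite u0 /hardy_weight /lebesgue_int.
  under eq_integral do rewrite /= normr0 expr0n/= mul0r.
  by rewrite integral0 lee_fin; apply/negP; rewrite -ltNge; lra.
have e0 : (0 <= energy (trial mu : heis -> R))%E.
  by apply: lebesgue_int_ge0 => p; rewrite lee_fin sqr_ge0.
move: e0 En W; move: (energy _) (hardy_weight _) => e w e0 En W.
have N20 : 0 < N ^+ 2 by rewrite exprn_gt0.
have ef : e \is a fin_num by rewrite ge0_fin_numE// (le_lt_trans En) ?ltry.
move: e e0 En ef => [e| |]// e0 En _; rewrite !lee_fin in e0 En.
(* If the weight is infinite the quotient is 0, the energy being finite. *)
case: w W => [w| |] W //; last by rewrite invey mule0 lte_fin.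
rewrite lee_fin in W; have w0 : 0 < w by lra.
rewrite inver gt_eqF// -EFinM lte_fin ltr_pdivrMr//.
apply: (le_lt_trans En); apply: (@lt_le_trans _ _ (N ^+ 2 * (x + T%:R * gain))).
  by rewrite mulrDr; lra.
by rewrite ler_wpM2l// ltW.
Qed.

End full_constant_gain.

(** * The radial Hardy constant *)

Section radial_constant.
Context {R : realType} {n : nat}.
Notation heis := 'rV[R]_(n + n + 1).
Implicit Types (p q v : heis) (u w : heis -> R).
Notation rho p := (hdot p p).
Notation zc p := (p 0 (iz (n := n))).

Lemma half_aperture_le0 (w : R) : w <= 0 -> half_aperture w = 0.
Proof.
move=> w0; apply: xgetPN => psi [/aperture_gt0 + e]; rewrite e.
by rewrite ltNge w0.
Qed.

Lemma sin_lt (x : R) : 0 < x < pi -> sin x < x.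
Proof.
move=> /andP[x0 xpi]; rewrite -subr_gt0.
have -> : 0 = 0 - sin 0 :> R by rewrite sin0 subrr.
apply: (@derive_pos_lt _ (fun x : R => x - sin x) (fun x : R => 1 - cos x)) => // t.
move=> /andP[t0 tx]; rewrite subr_gt0 lt_neqAle cos_le1 andbT; apply/eqP => c1.
have := sin_gt0_pi (_ : 0 < t < pi); rewrite t0 (lt_trans tx)// => /(_ isT).
have := sin2cos2 t; rewrite c1 expr1n subrr => /eqP; rewrite sqrf_eq0 => /eqP ->.
by rewrite ltxx.
Qed.

Definition domain : set heis := [set p | 0 < rho p /\ 0 < zc p].

Lemma open_domain : open domain.
Proof.
have zcc : continuous (fun p : heis => zc p).
  by move=> p; exact: coord_continuous.
have -> : domain = ((fun p => rho p) @^-1` [set t | 0 < t]) `&`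
    ((fun p => zc p) @^-1` [set t | 0 < t]) by [].
apply: openI; apply: open_comp => //; try exact: open_gt.
  by move=> p _; exact: continuous_rho.
Qed.

Notation Psi p := (half_aperture (zc p / rho p)).

(* Constant along the geodesics issued from the origin: it is the inverse square
   of the diameter of their projection, a circle. *)
Definition curvature p : R := sin (Psi p) ^+ 2 / rho p.

Lemma derive_Psi p v : domain p ->
  let s := sin (Psi p) in let c := cos (Psi p) in
  is_derive p v (fun q => Psi q) (2 * s ^+ 3 / (s - Psi p * c) *
   (zc v / rho p - zc p * (2 * hdot p v) / rho p ^+ 2)).
Proof.
move=> [p0 z0] s c; have w0 : 0 < zc p / rho p by rewrite divr_gt0.
have dv := is_derive_inv (lt0r_neq0 p0).
have dw := is_derive_mul (derive_zc p v) (is_derive_chain (f := fun q : heis => rho q) dv (derive_rho p v)).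
apply: is_derive_eq (is_derive_chain (f := fun q : heis => zc q / rho q)
  (is_derive_half_aperture w0) dw) _.
by rewrite -/s -/c; congr (_ * _); ring.
Qed.

Let curvature_identity (psi s c r z h k : R) : s != 0 -> r != 0 -> s - psi * c != 0 ->
  z = r * (psi - s * c) / (4 * s ^+ 2) -> c ^+ 2 = 1 - s ^+ 2 ->
  2 * s * (c * (2 * s ^+ 3 / (s - psi * c) * (k / r - z * (2 * h) / r ^+ 2))) / r +
    s ^+ 2 * (- r ^- 2 * (2 * h)) =
  - (s ^+ 5 / ((s - psi * c) * r ^+ 2)) * (2 * h) +
    4 * s ^+ 4 * c / ((s - psi * c) * r ^+ 2) * k.
Proof.
move=> s0 r0 g0 -> cs.
have -> : 2 * s * (c * (2 * s ^+ 3 / (s - psi * c) * (k / r -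
      r * (psi - s * c) / (4 * s ^+ 2) * (2 * h) / r ^+ 2))) / r +
    s ^+ 2 * (- r ^- 2 * (2 * h)) =
  - (s ^+ 2 * (s - s * c ^+ 2) / ((s - psi * c) * r ^+ 2)) * (2 * h) +
    4 * s ^+ 4 * c / ((s - psi * c) * r ^+ 2) * k by field; rewrite g0 r0 s0.
by rewrite cs; congr (- (_ / _) * _ + _); ring.
Qed.

Let ccdist_identity (psi s c q z h k : R) : s != 0 -> q != 0 -> s - psi * c != 0 ->
  z = q ^+ 2 * (psi - s * c) / (4 * s ^+ 2) ->
  (2 * q)^-1 * (2 * h) * (psi * s^-1) +
    q * (2 * s ^+ 3 / (s - psi * c) * (k / q ^+ 2 - z * (2 * h) / (q ^+ 2) ^+ 2) * s^-1 +
      psi * (- s ^- 2 * (c * (2 * s ^+ 3 / (s - psi * c) *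
        (k / q ^+ 2 - z * (2 * h) / (q ^+ 2) ^+ 2))))) =
  c / (2 * q) * (2 * h) + 2 * s / q * k.
Proof. by move=> s0 q0 g0 ->; field; rewrite g0 q0 s0. Qed.

(** With this differential written A drho + B dz and that of the distance A' drho + B' dz, constancy
    of the curvature along geodesics is the cancellation 4 A A' + B B' / 4 = 0. *)
Lemma derive_curvature p v : domain p ->
  let s := sin (Psi p) in let c := cos (Psi p) in let g := s - Psi p * c in
  is_derive p v curvature (- (s ^+ 5 / (g * rho p ^+ 2)) * (2 * hdot p v) +
    4 * s ^+ 4 * c / (g * rho p ^+ 2) * zc v).
Proof.
move=> Op s c g; have [p0 z0] := Op.
have [Ip s0 zE] := half_aperture_zc p0 z0.
have g0 : 0 < g by exact: gap_gt0.
have dv := is_derive_inv (lt0r_neq0 p0).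
have ds := is_derive_chain (f := fun q : heis => sin (Psi q)) (is_derive_sqr _)
  (is_derive_chain (f := fun q : heis => Psi q) (is_derive_sin _) (derive_Psi v Op)).
have cs : c ^+ 2 = 1 - s ^+ 2 by rewrite cos2sin2.
apply: is_derive_eq (is_derive_mul ds (is_derive_chain (f := fun q : heis => rho q) dv (derive_rho p v))) _.
by rewrite -(@curvature_identity (Psi p) _ _ _ (zc p)) ?gt_eqF.
Qed.

(** The coefficients satisfy the eikonal equation: (4 A'^2 + B'^2 / 4) rho = cos^2 + sin^2 = 1. *)
Lemma derive_ccdist p v : domain p ->
  is_derive p v ccdist (cos (Psi p) / (2 * Num.sqrt (rho p)) * (2 * hdot p v) +
    2 * sin (Psi p) / Num.sqrt (rho p) * zc v).
Proof.
move=> Op; have [p0 z0] := Op; have [Ip s0 zE] := half_aperture_zc p0 z0.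
have g0 := gap_gt0 Ip.
have q0 : 0 < Num.sqrt (rho p) by rewrite sqrtr_gt0.
have q2 := sqr_sqrtr (ltW p0).
have e : \near p, Num.sqrt (rho p) * (Psi p * (sin (Psi p))^-1) = ccdist p.
  have : nbhs p domain by apply: open_nbhs_nbhs; split; [exact: open_domain|].
  by apply: filterS => q [q0' qz]; rewrite ccdist_half_aperture// mulrA.
apply: near_eq_is_derive e _.
have dv := is_derive_inv (lt0r_neq0 s0).
have dq := is_derive_chain (f := fun q : heis => rho q) (is_derive1_sqrt p0) (derive_rho p v).
have dP := derive_Psi v Op.
apply: is_derive_eq (is_derive_mul dq (is_derive_mul dP
  (is_derive_chain (f := fun q : heis => sin (Psi q)) dv
    (is_derive_chain (f := fun q : heis => Psi q) (is_derive_sin _) dP)))) _.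
rewrite -(@ccdist_identity (Psi p) _ _ _ (zc p)) ?gt_eqF// ?q2//.
Qed.

End radial_constant.

(** * Trial functions for the radial constant *)

Section radial_trial.
Context {R : realType} {n : nat}.
Notation heis := 'rV[R]_(n + n + 1).
Implicit Types (p q v : heis) (u w : heis -> R) (T : R).
Notation rho p := (hdot p p).
Notation zc p := (p 0 (iz (n := n))).
Notation Psi p := (half_aperture (zc p / rho p)).

Definition window (a : R) : R := flat0 (a - 1) * flat0 (2 - a).

(** Curvature above 1 forces rho < sin^2 Psi <= 1, so a cutoff near rho = 0 suffices: both ends of a
    geodesic lie there. *)
Definition radial_trial T p : R := window (curvature p) * step (T^-1 * ln (rho p) + 2).

Lemma window01 a : 0 <= window a <= 1.
Proof.
rewrite /window mulr_ge0 ?flat0_ge0//= -[leRHS](mulr1 1).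
by apply: ler_pM; rewrite ?flat0_ge0 ?flat0_le1.
Qed.

Lemma smooth_on_window : smooth_on setT window.
Proof.
have idd := smooth_on_id [set: R].
have fl f : smooth_on setT f -> smooth_on setT (fun a : R => flat0 (f a)).
  by move=> fs; exact: (smooth_on_comp (smooth_on_flat 0) fs).
by apply: smooth_on_mul; apply: fl; apply: smooth_on_sub => //; exact: smooth_on_cst.
Qed.

Lemma window_neq0 a : window a != 0 -> 1 < a < 2.
Proof.
rewrite mulf_eq0 negb_or => /andP[h1 h2].
apply/andP; split; rewrite ltNge; apply/negP => h.
  by move/eqP: h1; apply; apply: flat0_le0; lra.
by move/eqP: h2; apply; apply: flat0_le0; lra.
Qed.

Lemma curvature_gt0 p : 0 < curvature p -> domain p.
Proof.
rewrite /curvature => c0.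
have r0 : 0 < rho p.
  rewrite lt_def hdot_ge0 andbT; apply/eqP => r0.
  by rewrite r0 invr0 mulr0 ltxx in c0.
split=> //; rewrite ltNge; apply/negP => z0; move: c0.
rewrite half_aperture_le0 ?sin0 ?expr0n/= ?mul0r ?ltxx//.
by rewrite pmulr_lle0// invr_gt0.
Qed.

(** The positive lower bound on z keeps this closed set away from the plane z = 0, where the
    half-aperture degenerates, and so allows the extension by 0. *)
Definition support_set T : set heis := [set p |
  expR (- 2 * T) <= rho p <= 1 /\
  expR (- 2 * T) * aperture (Num.sqrt (expR (- 2 * T))) <= zc p <= 2].

Lemma sqrt_expR_itv T : 0 <= T -> 0 < Num.sqrt (expR (- 2 * T)) <= 1.
Proof.
move=> T0; rewrite sqrtr_gt0 expR_gt0/= -sqrtr1 ler_wsqrtr//.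
by rewrite expR_le1 mulNr oppr_le0 mulr_ge0.
Qed.

Lemma aperture_sqrt_expR_gt0 T : 0 <= T -> 0 < aperture (Num.sqrt (expR (- 2 * T))).
Proof.
move=> /sqrt_expR_itv/andP[e0 e1]; apply: aperture_gt0; rewrite e0/=.
by apply: (le_lt_trans e1); apply: lt_le_trans (@pi_ge2 R); rewrite ltr1n.
Qed.

Lemma support_set_domain T : 0 <= T -> support_set T `<=` domain.
Proof.
move=> T0 p [/andP[r1 _] /andP[z1 _]]; split.
  by apply: lt_le_trans r1; exact: expR_gt0.
apply: lt_le_trans z1; rewrite mulr_gt0 ?expR_gt0//; exact: aperture_sqrt_expR_gt0.
Qed.

Lemma radial_trial_support T p : 0 < T -> ~ support_set T p -> radial_trial T p = 0.
Proof.
move=> T0 nS; apply/eqP/negPn/negP; rewrite mulf_eq0 negb_or => /andP[w0 s0]; apply: nS.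
have /andP[c1 c2] := window_neq0 w0.
have Op : domain p by apply: curvature_gt0; lra.
have [r0 z0] := Op; have [Ip sp zE] := half_aperture_zc r0 z0.
have /andP[p0 ppi] := Ip.
have lr : - 2 * T <= ln (rho p).
  rewrite leNgt; apply/negP => h; move/eqP: s0; apply; apply: step_le0.
  have : T^-1 * ln (rho p) < T^-1 * (- 2 * T) by rewrite ltr_pM2l// invr_gt0.
  have -> : T^-1 * (- 2 * T) = - 2 by field; rewrite gt_eqF.
  lra.
have er : expR (- 2 * T) <= rho p by rewrite -[leRHS]lnK// ler_expR.
have rs : rho p < sin (Psi p) ^+ 2.
  by move: c1; rewrite /curvature ltr_pdivlMr// mul1r.
have s1 : sin (Psi p) <= 1 by exact: sin_le1.
have s21 : sin (Psi p) ^+ 2 <= 1 by rewrite expr_le1// ltW.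
split.
  by rewrite er/= ltW// (lt_le_trans rs).
apply/andP; split.
  (* Curvature above 1 gives sqrt rho < sin Psi < Psi; monotonicity of [aperture] then bounds z /
     rho from below. *)
  have e1 : Num.sqrt (expR (- 2 * T)) < Psi p.
    apply: lt_trans (sin_lt Ip).
    rewrite -ltr_sqr ?nnegrE ?sqrtr_ge0 ?(ltW sp)// sqr_sqrtr ?expR_ge0//.
    exact: le_lt_trans rs.
  have /andP[e0 _] := sqrt_expR_itv (ltW T0).
  have := aperture_lt e0 e1 ppi.
  have -> : aperture (Psi p) = zc p / rho p by rewrite (half_apertureP _).2// divr_gt0.
  rewrite ltr_pdivlMr// => h; apply: le_trans (ltW h).
  by rewrite mulrC ler_wpM2l// ltW// aperture_sqrt_expR_gt0// ltW.
set s := sin _ in sp zE rs s1 s21; set c := cos _ in zE; set r := rho p in r0 zE rs.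
have c1' : - 1 <= s * c.
  have : c <= 1 by exact: cos_le1.
  have : - 1 <= c by exact: cos_geN1.
  by move: sp s1; nra.
have pi4 : pi < 4 :> R by have := @pihalf_lt2 R; lra.
have s4 : 0 < 4 * s ^+ 2 by rewrite mulr_gt0// exprn_gt0.
have D0 : 0 < Psi p - s * c.
  have : 0 < r * (Psi p - s * c) / (4 * s ^+ 2) by rewrite -zE.
  by rewrite pmulr_lgt0 ?invr_gt0// pmulr_rgt0.
(* As rho < sin^2 Psi, it is enough that Psi - sin Psi cos Psi <= 8, which follows from Psi < 4. *)
rewrite zE ler_pdivrMr//.
apply: (@le_trans _ _ (s ^+ 2 * (Psi p - s * c))).
  by rewrite ler_wpM2r// ltW.
have -> : 2 * (4 * s ^+ 2) = s ^+ 2 * 8 by ring.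
by apply: ler_wpM2l; [exact: sqr_ge0|lra].
Qed.

Lemma closed_support_set T : closed (support_set T).
Proof.
have zcc : continuous (fun p : heis => zc p) by move=> p; exact: coord_continuous.
pose a := expR (- 2 * T); pose b := a * aperture (Num.sqrt (expR (- 2 * T))).
have -> : support_set T = ((fun p => rho p) @^-1` `[a, 1]%classic) `&`
    ((fun p => zc p) @^-1` `[b, 2]%classic).
  by apply/seteqP; split=> p; rewrite /support_set /= !in_itv.
apply: closedI; apply: preimage_closed => [q _|].
- exact: continuous_rho.
- exact: interval_closed.
- exact: zcc.
- exact: interval_closed.
Qed.

Lemma smooth_on_Psi : smooth_on domain (fun p : heis => Psi p).
Proof.
have wO : smooth_on domain (fun p : heis => zc p / rho p).
  apply: smooth_on_div; [exact: smooth_on_coord|exact: smooth_on_rho|].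
  by move=> p [/gt_eqF ->].
apply: (smooth_on_comp smooth_on_half_aperture wO) => p [p0 z0].
by rewrite /= divr_gt0.
Qed.

Lemma smooth_on_curvature : smooth_on domain (@curvature R n).
Proof.
have [ss _] := @smooth_on_sin_cos R.
have sO := smooth_on_comp ss smooth_on_Psi (fun _ _ => I).
apply: smooth_on_div; [|exact: smooth_on_rho|by move=> p [/gt_eqF ->]].
by under eq_fun do rewrite expr2; exact: smooth_on_mul.
Qed.

Lemma smooth_on_radial_trial T : 0 < T -> smooth_on setT (radial_trial T).
Proof.
move=> T0.
have rO := smooth_on_rho (R := R) (n := n) domain.
apply: (smooth_on_extend (O := domain) (K := support_set T)).
- exact: open_domain.
- exact: closed_support_set.
- by apply: support_set_domain; exact: ltW.
- by move=> p; exact: radial_trial_support.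
apply: smooth_on_mul; first 
  exact: (smooth_on_comp smooth_on_window smooth_on_curvature (fun _ _ => I)).
apply: (smooth_on_comp smooth_on_step _ (fun _ _ => I)).
apply: smooth_on_add; last exact: smooth_on_cst.
apply: smooth_on_scale; apply: (smooth_on_comp smooth_on_ln rO) => p [p0 _].
exact: p0.
Qed.

Lemma radial_trial_test T : 0 < T -> test_function (radial_trial T).
Proof.
move=> T0; apply: (@test_functionI _ _ _ (support_set T) 1 2) => //.
- exact: closed_support_set.
- move=> p [/andP[_ r1] /andP[z1 z2]]; rewrite expr1n; split=> //.
  rewrite ger0_norm//; apply: le_trans z1; rewrite mulr_ge0 ?expR_ge0//.
  by rewrite ltW// aperture_sqrt_expR_gt0// ltW.
- by move=> /(support_set_domain (ltW T0))[]; rewrite rho0 ltxx.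
- by move=> p; exact: radial_trial_support.
- exact: smooth_on_radial_trial.
Qed.

End radial_trial.

(** * Pointwise bound of the radial derivative *)

Section radial_bound.
Context {R : realType} {n : nat}.
Notation heis := 'rV[R]_(n + n + 1).
Implicit Types (p q v : heis) (u w : heis -> R).
Notation rho p := (hdot p p).
Notation zc p := (p 0 (iz (n := n))).
Notation Psi p := (half_aperture (zc p / rho p)).
Notation radial_form T p := (hdot (hgrad (radial_trial T) p) (hgrad ccdist p)).

Let form_identity (q r s c P W k X : R) : q ^+ 2 = r -> q != 0 -> s != 0 ->
  s - P * c != 0 ->
  (4 * (- X * (s ^+ 5 / ((s - P * c) * r ^+ 2)) + W * k) * (c / (2 * q)) +
    X * (4 * s ^+ 4 * c / ((s - P * c) * r ^+ 2)) * (2 * s / q) / 4) * r =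
  2 * W * k * c * q.
Proof. by move=> <- q0 s0 g0; field; rewrite g0 q0. Qed.

(* Only the cutoff in rho contributes, since the curvature is constant along
   geodesics. *)
Lemma radial_density : exists2 M : R, 0 <= M & forall (T : R) p, 0 < T ->
  radial_form T p = 0 \/ [/\ 0 < rho p, - 2 * T <= ln (rho p) <= - T, `|zc p| <= 2 &
    radial_form T p ^+ 2 <= 4 * M ^+ 2 / T ^+ 2 / rho p].
Proof.
have [s' [M [sd sM M0 s0 s1]]] := @step_derivative R.
have [h' _ hd] := smooth_on_derive1 (@smooth_on_window R).
exists M => // T p T0.
have [Sp|nS] := pselect (support_set T p); last first.
  left; have D0 v : 'D_v (radial_trial T) p = 0.
    have e : \near p, cst 0 p = radial_trial T p.
      have : nbhs p (~` support_set T).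
        by apply: open_nbhs_nbhs; split=> //; apply: closed_openC; exact: closed_support_set.
      by apply: filterS => q /(radial_trial_support T0).
    by rewrite -(near_eq_derive v e); exact: (@derive_val _ _ _ _ _ _ _ (is_derive_cst 0 p v)).
  rewrite /hdot big1// => i _; rewrite /hgrad big1 => [|j _].
    by rewrite !mxE !mul0r addr0.
  by rewrite !D0 !scale0r addr0.
have Op := support_set_domain (ltW T0) Sp; have [r0 z0] := Op.
have [Ip sp zE] := half_aperture_zc r0 z0; have g0 := gap_gt0 Ip.
set s := sin (Psi p) in sp zE g0; set c := cos (Psi p) in zE g0.
set y := T^-1 * ln (rho p) + 2.
have dw v := is_derive_chain (f := @curvature R n) (hd _ I) (derive_curvature v Op).
have dl v : is_derive p v (fun q : heis => T^-1 * ln (rho q) + 2)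
    (T^-1 * ((rho p)^-1 * (2 * hdot p v))).
  apply: is_derive_eq (is_derive_add (is_derive_scale T^-1
    (is_derive_chain (f := fun q : heis => rho q) (is_derive1_ln r0) (derive_rho p v)))
    (is_derive_cst (2 : R) p v)) _.
  by rewrite addr0.
have du v := is_derive_mul (dw v)
  (is_derive_chain (f := fun q : heis => T^-1 * ln (rho q) + 2) (sd _) (dl v)).
(* X carries the derivative of the window and k' that of the cutoff in rho; X drops out of [HE]. *)
pose X := h' (curvature p) * step y.
pose k' := s' y * T^-1 * (rho p)^-1.
have uE v : 'D_v (radial_trial T) p =
    (- X * (s ^+ 5 / ((s - Psi p * c) * rho p ^+ 2)) + window (curvature p) * k') *
      (2 * hdot p v) +
    X * (4 * s ^+ 4 * c / ((s - Psi p * c) * rho p ^+ 2)) * zc v.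
  rewrite (@derive_val _ _ _ _ _ _ _ (du v)) -/s -/c -/y /X /k'; ring.
have dE v : 'D_v ccdist p =
    c / (2 * Num.sqrt (rho p)) * (2 * hdot p v) + 2 * s / Num.sqrt (rho p) * zc v.
  exact: (@derive_val _ _ _ _ _ _ _ (derive_ccdist v Op)).
have q0 : 0 < Num.sqrt (rho p) by rewrite sqrtr_gt0.
have q2 := sqr_sqrtr (ltW r0).
have HE : radial_form T p = 2 * window (curvature p) * k' * c * Num.sqrt (rho p).
  rewrite (hdot_hgrad uE dE).
  by apply: form_identity => //; rewrite gt_eqF.
have [Y0|Y0] := ltP y 0; first by left; rewrite HE /k' s0//; ring.
have [Y1|Y1] := ltP 1 y; first by left; rewrite HE /k' s1//; ring.
right; split=> //.
- have TE : ln (rho p) = T * (y - 2) by rewrite /y; field; rewrite gt_eqF.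
  by rewrite TE; apply/andP; split; nra.
- by move: Sp => [_ /andP[_ z2]]; rewrite ger0_norm// ltW.
rewrite HE.
have -> : 4 * M ^+ 2 / T ^+ 2 / rho p = 4 * 1 * M ^+ 2 * 1 * (T ^+ 2 * rho p)^-1.
  by field; rewrite !gt_eqF.
have -> : (2 * window (curvature p) * k' * c * Num.sqrt (rho p)) ^+ 2 =
    4 * window (curvature p) ^+ 2 * s' y ^+ 2 * c ^+ 2 * (T ^+ 2 * rho p)^-1.
  rewrite /k' 4!exprMn q2; move: (rho p) r0 => r r0.
  by field; rewrite !gt_eqF.
have /andP[w0 w1] := window01 (curvature p).
have W2 : window (curvature p) ^+ 2 <= 1 by rewrite expr_le1.
have C2 : c ^+ 2 <= 1.
  by rewrite -(@real_normK _ c) ?num_real// expr_le1// ler_norml cos_geN1 cos_le1.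
have S2 : s' y ^+ 2 <= M ^+ 2 by rewrite -(@real_normK _ (s' y)) ?num_real// ler_sqr ?nnegrE.
rewrite ler_wpM2r//; first by rewrite invr_ge0 mulr_ge0 ?sqr_ge0// ltW.
by apply: mul3_le => //; apply/andP; split => //; exact: sqr_ge0.
Qed.

End radial_bound.

(** * Radial energy against weight as T grows *)

Section radial_conclusion.
Context {R : realType} {n : nat}.
Context (n_gt0 : (1 <= n)%N).
Notation heis := 'rV[R]_(n + n + 1).
Implicit Types (p q v : heis).
Notation rho p := (hdot p p).
Notation zc p := (p 0 (iz (n := n))).
Notation radial_form T p := (hdot (hgrad (radial_trial T) p) (hgrad ccdist p)).

Let N0 : 0 < n%:R :> R. Proof. by rewrite ltr0n. Qed.

(** Slice T <= - ln rho <= 2T into unit steps. On a slice the density is O(1 / (T^2 rho)), and the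
    slice lies in a box of volume O(rho^n) with n >= 1, so it costs O(1 / T^2); there are T + 1
    slices. *)
Lemma radial_energy_le : exists2 C : R, 0 <= C & forall T : nat, (0 < T)%N ->
  (radial_energy (radial_trial T%:R : heis -> R) <= (C / T%:R)%:E)%E.
Proof.
have [M M0 PM] := @radial_density R n.
exists `|32 * 4 ^+ n * expR 1 * M ^+ 2| => // T T_gt0.
have T0 : 0 < T%:R :> R by rewrite ltr0n.
pose r (i : 'I_T.+1) : R := expR (- (T + i)%:R / 2).
have r20 i : r i ^+ 2 = expR (- (T + i)%:R).
  by rewrite /r -expRM_natl; congr expR; field.
have rp i : 0 < r i by exact: expR_gt0.
pose c (i : 'I_T.+1) : R := 4 * M ^+ 2 / T%:R ^+ 2 * expR ((T + i)%:R + 1).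
have K0 : 0 <= 4 * M ^+ 2 / T%:R ^+ 2.
  by apply: divr_ge0; [apply: mulr_ge0 => //; exact: sqr_ge0|exact: sqr_ge0].
have c0 i : 0 <= c i by apply: mulr_ge0 => //; exact: expR_ge0.
pose A (i : 'I_T.+1) := @sides R n (- r i) (- 2).
pose B (i : 'I_T.+1) := @sides R n (r i) 2.
have AB i j : A i j <= B i j.
  by rewrite /A /B /sides; case: ifP => _; [lra|have := rp i; lra].
apply: (@le_trans _ _ (lebesgue_int (fun p => (box_sum c A B p)%:E))).
  apply: lebesgue_int_le => p; first by rewrite lee_fin sqr_ge0.
  rewrite lee_fin real_normK ?num_real//.
  have [->|[r0 /andP[l1 l2] z2 D]] := PM T%:R p T0.
    by rewrite expr0n/= box_sum_ge0.
  have y0 : 0 <= - ln (rho p) by lra.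
  (* j is the integer part of - ln rho; the value 2T is allowed, hence T + 1 boxes. *)
  have /andP[j1 j2] := truncn_itv y0; set j := Num.truncn _ in j1 j2.
  have Tj : (T <= j)%N.
    rewrite -ltnS -(ltr_nat R); apply: le_lt_trans j2; lra.
  have jT : (j - T < T.+1)%N.
    have : (j <= 2 * T)%N by rewrite -(ler_nat R) natrM; lra.
    by rewrite ltnS leq_subLR addnn -mul2n.
  rewrite /box_sum (bigD1 (Ordinal jT))//=.
  have S0 : 0 <= \sum_(i < T.+1 | i != Ordinal jT) c i * \1_(box (A i) (B i)) p.
    by apply: sumr_ge0 => i _; rewrite mulr_ge0// indicE.
  apply: (le_trans D); apply: (@le_trans _ _ (c (Ordinal jT))); last first.
    rewrite [X in c _ * X](_ : _ = 1) ?mulr1 ?lerDl//.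
    rewrite indicE mem_set// => k.
    have hr : rho p <= r (Ordinal jT) ^+ 2.
      by rewrite r20 /= subnKC// -[leLHS]lnK// ler_expR; lra.
    have := coord_norm_le k hr (ltW (rp _)) z2.
    by rewrite /A /B /sides ler_norml; case: ifP.
  rewrite /c; apply: ler_wpM2l => //=; rewrite subnKC//.
  have -> : (rho p)^-1 = expR (- ln (rho p)) by rewrite expRN lnK.
  by rewrite ler_expR natr1 ltW.
rewrite lebesgue_int_box_sum// lee_fin.
have E i : c i * \prod_j (B i j - A i j) <= 16 * 4 ^+ n * expR 1 * M ^+ 2 / T%:R ^+ 2.
  rewrite prod_sides.
  have -> : 2 - - 2 = 4 :> R by ring.
  have -> : r i - - r i = 2 * r i by ring.
  have -> : (2 * r i) ^+ (n + n) = 4 ^+ n * (r i ^+ 2) ^+ n.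
    by rewrite addnn -mul2n exprM -[RHS]exprMn; congr (_ ^+ _); ring.
  have ri1 : r i ^+ 2 <= 1 by rewrite r20 expR_le1 oppr_le0.
  (* This is where n >= 1 enters; for n = 1 the horizontal area exactly compensates the growth of 1
     / rho. *)
  have rn : (r i ^+ 2) ^+ n <= r i ^+ 2.
    by case: n n_gt0 => // m _; rewrite exprS ler_piMr ?sqr_ge0// exprn_ile1 ?sqr_ge0.
  have -> : 16 * 4 ^+ n * expR 1 * M ^+ 2 / T%:R ^+ 2 = c i * (4 ^+ n * r i ^+ 2 * 4).
    rewrite /c r20 expRN expRD; have e0 := expR_gt0 (T + i)%:R :> 0 < _ :> R.
    by field; rewrite !gt_eqF.
  apply: ler_wpM2l => //; rewrite ler_wpM2r// ler_wpM2l// exprn_ge0//.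
apply: (@le_trans _ _ (\sum_(i < T.+1) 16 * 4 ^+ n * expR 1 * M ^+ 2 / T%:R ^+ 2)).
  by apply: ler_sum => i _; exact: E.
rewrite sumr_const card_ord -[leLHS]mulr_natl.
apply: (@le_trans _ _ (32 * 4 ^+ n * expR 1 * M ^+ 2 / T%:R)); last first.
  by rewrite ler_wpM2r ?invr_ge0 ?ler_norm// ltW.
have T1 : T.+1%:R <= 2 * T%:R :> R by rewrite mulr_natl -natr1 mulr2n lerD2l ler1n.
have -> : 32 * 4 ^+ n * expR 1 * M ^+ 2 / T%:R =
  2 * T%:R * (16 * 4 ^+ n * expR 1 * M ^+ 2 / T%:R ^+ 2) by field; rewrite gt_eqF.
apply: ler_wpM2r T1; apply: divr_ge0; last exact: sqr_ge0.
apply: mulr_ge0; last exact: sqr_ge0.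
by rewrite mulr_ge0 ?expR_ge0// mulr_ge0// exprn_ge0.
Qed.


(** Near a fixed point with rho > 1/2 > exp (-1) the cutoff in rho equals 1, so there the trial
    function is the same for every T. *)
Lemma radial_weight_ge : exists2 c : R, 0 < c & forall T : nat, (0 < T)%N ->
  (c%:E <= hardy_weight (radial_trial T%:R : heis -> R))%E.
Proof.
(* The window is open at p0, where [rho = 2/3] and the half-aperture is [pi/2]. *)
pose r : R := Num.sqrt (3 * n%:R)^-1.
pose p0 : heis := \row_j sides r (pi / 12) j.
have rho0 : rho p0 = 2 / 3.
  rewrite /hdot (eq_bigr (fun=> 2 * r ^+ 2)) => [|i _]; last first.
    by rewrite !mxE /sides !eq_lrshift; ring.
  rewrite sumr_const card_ord -mulr_natl sqr_sqrtr ?invr_ge0 ?mulr_ge0//.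
  by field; rewrite gt_eqF.
have zc0 : zc p0 = pi / 12 by rewrite mxE /sides eqxx.
have pi0 := @pi_gt0 R.
have Op : domain p0 by split; rewrite ?rho0 ?zc0 divr_gt0.
have psi0 : half_aperture (zc p0 / rho p0) = pi / 2.
  rewrite zc0 rho0 -[RHS]apertureK; last by apply/andP; split; lra.
  by rewrite /aperture sin_pihalf cos_pihalf; congr half_aperture; field.
have c0 : curvature p0 = 3 / 2.
  by rewrite /curvature psi0 sin_pihalf rho0; field.
have K0 := gauge4_gt0 Op.1.
(* By [inv_ccdist_ge], f bounds the weight density from below where the cutoff is 1, and it is
   continuous at p0. *)
pose f p : R := window (curvature p) * window (curvature p) * (rho p / gauge4 p).
have fs : smooth_on domain f.
  have ws := smooth_on_comp (@smooth_on_window R) (@smooth_on_curvature R n) (fun _ _ => I).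
  apply: smooth_on_mul; first exact: smooth_on_mul.
  apply: smooth_on_div => [||p [p_gt0 _]]; [exact: smooth_on_rho|exact: smooth_on_gauge4|].
  by rewrite gt_eqF// gauge4_gt0.
have fc : {for p0, continuous f}.
  by apply: differentiable_continuous; exact: smooth_on_differentiable fs Op.
have rhoc := @continuous_rho R n p0.
have f0 : 0 < f p0.
  have w0 : 0 < window (curvature p0).
    by rewrite c0 /window mulr_gt0// flat0_gt0//; lra.
  by apply: mulr_gt0; [exact: mulr_gt0|apply: divr_gt0 => //; exact: Op.1].
pose m := f p0 / 2; have m0 : 0 < m by rewrite divr_gt0.
have fm : \forall p \near p0, m < f p.
  by apply: (cvgr_gt _ fc); rewrite /m; lra.
have rc : \forall p \near p0, 1 / 2 < rho p.
  by apply: (cvgr_gt _ rhoc); rewrite rho0; lra.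
have /nbhs_ballP[e /= e0 eB] : nbhs p0 [set p | m < f p /\ 1 / 2 < rho p].
  by apply: filterS2 fm rc.
pose h := e / 2; have h0 : 0 < h by rewrite divr_gt0.
pose A j : R := p0 0 j - h; pose B j : R := p0 0 j + h.
have AB j : A j <= B j by rewrite /A /B; lra.
exists (m * (2 * h) ^+ (n + n + 1)); first by rewrite mulr_gt0// exprn_gt0// mulr_gt0.
move=> T T_gt0; have T0 : 0 < T%:R :> R by rewrite ltr0n.
have := @lebesgue_int_box_sum R _ 1 (fun=> m) (fun=> A) (fun=> B) (fun=> ltW m0) (fun=> AB).
rewrite big_ord1 (eq_bigr (fun=> 2 * h)) => [|j _]; last by rewrite /A /B; ring.
rewrite prodr_const card_ord => <-.
apply: lebesgue_int_le => p; first by rewrite lee_fin box_sum_ge0// => _; exact: ltW.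
rewrite lee_fin /box_sum big_ord1 real_normK ?num_real// indicE.
have [/set_mem pAB|_] := boolP (p \in box A B); last first.
  by rewrite mulr0 divr_ge0 ?sqr_ge0.
have [fp rp] : m < f p /\ 1 / 2 < rho p.
  apply: eB; split=> // i j; rewrite (ord1 i) /ball/= ltr_distl.
  by have /andP[] := pAB j; rewrite /A /B /h => h1 h2; apply/andP; split; lra.
rewrite mulr1 (_ : radial_trial T%:R p = window (curvature p)).
  apply: (le_trans (ltW fp)); rewrite /f -expr2 ler_wpM2l ?sqr_ge0//.
  exact: inv_ccdist_ge.
rewrite /radial_trial step_ge1 ?mulr1//.
have : - T%:R <= ln (rho p).
  have e1 : expR (-1) <= rho p :> R.
    apply: ltW; apply: le_lt_trans rp; rewrite expRN div1r lef_pV2 ?posrE ?expR_gt0//.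
    by have := expR_ge1Dx (1 : R); lra.
  have r0 : 0 < rho p by apply: lt_le_trans e1; exact: expR_gt0.
  apply: (@le_trans _ _ (-1)); first by rewrite lerN2 ler1n.
  by rewrite -(expRK (-1)) ler_ln// posrE expR_gt0.
move=> lT; have : T%:R^-1 * - T%:R <= T%:R^-1 * ln (rho p).
  by rewrite ler_pM2l// invr_gt0.
by rewrite mulrN mulVf ?gt_eqF//; lra.
Qed.


Lemma radial_hardy_const_eq0 : radial_hardy_const R n = 0%E.
Proof.
have [C C0 PC] := radial_energy_le; have [c c0 Pc] := radial_weight_ge.
apply/eqP; rewrite eq_le; apply/andP; split.
  apply: ge_ereal_sup => _ [x [x0 Px] <-]; rewrite lee_fin leNgt; apply/negP => x_gt0.
  have xc : 0 < x * c by rewrite mulr_gt0.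
  pose T := (Num.bound (C / (x * c))).+1.
  have T0 : 0 < T%:R :> R by rewrite ltr0n.
  have := Px _ (radial_trial_test (n := n) T0).
  apply/negP; rewrite -ltNge.
  apply: (le_lt_trans (PC T erefl)).
  apply: (@lt_le_trans _ _ (x%:E * c%:E)%E); last first.
    by apply: lee_wpmul2l; [rewrite lee_fin|exact: Pc].
  rewrite -EFinM lte_fin ltr_pdivrMr// mulrC -ltr_pdivrMr//.
  apply: (@lt_le_trans _ _ (Num.bound (C / (x * c)))%:R).
    by apply: archi_boundP; rewrite divr_ge0// ltW.
  by rewrite ler_nat.
apply: ereal_sup_ubound; exists 0 => //; split=> // u _.
by rewrite mul0e; apply: lebesgue_int_ge0 => p; rewrite lee_fin sqr_ge0.
Qed.

End radial_conclusion.

Theorem theorem1 (R : realType) (n : nat) (hn : (1 <= n)%N) :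
  radial_hardy_const R n = 0%E /\ (hardy_const R n < (n%:R ^+ 2)%:E)%E.
Proof. by split; [exact: radial_hardy_const_eq0|exact: hardy_const_lt]. Qed.
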